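(* Let $m\geq 3$ and $n$ be integers such that $$n\geq\begin{cases} m^3-m-3, & \text{if $m$ is even and $n$ is odd},\\ \left\lceil\frac{m^3-2m-5}{2}\right\rceil, & \text{otherwise}.\end{cases}$$ Let $X_{m,n}\subseteq\mathbb{P}^{N}$, $N=(m+1)\binom{n+2}{2}-1$, be the Segre-Veronese variety, i.e. the image of $\mathbb{P}^m\times\mathbb{P}^n$ (over $\mathbb{C}$) under the embedding by $\mathcal{O}(1,2)$. Then for every $s\geq 1$ the secant variety $\sigma_s(X_{m,n})$ is non-defective.
   Context: All varieties are over $\mathbb{C}$. For a variety $X\subseteq\mathbb{P}^N$, its $s$-th secant variety $\sigma_s(X)$ is the Zariski closure of $\bigcup_{P_1,\dots,P_s\in X}\langle P_1,\dots,P_s\rangle$, the union of the linear spans of $s$-tuples of points of $X$. The expected dimension of $\sigma_s(X)$ is $\min\{N,\ s(\dim X+1)-1\}$. The secant variety $\sigma_s(X)$ is called non-defective if its dimension equals the expected dimension, and defective otherwise. Here $\dim X_{m,n}=m+n$. *)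

(* Defs.v *)
From mathcomp Require Import all_boot all_order all_algebra.
From mathcomp Require Import classical_sets.
From mathcomp Require Import mpoly.

Set Implicit Arguments.
Unset Strict Implicit.
Unset Printing Implicit Defensive.

Import GRing.Theory.
Local Open Scope ring_scope.
Local Open Scope classical_set_scope.

Section Projective.
Variables (K : fieldType) (N : nat).

(* A point of the projective space P^N is a line through 0 in K^(N+1). *)
Definition proj := {L : {vspace 'rV[K]_N.+1} | \dim L == 1%N}.

Definition pvanish (f : {mpoly K[N.+1]}) (P : proj) : Prop :=
  forall v, v \in val P -> f.@[v 0] = 0.

Definition zariski_closed (Z : set proj) : Prop :=
  exists S : set {mpoly K[N.+1]},
    (forall f, S f -> exists d, f \is d.-homog) /\
    Z = [set P | forall f, S f -> pvanish f P].

Definition zariski_closure (A : set proj) : set proj :=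
  \bigcap_(Z in [set Z | zariski_closed Z /\ A `<=` Z]) Z.

(* Irreducibility of W in the topology induced from P^N. *)
Definition irreducible_set (W : set proj) : Prop :=
  W !=set0 /\
  forall A B, zariski_closed A -> zariski_closed B ->
    W `<=` A `|` B -> W `<=` A \/ W `<=` B.

(* W is closed in the subspace X of P^N. *)
Definition rel_closed (X W : set proj) : Prop :=
  exists2 Z, zariski_closed Z & W = X `&` Z.

Definition irr_chain (X : set proj) (d : nat) (W : nat -> set proj) : Prop :=
  (forall i, (i <= d)%N -> rel_closed X (W i) /\ irreducible_set (W i)) /\
  (forall i, (i < d)%N -> W i `<` W i.+1).

(* Krull dimension for the topology induced on X; a closed X need not be assumed. *)
Definition has_dim (X : set proj) (d : nat) : Prop :=
  (exists W, irr_chain X d W) /\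
  (forall e W, irr_chain X e W -> (e <= d)%N).

Definition secant_variety (s : nat) (X : set proj) : set proj :=
  zariski_closure
    [set Q | exists2 P : 'I_s -> proj,
       (forall i, X (P i)) & (val Q <= \sum_(i < s) val (P i))%VS].

(* N and d are the dimensions of the ambient space and of the variety. *)
Definition expected_dim (s d : nat) : nat := (minn N (s * d.+1 - 1))%N.

Definition nondefective (s : nat) (X : set proj) : Prop :=
  exists2 d, has_dim X d & has_dim (secant_variety s X) (expected_dim s d).

End Projective.

Section SegreVeronese.
Variables (K : fieldType) (m n : nat).

Definition sv_N : nat := (m.+1 * 'C(n.+2, 2)).-1%N.

(* Labels (i, (j, k)), j <= k, of the monomials x_i y_j y_k of bidegree (1,2). *)
Definition sv_index : finType :=
  ('I_m.+1 * {jk : 'I_n.+1 * 'I_n.+1 | (jk.1 <= jk.2)%N})%type.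

Lemma card_sv_index : #|sv_index| = sv_N.+1.
Proof.
rewrite card_prod card_ord card_sig /sv_N prednK ?muln_gt0 ?bin_gt0 //.
congr (_ * _)%N.
have -> : #|[pred jk : 'I_n.+1 * 'I_n.+1 | (jk.1 <= jk.2)%N]| =
  (\sum_(k < n.+1) \sum_(j < n.+1 | (j <= k)%N) 1)%N.
  rewrite -sum1_card (exchange_big_dep predT) //=.
  by rewrite pair_big_dep.
rewrite -bin2_sum big_nat_recl // add0n big_mkord.
apply: eq_bigr => k _; under eq_bigl do rewrite -ltnS.
by rewrite (big_ord_narrow (ltn_ord k)) sum1_card card_ord.
Qed.

(* The image of ([x], [y]) under O(1,2), in coordinates. *)
Definition sv_vec (x : 'rV[K]_m.+1) (y : 'rV[K]_n.+1) : 'rV[K]_sv_N.+1 :=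
  \row_c let: (i, jk) := enum_val (cast_ord (esym card_sv_index) c) in
         x 0 i * y 0 (val jk).1 * y 0 (val jk).2.

Definition segre_veronese : set (proj K sv_N) :=
  [set Q | exists x y, [/\ x != 0, y != 0 & val Q = <[sv_vec x y]>%VS]].

End SegreVeronese.

(* Main.v *)
(** A linear form on the ambient space of the Segre-Veronese variety is a trilinear
form f on V x Y x Y, symmetric in the last two arguments, where V and Y have dimensions
m+1 and n+1. It vanishes on the tangent space at (x, y) iff f x y _ = 0 and
f _ y y = 0. The rank of a sum of tangent spaces bounds the dimension of a secant
variety from below, and counting polynomial functions of given degree bounds it from
above. It therefore suffices to find b points with independent tangent spaces and b+1
points whose tangent spaces span, for the critical number b.

Split Y as the sum of a space U of dimension about m and t planes L. Each plane carries
a group of m+1 points (x_j, y_j) with y_0, y_1 a basis of L and y_j, for j >= 2, in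
general position in the span of L and a vector u_j of U; finitely many further points
(e_q, eta_q) lie in V x U. For generic parameters a form that is singular at all these
points and vanishes on V x U x U is zero. When x_1 lies on the line through x_0 and e_q,
and the sum of the u_j is eta_q, every group imposes the conditions
sum A_j f(x_1, u_j, u_j) = 0 and sum A'_j f(x_0, u_j, u_j) = 0 on the restriction of f to
V x U x U. In a limit position each of them involves a single u_j, which can be chosen
freely, and the lower bound on n provides enough groups to kill this restriction. Forms
on V x U x U can instead be killed by adding the right number of vectors to the tangent
spaces, which gives independence. *)

Require Import Defs.
From mathcomp Require Import all_boot all_order all_algebra.
From mathcomp Require Import fingroup perm boolp classical_sets mpoly.
From mathcomp Require Import zify ring.

Set Implicit Arguments.
Unset Strict Implicit.
Unset Printing Implicit Defensive.

Import Order.TTheory GRing.Theory Num.Theory.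
Local Open Scope ring_scope.
Local Open Scope classical_set_scope.

(** * Polynomial functions and generic conditions *)

(** The parity of n - m fixes dim U: it is m-1 if m and n have the same parity and m otherwise. In
    the first case the m-1 vectors u_2, ..., u_m of a group span U, so the group settles V x U x L
    by itself. In the second case they span only a hyperplane. Modulo it a form on V x U x L has
    2(m+1) coefficients, of which the points of the group remove m+1 and each further point (e_q,
    eta_q) removes two. For m+1 = 2h exactly h further points are needed; for m = 2h, h points leave
    one coefficient per group, and h+1 points are one condition too many. For independence the
    missing coefficient is removed by one added vector per group. For spanning one further point is
    added to the minimal number, and the surplus per group reappears as conditions on V x U x U: two
    in general, but only one if m is even and n is odd. This is why the bound on n is about twice as
    large there. In each case it compares the forms on V x U x U singular at the further points with
    the 2t or t conditions available. All requirements on the parameters are Zariski open, so each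
    may be witnessed at its own, possibly degenerate, parameters. *)

Section PolynomialFunctions.
Variable K : numFieldType.

Lemma poly_nonroot (p : {poly K}) : p != 0 -> exists t, p.[t] != 0.
Proof.
move=> p0; pose rs := [seq (i%:R : K) | i <- iota 0 (size p)].
have urs : uniq rs.
  rewrite map_inj_uniq ?iota_uniq // => i j /eqP.
  by rewrite eqr_nat => /eqP.
have : ~~ all (root p) rs.
  apply/negP => ars.
  by have := max_poly_roots p0 ars urs; rewrite size_map size_iota ltnn.
by rewrite -has_predC => /hasP[t _ /= pt]; exists t.
Qed.

Variable I : Type.
Implicit Types (F G : (I -> K) -> K) (a b : I -> K).

(** Polynomiality is tested on lines only. This makes sense for an infinite index type [I], and it
    is enough for finding common nonzeros and for interpolation on a grid. *)
Definition pdeg (D : nat) F := forall a b,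
  exists2 p : {poly K}, (size p <= D.+1)%N &
    forall t, F (fun i => a i + t * (b i - a i)) = p.[t].

Lemma pdeg_le D E F : (D <= E)%N -> pdeg D F -> pdeg E F.
Proof.
move=> DE FD a b; have [p sp Fp] := FD a b.
by exists p => //; apply: leq_trans sp _.
Qed.

Lemma pdeg_const D (c : K) : pdeg D (fun=> c).
Proof.
move=> a b; exists c%:P; last by move=> t; rewrite hornerC.
by apply: leq_trans (size_polyC_leq1 _) _.
Qed.

Lemma pdeg_var i : pdeg 1 (fun a => a i).
Proof.
move=> a b; exists ((b i - a i)%:P * 'X + (a i)%:P).
  by rewrite size_MXaddC; case: ifP => // _; rewrite ltnS size_polyC_leq1.
by move=> t; rewrite !hornerE addrC mulrC.
Qed.

Lemma pdeg_add D F G : pdeg D F -> pdeg D G -> pdeg D (fun a => F a + G a).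
Proof.
move=> FD GD a b; have [p sp Fp] := FD a b; have [q sq Gq] := GD a b.
exists (p + q); last by move=> t; rewrite hornerD Fp Gq.
by apply: leq_trans (size_polyD _ _) _; rewrite geq_max sp.
Qed.

Lemma pdeg_mul D E F G : pdeg D F -> pdeg E G ->
  pdeg (D + E) (fun a => F a * G a).
Proof.
move=> FD GD a b; have [p sp Fp] := FD a b; have [q sq Gq] := GD a b.
exists (p * q); last by move=> t; rewrite hornerM Fp Gq.
by apply: leq_trans (size_polyMleq _ _) _; lia.
Qed.

Lemma pdeg_sum D (J : Type) (r : seq J) (P : pred J) (F : J -> (I -> K) -> K) :
  (forall j, P j -> pdeg D (F j)) ->
  pdeg D (fun a => \sum_(j <- r | P j) F j a).
Proof.
move=> FD; elim: r => [|j r IH] a b.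
  exists 0; rewrite ?size_poly0 // => t; by rewrite big_nil horner0.
have [p sp Fp] := IH a b; case Pj: (P j); last first.
  by exists p => // t; rewrite big_cons Pj Fp.
have [q sq Fq] := FD j Pj a b; exists (q + p).
  by apply: leq_trans (size_polyD _ _) _; rewrite geq_max sp andbT.
by move=> t; rewrite big_cons hornerD -Fp -Fq Pj.
Qed.

Lemma pdeg_prod (J : Type) (r : seq J) (D : J -> nat) (F : J -> (I -> K) -> K) :
  (forall j, pdeg (D j) (F j)) ->
  pdeg (\sum_(j <- r) D j) (fun a => \prod_(j <- r) F j a).
Proof.
move=> FD; elim: r => [|j r IH].
  have -> : (fun a => \prod_(j <- [::]) F j a) = (fun=> 1).
    by apply/funext => a; rewrite big_nil.
  exact: pdeg_const.
have -> : (fun a => \prod_(i <- j :: r) F i a) =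
          (fun a => F j a * \prod_(i <- r) F i a).
  by apply/funext => a; rewrite big_cons.
by rewrite big_cons; apply: pdeg_mul.
Qed.

Lemma pdeg_exp D k F : pdeg D F -> pdeg (D * k) (fun a => F a ^+ k).
Proof.
move=> FD; elim: k => [|k IH].
  rewrite muln0; have -> : (fun a => F a ^+ 0) = (fun=> 1).
    by apply/funext => a; rewrite expr0.
  exact: pdeg_const.
have -> : (fun a => F a ^+ k.+1) = (fun a => F a * F a ^+ k).
  by apply/funext => a; rewrite exprS.
by rewrite mulnS; apply: pdeg_mul.
Qed.

Definition polyfun F := exists D, pdeg D F.

Lemma polyfun_const c : polyfun (fun=> c).
Proof. by exists 0; apply: pdeg_const. Qed.

Lemma polyfun_var i : polyfun (fun a => a i).
Proof. by exists 1%N; apply: pdeg_var. Qed.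

Lemma polyfun_add F G : polyfun F -> polyfun G -> polyfun (fun a => F a + G a).
Proof.
move=> [D FD] [E GE]; exists (maxn D E).
by apply: pdeg_add; [apply: pdeg_le FD | apply: pdeg_le GE]; lia.
Qed.

Lemma polyfun_mul F G : polyfun F -> polyfun G -> polyfun (fun a => F a * G a).
Proof. by move=> [D FD] [E GE]; exists (D + E)%N; apply: pdeg_mul. Qed.

Lemma polyfun_opp F : polyfun F -> polyfun (fun a => - F a).
Proof.
move=> FP; have -> : (fun a => - F a) = (fun a => -1 * F a).
  by apply/funext => a; rewrite mulN1r.
by apply: polyfun_mul => //; apply: polyfun_const.
Qed.

Lemma polyfun_sum (J : Type) (r : seq J) (P : pred J) (F : J -> (I -> K) -> K) :
  (forall j, polyfun (F j)) -> polyfun (fun a => \sum_(j <- r | P j) F j a).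
Proof.
move=> FP; elim: r => [|j r IH].
  have -> : (fun a => \sum_(j <- [::] | P j) F j a) = (fun=> 0).
    by apply/funext => a; rewrite big_nil.
  exact: polyfun_const.
have -> : (fun a => \sum_(i <- j :: r | P i) F i a) =
  (fun a => (if P j then F j a else 0) + \sum_(i <- r | P i) F i a).
  by apply/funext => a; rewrite big_cons; case: ifP; rewrite ?add0r.
by apply: polyfun_add => //; case: (P j); [|apply: polyfun_const].
Qed.

Lemma polyfun_prod (J : Type) (r : seq J) (F : J -> (I -> K) -> K) :
  (forall j, polyfun (F j)) -> polyfun (fun a => \prod_(j <- r) F j a).
Proof.
move=> FP; elim: r => [|j r IH].
  have -> : (fun a => \prod_(j <- [::]) F j a) = (fun=> 1).
    by apply/funext => a; rewrite big_nil.
  exact: polyfun_const.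
have -> : (fun a => \prod_(i <- j :: r) F i a) =
          (fun a => F j a * \prod_(i <- r) F i a).
  by apply/funext => a; rewrite big_cons.
exact: polyfun_mul.
Qed.

Lemma polyfun_det k (M : (I -> K) -> 'M[K]_k) :
  (forall i j, polyfun (fun a => M a i j)) -> polyfun (fun a => \det (M a)).
Proof.
move=> MP; apply: polyfun_sum => s.
by apply: polyfun_mul; [apply: polyfun_const | apply: polyfun_prod].
Qed.

(* [gen P]: the set of parameters satisfying P contains a nonempty Zariski open
   subset of the affine space of parameters. *)
Definition gen (P : (I -> K) -> Prop) := exists F,
  [/\ polyfun F, exists a, F a != 0 & forall a, F a != 0 -> P a].

Lemma gen_ex P : gen P -> exists a, P a.
Proof. by move=> [F [_ [a Fa] FP]]; exists a; apply: FP. Qed.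

Lemma gen_imp (P Q : (I -> K) -> Prop) :
  (forall a, P a -> Q a) -> gen P -> gen Q.
Proof. by move=> PQ [F [Fp Fa FP]]; exists F; split => // a /FP /PQ. Qed.

Lemma gen_neq0 F a : polyfun F -> F a != 0 -> gen (fun a => F a != 0).
Proof. by move=> Fp Fa; exists F; split => //; exists a. Qed.

Lemma gen_true : gen (fun=> True).
Proof.
exists (fun=> 1); split => //; first exact: polyfun_const.
by exists (fun=> 0); apply: oner_neq0.
Qed.

(** Irreducibility of affine space: on the line from a point with [F] nonzero to a point with [G]
    nonzero both functions become nonzero polynomials in t, and so does their product. *)
Lemma gen_and P Q : gen P -> gen Q -> gen (fun a => P a /\ Q a).
Proof.
move=> [F [Fp [a Fa] FP]] [G [Gp [b Gb] GQ]].
exists (fun a => F a * G a); split; first exact: polyfun_mul.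
- have [[D FD] [E GE]] := (Fp, Gp).
  have [p _ Fl] := FD a b; have [q _ Gl] := GE a b.
  have p0 : p != 0.
    apply: contraNneq Fa => p0; rewrite -(horner0 0) -p0 -Fl; apply/eqP.
    by congr F; apply/funext => i; rewrite mul0r addr0.
  have q0 : q != 0.
    apply: contraNneq Gb => q0; rewrite -(horner0 1) -q0 -Gl; apply/eqP.
    by congr G; apply/funext => i; rewrite mul1r addrC subrK.
  have [t] := poly_nonroot (mulf_neq0 p0 q0).
  by rewrite hornerM -Fl -Gl; exists (fun i => a i + t * (b i - a i)).
- by move=> c; rewrite mulf_eq0 negb_or => /andP[/FP ? /GQ].
Qed.

Lemma gen_all (J : finType) (P : J -> (I -> K) -> Prop) :
  (forall j, gen (P j)) -> gen (fun a => forall j, P j a).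
Proof.
move=> PG; suff: gen (fun a => forall j, j \in enum J -> P j a).
  by apply: gen_imp => a Pa j; apply: Pa; rewrite mem_enum.
elim: (enum J) => [|j r IH]; first by apply: gen_imp gen_true.
apply: gen_imp (gen_and (PG j) IH) => a [Pj Pr] k.
by rewrite inE => /predU1P[->|/Pr].
Qed.

(** A one-sided inverse [B] of the matrix at [a0] turns injectivity into the nonvanishing of the
    single polynomial function det(A a B), which is 1 at [a0]. *)
Lemma gen_inj (J E : finType) (M : (I -> K) -> E -> J -> K) (a0 : I -> K) :
  (forall e j, polyfun (fun a => M a e j)) ->
  (forall w, (forall e, \sum_j M a0 e j * w j = 0) -> forall j, w j = 0) ->
  gen (fun a =>
    forall w, (forall e, \sum_j M a e j * w j = 0) -> forall j, w j = 0).
Proof.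
move=> MP inj0.
pose A a : 'M[K]_(#|J|, #|E|) := \matrix_(j, e) M a (enum_val e) (enum_val j).
have AE a (w : 'rV_#|J|) e : (w *m A a) 0 e =
    \sum_j M a (enum_val e) j * w 0 (enum_rank j).
  rewrite mxE (reindex _ (onW_bij _ (@enum_val_bij J))) /=.
  by apply: eq_bigr => j _; rewrite mxE enum_valK mulrC.
have /row_freeP[B AB] : row_free (A a0).
  apply: inj_row_free => w wA; apply/rowP => j.
  rewrite mxE -(enum_valK j).
  apply: (inj0 (fun j => w 0 (enum_rank j))) => e.
  by rewrite -(enum_rankK e) -AE wA mxE.
apply: (@gen_imp (fun a => \det (A a *m B) != 0)); last first.
  apply: (@gen_neq0 _ a0); last by rewrite AB det1 oner_neq0.
  apply: polyfun_det => i j.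
  have -> : (fun a => (A a *m B) i j) =
      (fun a => \sum_e M a (enum_val e) (enum_val i) * B e j).
    by apply/funext => a; rewrite mxE; apply: eq_bigr => e _; rewrite mxE.
  by apply: polyfun_sum => e; apply: polyfun_mul => //; apply: polyfun_const.
move=> a; rewrite -unitfE -unitmxE => uAB w wM j.
pose v : 'rV_#|J| := \row_j w (enum_val j).
have vA : v *m A a = 0.
  apply/rowP => e; rewrite AE [RHS]mxE; apply: etrans (wM (enum_val e)).
  by apply: eq_bigr => k _; rewrite mxE enum_rankK.
have : v *m (A a *m B) = 0 by rewrite mulmxA vA mul0mx.
move/(congr1 (mulmx^~ (invmx (A a *m B)))); rewrite mulmxK // mul0mx.
by move/rowP/(_ (enum_rank j)); rewrite !mxE enum_rankK.
Qed.

End PolynomialFunctions.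

Section Grid.
Variables (K : numFieldType) (I : finType).

Lemma grid_vanish D (F : (I -> K) -> K) : pdeg D F ->
  (forall g : {ffun I -> 'I_D.+1}, F (fun i => (g i)%:R) = 0) ->
  forall a, F a = 0.
Proof.
move=> FD Fg.
(* Coordinates are freed one at a time: those outside [r] still take grid values, and along one
   coordinate a polynomial of degree at most [D] has D+1 roots. *)
suff H (r : seq I) : forall a, (forall i, i \notin r ->
    exists k : 'I_D.+1, a i = k%:R) -> F a = 0.
  by move=> a; apply: (H (enum I)) => i; rewrite mem_enum.
elim: r => [|i r IH] a ar.
  have /choice[g ag] : forall i, exists k : 'I_D.+1, a i = k%:R.
    by move=> i; apply: ar.
  have -> : a = (fun i => ([ffun i => g i] i)%:R).
    by apply/funext => i; rewrite ffunE ag.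
  exact: Fg.
pose a0 j := if j == i then 0 else a j; pose a1 j := if j == i then 1 else a j.
have [p sp Fp] := FD a0 a1.
have lineE t : (fun j => a0 j + t * (a1 j - a0 j)) =
    (fun j => if j == i then t else a j).
  apply/funext => j; rewrite /a0 /a1; case: eqP => _.
    by rewrite subr0 mulr1 add0r.
  by rewrite subrr mulr0 addr0.
have p0 : p = 0.
  apply/eqP/contraT => p0.
  pose rs := [seq (k%:R : K) | k <- iota 0 D.+1].
  have urs : uniq rs.
    rewrite map_inj_uniq ?iota_uniq // => k l /eqP.
    by rewrite eqr_nat => /eqP.
  have ars : all (root p) rs.
    apply/allP => x /mapP[k]; rewrite mem_iota add0n => /= kD ->.
    rewrite /root -Fp lineE; apply/eqP/IH => j jr.
    case: eqVneq => [_|ji]; first by exists (Ordinal kD).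
    by apply: ar; rewrite inE negb_or ji.
  have := max_poly_roots p0 ars urs; rewrite size_map size_iota.
  by rewrite ltnNge sp.
have -> : a = (fun j => if j == i then a i else a j).
  by apply/funext => j; case: eqP => // ->.
by rewrite -lineE Fp p0 horner0.
Qed.

End Grid.

(** * Homogeneous forms on projective space *)

Section ProjectiveSets.
Variables (K : numFieldType) (N : nat).
Implicit Types (f g : {mpoly K[N.+1]}) (P Q : proj K N) (v : 'rV[K]_N.+1).

Lemma exists_proj v : v != 0 -> exists Q : proj K N, val Q = <[v]>%VS.
Proof.
move=> v0; have d1 : \dim <[v]>%VS == 1%N by rewrite dim_vline v0.
by exists (exist _ <[v]>%VS d1).
Qed.

Lemma proj_line Q : exists2 v, v != 0 & val Q = <[v]>%VS.
Proof.
case: Q => L /= /eqP dL; exists (vpick L).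
  by rewrite vpick0 -dimv_eq0 dL.
apply/esym/eqP; rewrite eqEdim -memvE memv_pick dL dim_vline vpick0.
by rewrite -dimv_eq0 dL.
Qed.

Lemma meval_homogZ d f c v : f \is d.-homog ->
  f.@[(c *: v) 0] = c ^+ d * f.@[v 0].
Proof.
move=> /dhomogP fd; rewrite !mevalE mulr_sumr.
rewrite !(big_seq_cond xpredT); apply: eq_bigr => m /andP[mf _].
have <- : mdeg m = d by exact: fd.
rewrite mulrCA mdegE -prodrXr -big_split /=; congr (_ * _).
by apply: eq_bigr => i _; rewrite mxE exprMn.
Qed.

Lemma pvanish_line d f Q v : f \is d.-homog -> val Q = <[v]>%VS ->
  pvanish f Q <-> f.@[v 0] = 0.
Proof.
move=> fd Qv; split=> [fQ | fv w].
  by apply: fQ; rewrite Qv memv_line.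
by rewrite Qv => /vlineP[c ->]; rewrite (meval_homogZ _ _ fd) fv mulr0.
Qed.

Lemma zero_locus_closed (S : set {mpoly K[N.+1]}) :
  (forall f, S f -> exists d, f \is d.-homog) ->
  zariski_closed [set P | forall f, S f -> pvanish f P].
Proof. by move=> Sh; exists S. Qed.

Lemma irreducible_mul (W : set (proj K N)) d e f g :
  irreducible_set W -> f \is d.-homog -> g \is e.-homog ->
  (forall P, W P -> pvanish (f * g) P) ->
  (forall P, W P -> pvanish f P) \/ (forall P, W P -> pvanish g P).
Proof.
move=> [_ Wirr] fd ge fgW.
have cl (h : {mpoly K[N.+1]}) k : h \is k.-homog ->
    zariski_closed [set P | forall q, q = h -> pvanish q P].
  by move=> hk; apply: (@zero_locus_closed (fun q => q = h)) => _ ->; exists k.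
case: (Wirr _ _ (cl f d fd) (cl g e ge)) => [P WP | Wf | Wg].
- have [v _ Pv] := proj_line P.
  have /(pvanish_line (dhomogM fd ge) Pv) := fgW P WP.
  rewrite mevalM => /eqP; rewrite mulf_eq0 => /orP[] /eqP z.
    by left => _ ->; apply/(pvanish_line fd Pv).
  by right => _ ->; apply/(pvanish_line ge Pv).
- by left => P /Wf; apply.
- by right => P /Wg; apply.
Qed.

Lemma pdeg_meval (I : Type) (psi : (I -> K) -> 'rV[K]_N.+1) D d f :
  (forall j, pdeg D (fun a => psi a 0 j)) -> f \is d.-homog ->
  pdeg (D * d) (fun a => f.@[psi a 0]).
Proof.
move=> psiD /dhomogP fd.
have -> : (fun a => f.@[psi a 0]) = (fun a => \sum_(m <- msupp f |
    m \in msupp f) f@_m * \prod_i psi a 0 i ^+ m i).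
  by apply/funext => a; rewrite mevalE big_seq_cond; under eq_bigl do rewrite andbT.
apply: pdeg_sum => m mf; rewrite -[(D * d)%N]add0n.
apply: pdeg_mul; first exact: pdeg_const.
have <- : mdeg m = d by exact: fd.
rewrite mdegE big_distrr /=.
by apply: pdeg_prod => i; apply: pdeg_exp.
Qed.

Lemma linear_dependency (T G : finType) (M : T -> G -> K) : (#|G| < #|T|)%N ->
  exists c : T -> K, (exists t, c t != 0) /\
    forall x : G, \sum_t c t * M t x = 0.
Proof.
move=> GT; pose A : 'M[K]_(#|T|, #|G|) := \matrix_(t, g) M (enum_val t) (enum_val g).
have /rowV0Pn[w /sub_kermxP wA w0] : kermx A != 0.
  rewrite kermx_eq0 /row_free; apply: contraTneq GT => <-.
  by rewrite -leqNgt rank_leq_col.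
exists (fun t => w 0 (enum_rank t)); split.
  by case/rV0Pn: w0 => i wi; exists (enum_val i); rewrite enum_valK.
move=> x; move/rowP/(_ (enum_rank x)): wA; rewrite [RHS]mxE mxE => wA.
apply: etrans wA; rewrite (reindex _ (onW_bij _ (@enum_val_bij T))) /=.
by apply: eq_bigr => t _; rewrite !mxE enum_rankK enum_valK.
Qed.

(** Pulled back along [psi], forms of degree [d] have degree at most D d in the parameters and are
    determined by their values on a grid of (D d + 1)^|I| points. More forms than grid points are
    therefore dependent. *)
Lemma homog_relation (I T : finType) (psi : (I -> K) -> 'rV[K]_N.+1) D d
    (p : T -> {mpoly K[N.+1]}) :
  (forall j, pdeg D (fun a => psi a 0 j)) -> (forall t, p t \is d.-homog) ->
  ((D * d).+1 ^ #|I| < #|T|)%N ->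
  exists c : T -> K, (exists t, c t != 0) /\
    forall a, (\sum_t c t *: p t).@[psi a 0] = 0.
Proof.
move=> psiD pd dT.
have [|c [c0 cM]] := @linear_dependency T {ffun I -> 'I_(D * d).+1}
  (fun t x => (p t).@[psi (fun i => (x i)%:R) 0]).
  by rewrite card_ffun card_ord.
exists c; split => //.
have pD : (\sum_t c t *: p t) \is d.-homog.
  by apply: rpred_sum => t _; apply: dhomogZ.
apply: (grid_vanish (pdeg_meval psiD pD)) => x.
by rewrite raddf_sum -[RHS](cM x); apply: eq_bigr => t _ /=; rewrite mevalZ.
Qed.

End ProjectiveSets.

(** * Upper bound for the dimension *)

Section ChainBound.
Variables (K : numFieldType) (N : nat) (X : set (proj K N)).
Variables (e : nat) (W : nat -> set (proj K N)).
Hypothesis chainW : irr_chain X e W.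

Let W_irr i : (i <= e)%N -> irreducible_set (W i).
Proof. by case: chainW => cW _ /cW[]. Qed.

Let W_incr i : (i < e)%N -> W i `<=` W i.+1.
Proof. by case: chainW => _ cW /cW []. Qed.

(** A point of W (i+1) outside W i still lies in [X], so one of the homogeneous equations that cut W
    i out of [X] fails there. *)
Lemma chain_separation i : (i < e)%N -> exists h : {mpoly K[N.+1]} * nat,
  [/\ h.1 \is (h.2).-homog, forall P, W i P -> pvanish h.1 P &
      exists2 P, W i.+1 P & ~ pvanish h.1 P].
Proof.
move=> ie; case: chainW => cW sW.
have [[Z [S [Sh ->]] WiE] _] := cW i (ltnW ie).
have [[Z' _ Wi1E] _] := cW i.+1 ie.
have [_ /existsNP[P /not_implyP[WP]]] := sW i ie; rewrite WiE.
have XP : X P by move: WP; rewrite Wi1E => -[].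
move=> nP; have /existsNP[f /not_implyP[Sf nf]] : ~ (forall f, S f -> pvanish f P).
  by move=> h; apply: nP.
have [d fd] := Sh f Sf; exists (f, d); split => //; last by exists P.
by move=> Q [_]; apply.
Qed.

(* Independence over W e of the monomials in the separating forms h_i, filled up
   to a common degree with a coordinate that does not vanish on W 0: the lowest
   power of h_(J) can be cancelled on W J.+1, and the remaining terms divisible by
   h_(J) disappear on W J. *)
Lemma chain_independence : exists (w : nat) (dl : 'I_e -> nat),
  (forall i, dl i <= w)%N /\
  forall r, exists p : {ffun 'I_e -> 'I_r} -> {mpoly K[N.+1]},
    (forall a, p a \is (r * (e * w)).-homog) /\
    forall c, (exists a, c a != 0) ->
      exists2 P, W e P & ~ pvanish (\sum_a c a *: p a) P.
Proof.
have /choice[hd hP] : forall i, exists h : {mpoly K[N.+1]} * nat, (i < e)%N ->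
    [/\ h.1 \is (h.2).-homog, forall P, W i P -> pvanish h.1 P &
      exists2 P, W i.+1 P & ~ pvanish h.1 P].
  move=> i; case: (ltnP i e) => ie; last by exists (0, 0%N).
  by have [h hP] := chain_separation ie; exists h.
pose h i := (hd i).1; pose dl i := (hd i).2.
have [[P0 WP0] _] := W_irr (leq0n e).
have [v0 v0n P0v] := proj_line P0.
have /rV0Pn[l vl] := v0n.
have lvan : ~ pvanish 'X_l P0.
  by move/(_ v0); rewrite P0v memv_line mevalXU => /(_ isT) v0l; rewrite v0l eqxx in vl.
have lh : ('X_l : {mpoly K[N.+1]}) \is 1.-homog.
  by rewrite dhomogX; apply/eqP/mdeg1.
pose w := \max_(i < e) dl i.
have dlw (i : 'I_e) : (dl i <= w)%N by apply: leq_bigmax_cond.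
exists w, (fun i => dl i); split => // r.
pose E := (r * (e * w))%N.
pose ep (a : {ffun 'I_e -> 'I_r}) := (E - \sum_(i < e) dl i * a i)%N.
have epE (a : {ffun 'I_e -> 'I_r}) : (\sum_(i < e) dl i * a i + ep a = E)%N.
  rewrite subnKC // /E mulnCA -[X in (X * _)%N](card_ord e) -sum_nat_const.
  by apply: leq_sum => i _; rewrite mulnC leq_mul // ltnW.
pose mon J (a : {ffun 'I_e -> 'I_r}) : {mpoly K[N.+1]} :=
  \prod_(i < e | (i < J)%N) h i ^+ a i * 'X_l ^+ ep a.
have hprod J (a : {ffun 'I_e -> 'I_r}) :
    \prod_(i < e | (i < J)%N) h i ^+ a i \is
      (\sum_(i < e | (i < J)%N) dl i * a i).-homog.
  apply: (big_rec2 (fun (p : {mpoly K[N.+1]}) n => p \is n.-homog)).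
    exact: dhomog1.
  move=> i n p iJ pn; apply: dhomogM => //; apply: dhomogMn.
  by have [] := hP i (ltn_ord i).
have Xep (a : {ffun 'I_e -> 'I_r}) :
    ('X_l : {mpoly K[N.+1]}) ^+ ep a \is (ep a).-homog.
  by rewrite -[X in X.-homog]mul1n; apply: dhomogMn.
exists (mon e); split.
  move=> a; rewrite -/E -(epE a); apply: dhomogM => //.
  have -> : (\sum_(i < e) dl i * a i = \sum_(i < e | (i < e)%N) dl i * a i)%N.
    by apply: eq_bigl => i; rewrite ltn_ord.
  exact: hprod.
move=> c [a0 ca0]; apply: contrapT => nvan.
have van P : W e P -> pvanish (\sum_(a in [set a | c a != 0]%SET) c a *: mon e a) P.
  move=> WP; apply: contrapT => nP; apply: nvan; exists P => // van; apply: nP.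
  have -> // : \sum_(a in [set a | c a != 0]%SET) c a *: mon e a = \sum_a c a *: mon e a.
  rewrite [RHS](bigID (mem [set a | c a != 0]%SET)) /= [X in _ + X]big1 ?addr0 //.
  by move=> a; rewrite inE negbK => /eqP ->; rewrite scale0r.
(* Downward induction on [J]. [A] is a nonempty set of exponents with nonzero coefficients that
   agree from index [J] on, and the combination of their monomials, truncated to the first [J]
   forms, vanishes on W J. At J = 0 a multiple of one power of ['X_l] is left, which does not vanish
   at [P0]. *)
suff H J : (J <= e)%N -> exists (A : {set {ffun 'I_e -> 'I_r}}) (D : nat),
    [/\ A != finset.set0, {in A, forall a, c a != 0},
        {in A &, forall a b : {ffun 'I_e -> 'I_r}, forall i : 'I_e, (J <= i)%N -> a i = b i},
        {in A, forall a : {ffun 'I_e -> 'I_r}, \sum_(i < e | (i < J)%N) dl i * a i + ep a = D}%N &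
        forall P, W J P -> pvanish (\sum_(a in A) c a *: mon J a) P].
  have [A [D [/set0Pn[a aA] cA eqA _ vA]]] := H 0%N (leq0n e).
  have AE : A = [set a]%SET.
    apply/setP => b; rewrite inE; apply/idP/eqP => [bA | -> //].
    by apply/ffunP => i; apply: eqA.
  have := vA P0 WP0; rewrite AE big_set1 /mon big_pred0; last by move=> i; rewrite ltn0.
  rewrite mul1r => /(_ v0); rewrite P0v memv_line => /(_ isT) /eqP.
  rewrite mevalZ rmorphXn /= mevalXU mulf_eq0 (negPf (cA a aA)) /=.
  by rewrite expf_eq0 (negPf vl) andbF.
move=> Je; rewrite -(subKn Je); elim: (e - J)%N (leq_subr J e) => [_ | k IH ke].
  rewrite subn0; exists [set a | c a != 0]%SET, E; split => //.
  - by apply/set0Pn; exists a0; rewrite inE.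
  - by move=> a; rewrite inE.
  - by move=> a b _ _ i; rewrite leqNgt ltn_ord.
  - move=> a _; rewrite -(epE a); congr (_ + _)%N.
    by apply: eq_bigl => i; rewrite ltn_ord.
have [A [D [/set0Pn[a1 a1A] cA eqA dA vA]]] := IH (ltnW ke).
have JE : (e - k = (e - k.+1).+1)%N by lia.
move: eqA dA vA; rewrite JE; set J' := (e - k.+1)%N => eqA dA vA.
have J'e : (J' < e)%N by lia.
have [hh hW [Q WQ hQ]] := hP J' J'e.
pose j := Ordinal J'e.
have [b bA bmin] : {b : {ffun 'I_e -> 'I_r} | b \in A & forall a, a \in A -> (b j <= a j)%N}.
  case: (@arg_minnP _ a1 (mem A) (fun a : {ffun 'I_e -> 'I_r} => a j : nat) a1A).
  by move=> b bA bm; exists b.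
have splitS (a : {ffun 'I_e -> 'I_r}) : (\sum_(i < e | (i < J'.+1)%N) dl i * a i =
    dl J' * a j + \sum_(i < e | (i < J')%N) dl i * a i)%N.
  rewrite (bigD1 j) //=; congr (_ + _)%N.
  by apply: eq_bigl => i; rewrite -val_eqE /=; lia.
have monS (a : {ffun 'I_e -> 'I_r}) : mon J'.+1 a = h J' ^+ a j * mon J' a.
  rewrite /mon (bigD1 j) //= -!mulrA; congr (_ * (_ * _)).
  by apply: eq_bigl => i; rewrite -val_eqE /=; lia.
(* The combination divided by the lowest power of h J' that occurs. As W (J'+1) is irreducible and h
   J' does not vanish on it, [R] does. *)
pose R := \sum_(a in A) c a *: (h J' ^+ (a j - b j) * mon J' a).
have Rh : R \is (D - dl J' * b j).-homog.
  apply: rpred_sum => a aA; apply: dhomogZ.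
  have -> : (D - dl J' * b j =
      dl J' * (a j - b j) + (\sum_(i < e | (i < J')%N) dl i * a i + ep a))%N.
    rewrite -(dA a aA) splitS mulnBr -addnA [RHS]addnBAC //.
    by rewrite leq_mul2l bmin ?orbT.
  by apply: dhomogM; [apply: dhomogMn | apply: dhomogM].
have sumE : \sum_(a in A) c a *: mon J'.+1 a = h J' ^+ b j * R.
  rewrite mulr_sumr; apply: eq_bigr => a aA.
  by rewrite monS -scalerAr [X in _ = c a *: X]mulrA -exprD subnKC ?bmin.
have WR P : W J' P -> pvanish R P.
  move=> WP.
  have hb : h J' ^+ b j \is (dl J' * b j).-homog by apply: dhomogMn.
  case: (irreducible_mul (W_irr J'e) hb Rh); first by rewrite -sumE.
    move/(_ Q WQ); have [u _ Qu] := proj_line Q.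
    move/(pvanish_line hb Qu); rewrite rmorphXn => /eqP /=.
    rewrite expf_eq0 => /andP[_ /eqP hu].
    by case: hQ; apply/(pvanish_line hh Qu).
  by move/(_ P); apply; apply: W_incr.
exists [set a in A | a j == b j]%SET, (D - dl J' * b j)%N; split.
- by apply/set0Pn; exists b; rewrite inE bA eqxx.
- by move=> a; rewrite inE => /andP[/cA].
- move=> a a'; rewrite !inE => /andP[aA /eqP aj] /andP[a'A /eqP a'j] i.
  rewrite leq_eqVlt => /predU1P[Ji | Ji]; last exact: eqA.
  have -> : i = j by apply/val_inj.
  by rewrite aj a'j.
- move=> a; rewrite inE => /andP[aA /eqP aj].
  by rewrite -(dA a aA) splitS aj; lia.
- move=> P WP v vP; have := WR P WP v vP.
  have hv : (h J').@[v 0] = 0 by apply: hW vP.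
  rewrite !raddf_sum (bigID (fun a : {ffun 'I_e -> 'I_r} => a j == b j)) /=.
  rewrite [X in _ + X]big1 ?addr0 => [Rv | a /andP[aA ajb]]; last first.
    rewrite mevalZ mevalM rmorphXn /= hv expr0n.
    have -> : (a j - b j == 0)%N = false.
      apply/negbTE; rewrite subn_eq0 -ltnNge ltn_neqAle eq_sym (bmin a aA) andbT.
      by rewrite val_eqE.
    by rewrite mul0r mulr0.
  apply: etrans Rv; apply: eq_big => [a | a]; first by rewrite inE.
  by rewrite inE => /andP[_ /eqP ->]; rewrite subnn expr0 mul1r.
Qed.

Lemma leq_exp_base k a b : (a <= b -> a ^ k <= b ^ k)%N.
Proof. by case: k => [//|k] ab; rewrite leq_exp2r. Qed.

(** Dimension as growth rate: r^e monomials stay independent on W e, whereas forms of their degree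
    depend on at most (r s)^|I| values in the parameters. For e > |I| this is too few as soon as r >
    s^|I|. *)
Lemma chain_length (I : finType) (psi : (I -> K) -> 'rV[K]_N.+1) D :
  (forall j, pdeg D (fun a => psi a 0 j)) ->
  (forall f d, f \is d.-homog -> (forall a, f.@[psi a 0] = 0) ->
     forall P, X P -> pvanish f P) ->
  (e <= #|I|)%N.
Proof.
move=> psiD psiX; rewrite leqNgt; apply/negP => Ie.
have [w [dl [_ H]]] := chain_independence.
pose s := (D * (e * w)).+1; pose r := (s ^ #|I|).+1.
have [p [ph pind]] := H r.
have [|c [c0 cpsi]] := homog_relation psiD ph.
  rewrite card_ffun !card_ord.
  have le1 : ((D * (r * (e * w))).+1 <= r * s)%N.
    by rewrite /s mulnS mulnCA; lia.
  apply: (@leq_ltn_trans ((r * s) ^ #|I|)); first exact: leq_exp_base.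
  rewrite expnMn; apply: (@leq_trans (r ^ #|I|.+1)); last by rewrite leq_pexp2l.
  by rewrite expnSr ltn_pmul2l ?expn_gt0.
have [P WP] := pind c c0; apply.
apply: (psiX _ (r * (e * w))%N) => //.
  by apply: rpred_sum => a _; apply: dhomogZ.
case: chainW => /(_ e (leqnn e))[[Z _ WE] _] _.
by move: WP; rewrite WE => -[].
Qed.

End ChainBound.

(** * Lower bound for the dimension *)

Section MonomialFunctions.
Variables (K : numFieldType) (J : finType) (r : nat).

Lemma poly_eq0_horner (p : {poly K}) : (forall x, p.[x] = 0) -> p = 0.
Proof.
move=> p0; apply/eqP/contraT => /poly_nonroot[x].
by rewrite p0 eqxx.
Qed.

Lemma monomials_independent (c : {ffun J -> 'I_r} -> K) :
  (forall w : J -> K, \sum_b c b * \prod_i w i ^+ b i = 0) -> forall b, c b = 0.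
Proof.
move=> c0 b0.
(* The variables in [s] are eliminated one at a time by comparing coefficients at the exponents of
   [b0]. What remains is the sum of the coefficients of all [b] that agree with [b0] on [s]. *)
suff H (s : seq J) : forall c' : {ffun J -> 'I_r} -> K, uniq s ->
    (forall w : J -> K, \sum_b c' b * \prod_(i <- s) w i ^+ b i = 0) ->
    \sum_(b : {ffun J -> 'I_r} | all (fun i => b i == b0 i) s) c' b = 0.
  have := H (enum J) c (enum_uniq J); rewrite (big_pred1 b0); last first.
    move=> b /=; apply/allP/eqP => [h | -> //].
    by apply/ffunP => i; apply/eqP/h; rewrite mem_enum.
  apply => w; rewrite -[RHS](c0 w); apply: eq_bigr => b _; congr (_ * _).
  by rewrite big_enum.
elim: s => [|i s IH] c' /=.
  move=> _ /(_ (fun=> 0)) H; rewrite -[RHS]H; apply: eq_bigr => b _.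
  by rewrite big_nil mulr1.
case/andP=> is_ us c'0.
under eq_bigl do rewrite andbC.
rewrite big_mkcondr /=.
apply: IH => // w.
pose p : {poly K} := \sum_(b : {ffun J -> 'I_r})
  (c' b * \prod_(k <- s) w k ^+ b k) *: 'X^(b i).
have p0 : p = 0.
  apply: poly_eq0_horner => x; rewrite horner_sum.
  rewrite -[RHS](c'0 (fun k => if k == i then x else w k)).
  apply: eq_bigr => b _; rewrite hornerZ hornerXn big_cons eqxx -mulrA.
  congr (_ * _); rewrite mulrC; congr (_ * _); apply: eq_big_seq => k ks.
  by case: eqVneq => // ki; rewrite -ki ks in is_.
move/(congr1 (fun q : {poly K} => q`_(b0 i))): p0; rewrite coef0 coef_sum => p0.
rewrite -[RHS]p0; apply: eq_bigr => b _; rewrite coefZ coefXn eq_sym val_eqE.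
by case: eqP => _; rewrite ?mulr1 // mulr0 mul0r.
Qed.

End MonomialFunctions.

Section ChainExistence.
Variables (K : numFieldType) (N d D : nat) (X : set (proj K N)).
Variables (psi : ('I_d -> K) -> 'rV[K]_N.+1) (V : 'M[K]_(d.+1, N.+1)).
Hypothesis psiD : forall j, pdeg D (fun a => psi a 0 j).
Hypothesis psiX : forall a (Q : proj K N), psi a != 0 -> val Q = <[psi a]>%VS -> X Q.
Hypothesis Vfree : row_free V.
(** Row 0 of [V] is the value of [psi] at 0 and the other rows are its partial derivatives there. By
    [Vfree] the cone over the image has d+1 independent tangent directions at this point. *)
Hypothesis psiV : forall a : 'I_d -> K, exists q : 'I_N.+1 -> {poly K},
  forall t j, psi (fun i => t * a i) 0 j =
    V 0 j + t * (\sum_i a i * V (lift ord0 i) j) + t ^+ 2 * (q j).[t].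

Let initial k (a : 'I_d -> K) : 'I_d -> K := fun i => if (i < k)%N then a i else 0.

Let initial_pdeg k j : pdeg D (fun a => psi (initial k a) 0 j).
Proof.
move=> a b; have [p sp pE] := psiD j (initial k a) (initial k b).
exists p => // t; rewrite -pE; congr (psi _ 0 j); apply/funext => i.
by rewrite /initial; case: ifP => // _; rewrite subr0 mulr0 addr0.
Qed.

Let vanish k (f : {mpoly K[N.+1]}) := forall a, f.@[psi (initial k a) 0] = 0.

(** The linear forms dual to the rows of [V] are local coordinates on the image: to lowest order in
    t they are 1 and the t a_i. The first one serves to homogenize. *)
Lemma dual_forms : exists l : 'I_d.+1 -> {mpoly K[N.+1]},
  (forall i, l i \is 1.-homog) /\
  forall a : 'I_d -> K, exists q : 'I_d.+1 -> {poly K}, forall t,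
    (l ord0).@[psi (fun i => t * a i) 0] = 1 + t * (q ord0).[t] /\
    forall i, (l (lift ord0 i)).@[psi (fun i => t * a i) 0] =
      t * (a i + t * (q (lift ord0 i)).[t]).
Proof.
have /row_freeP[B VB] := Vfree.
exists (fun i => \sum_j B j i *: 'X_j); split.
  move=> i; apply: rpred_sum => j _; apply: dhomogZ.
  by rewrite dhomogX; apply/eqP/mdeg1.
have lE i (v : 'rV[K]_N.+1) : (\sum_j B j i *: 'X_j).@[v 0] = \sum_j v 0 j * B j i.
  by rewrite raddf_sum; apply: eq_bigr => j _ /=; rewrite mevalZ mevalXU mulrC.
have VBE i k : \sum_j V i j * B j k = (i == k)%:R.
  by move/matrixP/(_ i k): VB; rewrite !mxE.
move=> a; have [q qE] := psiV a.
exists (fun i => (if i == ord0 then 'X else 1) * \sum_j B j i *: q j) => t.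
have E k : (\sum_j B j k *: 'X_j).@[psi (fun i => t * a i) 0] =
    (ord0 == k)%:R + t * (\sum_i a i * (lift ord0 i == k)%:R)
      + t ^+ 2 * (\sum_j B j k *: q j).[t].
  rewrite lE horner_sum -(VBE ord0 k).
  rewrite (_ : \sum_i a i * _ = \sum_j (\sum_i a i * V (lift ord0 i) j) * B j k).
    rewrite !mulr_sumr -!big_split; apply: eq_bigr => j _ /=.
    by rewrite qE hornerZ; ring.
  under [RHS]eq_bigr do rewrite mulr_suml.
  rewrite exchange_big /=; apply: eq_bigr => i _; rewrite -VBE mulr_sumr.
  by apply: eq_bigr => j _; rewrite mulrA.
split=> [|i]; rewrite E hornerM.
  rewrite eqxx /= hornerX big1 ?mulr0 ?addr0; last by move=> i _; rewrite mulr0.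
  by rewrite expr2 mulrA.
rewrite (bigD1 i) //= eqxx mulr1 big1 ?addr0; last first.
  by move=> j ji; rewrite (inj_eq lift_inj) (negPf ji) mulr0.
by rewrite hornerC mul1r add0r expr2 mulrDr mulrA.
Qed.

(* A relation of degree E between the dual forms on k parameters, which exists by
   counting, cannot survive on k+1 parameters: along the ray t |-> t * w its
   terms of lowest order in t are the monomials of w. *)
Lemma relation_not_extending k : (k < d)%N -> exists (f : {mpoly K[N.+1]}) (E : nat),
  [/\ f \is E.-homog, vanish k f & exists a, f.@[psi (initial k.+1 a) 0] != 0].
Proof.
move=> kd; have [l [lh lE]] := dual_forms.
(* As in [chain_length]: r^(k+1) exceeds (r s)^k, which bounds the grid size (D E + 1)^k for forms
   of degree [E] in [k] parameters. *)
pose s := (D * k.+1).+1; pose r := (s ^ k).+1; pose E := (r * k.+1)%N.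
pose T := {ffun 'I_k.+1 -> 'I_r}.
pose inj (i : 'I_k.+1) : 'I_d := widen_ord kd i.
pose len (b : T) := (\sum_i b i)%N.
have lenE b : (len b <= E)%N.
  rewrite /len /E mulnC -[X in (_ <= X * _)%N](card_ord k.+1) -sum_nat_const.
  by apply: leq_sum => i _; apply: ltnW.
pose p (b : T) : {mpoly K[N.+1]} :=
  \prod_i l (lift ord0 (inj i)) ^+ b i * l ord0 ^+ (E - len b).
have ph b : p b \is E.-homog.
  rewrite -[X in X.-homog](subnKC (lenE b)); apply: dhomogM; last first.
    by rewrite -[X in X.-homog]mul1n; apply: dhomogMn.
  apply: (big_rec2 (fun (p : {mpoly K[N.+1]}) n => p \is n.-homog)).
    exact: dhomog1.
  move=> i n q _ qn; apply: dhomogM => //.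
  by rewrite -[X in X.-homog]mul1n; apply: dhomogMn.
pose ext (a : 'I_k -> K) : 'I_d -> K :=
  fun i => if insub (i : nat) is Some j then a j else 0.
have [|||c [[b0 cb0] cpsi]] := @homog_relation K N 'I_k T (fun a => psi (ext a)) D E p.
- move=> j a b; have [q sq qE] := psiD j (ext a) (ext b).
  exists q => // t; rewrite -qE; congr (psi _ 0 j); apply/funext => i.
  by rewrite /ext; case: insub => // ; rewrite subr0 mulr0 addr0.
- exact: ph.
- rewrite card_ffun !card_ord.
  apply: (@leq_ltn_trans ((r * s) ^ k)).
    by apply: leq_exp_base; rewrite /E /s [X in (_ <= X)%N]mulnS mulnCA -addn1 addnC leq_add2r.
  by rewrite expnMn expnSr ltn_pmul2l ?expn_gt0.
exists (\sum_b c b *: p b), E; split.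
- by apply: rpred_sum => b _; apply: dhomogZ.
- move=> a; rewrite -(cpsi (fun i => a (widen_ord (ltnW kd) i))).
  congr (_.@[psi _ 0]); apply/funext => i; rewrite /initial /ext.
  case: insubP => [j -> ji | /negPf -> //].
  by congr (a _); apply/val_inj.
apply: contrapT => /forallNP nvan.
have [b1 cb1 b1min] : {b : T | c b != 0 & forall b', c b' != 0 -> (len b <= len b')%N}.
  by case: (@arg_minnP T b0 (fun b => c b != 0) len cb0) => b cb bm; exists b.
pose c' (b : T) := if len b == len b1 then c b else 0.
suff : c' b1 = 0 by rewrite /c' eqxx => c'0; rewrite c'0 eqxx in cb1.
apply: monomials_independent => w.
pose a : 'I_d -> K := fun i => if insub (i : nat) is Some j then w j else 0.
have aw i : a (inj i) = w i.
  by rewrite /a insubT //= => ik; congr (w _); apply/val_inj.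
have [q qE] := lE a.
(* The relation on the ray divided by t^(len b1), the lowest order that occurs; its value at t = 0
   is the part of lowest degree, evaluated at [w]. *)
pose R : {poly K} := \sum_(b | c b != 0) c b *: ('X ^+ (len b - len b1) *
  \prod_i ((w i)%:P + 'X * q (lift ord0 (inj i))) ^+ b i *
  (1 + 'X * q ord0) ^+ (E - len b)).
have R0 : R = 0.
  suff /eqP : 'X^(len b1) * R = 0.
    by rewrite mulf_eq0 -size_poly_eq0 size_polyXn => /eqP.
  apply: poly_eq0_horner => t; rewrite hornerM hornerXn.
  have /negP := nvan (fun i => t * a i); rewrite negbK => /eqP <-.
  have -> : initial k.+1 (fun i => t * a i) = (fun i => t * a i).
    apply/funext => i; rewrite /initial; case: ifP => // ik.
    by rewrite /a insubF // mulr0.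
  rewrite horner_sum mulr_sumr raddf_sum [RHS](bigID (fun b => c b != 0)) /=.
  rewrite [X in _ = _ + X]big1 ?addr0; last first.
    by move=> b /negPn/eqP ->; rewrite scale0r meval0.
  apply: eq_bigr => b cb; rewrite mevalZ hornerZ mulrCA; congr (_ * _).
  have [l0 lS] := qE t.
  rewrite !hornerM mevalM !rmorph_prod !rmorphXn /= !horner_exp hornerX l0.
  rewrite !mulrA -exprD subnKC ?b1min //; congr (_ * _); last first.
    by rewrite hornerD hornerM hornerX hornerC.
  rewrite /len -prodrXr horner_prod -big_split; apply: eq_bigr => i _ /=.
  rewrite rmorphXn /= lS aw horner_exp -exprMn; congr (_ ^+ _).
  by rewrite hornerD hornerM hornerX hornerC.
rewrite -[RHS](horner0 0) -R0 horner_sum (bigID (fun b => c b != 0)) /=.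
rewrite [X in _ + X]big1 ?addr0; last first.
  by move=> b /negPn/eqP cb; rewrite /c' cb if_same mul0r.
apply: eq_bigr => b cb; rewrite hornerZ !hornerM !horner_exp hornerX /c'.
case: eqVneq => [-> | lb]; last first.
  rewrite expr0n subn_eq0 leqNgt.
  have -> : (len b1 < len b)%N by rewrite ltn_neqAle eq_sym lb b1min.
  by rewrite !mul0r mulr0.
rewrite subnn expr0 mul1r !(hornerD, hornerM, hornerX, hornerC) mul0r addr0.
rewrite expr1n mulr1 horner_prod; congr (_ * _); apply: eq_bigr => i _.
by rewrite horner_exp !(hornerD, hornerM, hornerX, hornerC) mul0r addr0.
Qed.

(** The k-th member is the closure in [X] of the image of the first [k] parameters. It is
    irreducible because nonempty open conditions on the parameters have a common point, and
    [relation_not_extending] makes the inclusions strict. *)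
Lemma chain_exists : exists W, irr_chain X d W.
Proof.
have [l [lh lE]] := dual_forms.
have psi0 k (a := fun=> 0) : (l ord0).@[psi (initial k a) 0] = 1.
  have [q qE] := lE (fun=> 0); have [+ _] := qE 0; rewrite [X in 1 + X]mul0r addr0 => <-.
  congr (_.@[psi _ 0]); apply/funext => i; rewrite mul0r /initial.
  by case: ifP.
have psi_neq0 k a (f : {mpoly K[N.+1]}) : f \is 1.-homog ->
    f.@[psi (initial k a) 0] != 0 -> psi (initial k a) != 0.
  move=> fh; apply: contraNneq => ->.
  by rewrite -(scale0r 0) (meval_homogZ _ _ fh) expr1 mul0r.
pose Z k := [set P | forall f, ((exists E, f \is E.-homog) /\ vanish k f) ->
  pvanish f P].
have Zcl k : zariski_closed (Z k) by apply: zero_locus_closed => f [].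
exists (fun k => X `&` Z k); split=> [k _ | k kd].
  split; first by exists (Z k).
  have inW a Q : psi (initial k a) != 0 -> val Q = <[psi (initial k a)]>%VS ->
      (X `&` Z k) Q.
    move=> a0 Qa; split; first exact: psiX a0 Qa.
    by move=> f [[E fE] fv]; apply/(pvanish_line fE Qa).
  split.
    have n0 := psi_neq0 k _ _ (lh ord0) (_ : _ != 0).
    have /exists_proj[Q Qv] : psi (initial k (fun=> 0)) != 0.
      by apply: n0; rewrite psi0 oner_neq0.
    exists Q; apply: (inW (fun=> 0)) => //.
    by apply: n0; rewrite psi0 oner_neq0.
  have nv (A : set (proj K N)) : zariski_closed A -> ~ (X `&` Z k `<=` A) ->
      gen (fun a : 'I_d -> K => forall Q, val Q = <[psi (initial k a)]>%VS -> ~ A Q).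
    move=> [S [Sh ->]] /existsNP[P /not_implyP[[XP ZP]]].
    move=> /existsNP[f /not_implyP[Sf nf]]; have [E fE] := Sh f Sf.
    have /existsNP[a fa] : ~ vanish k f by move=> fv; apply/nf/ZP; split; [exists E|].
    have fP : polyfun (fun a => f.@[psi (initial k a) 0]).
      by exists (D * E)%N; apply: pdeg_meval.
    apply: gen_imp (gen_neq0 fP (introN eqP fa)) => b fb Q Qb AQ.
    by move/eqP: fb; apply; apply/(pvanish_line fE Qb)/AQ.
  have nl : gen (fun a : 'I_d -> K => psi (initial k a) != 0).
    have lP : polyfun (fun a => (l ord0).@[psi (initial k a) 0]).
      by exists (D * 1)%N; apply: pdeg_meval.
    have l0 : (l ord0).@[psi (initial k (fun=> 0)) 0] != 0.
      by rewrite psi0 oner_neq0.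
    by apply: gen_imp (gen_neq0 lP l0) => a; apply: psi_neq0.
  move=> A B Acl Bcl AB; apply: contrapT => /not_orP[nA nB].
  have [a [[a0 aA] aB]] := gen_ex (gen_and (gen_and nl (nv A Acl nA)) (nv B Bcl nB)).
  have [Q Qa] := exists_proj a0.
  by case: (AB Q (inW a Q a0 Qa)); [apply: aA | apply: aB].
split.
  move=> P [XP ZP]; split => // f [fh fv]; apply: ZP; split => // a.
  rewrite -[RHS](fv (initial k a)); congr (f.@[psi _ 0]).
  apply/funext => i; rewrite /initial; case: (ltnP i k) => ik; last by case: ifP.
  by rewrite ltnS ltnW.
move=> sub; have [f [E [fE fk [a fa]]]] := relation_not_extending kd.
have fP : polyfun (fun a => f.@[psi (initial k.+1 a) 0]).
  by exists (D * E)%N; apply: pdeg_meval.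
have lP : polyfun (fun a => (l ord0).@[psi (initial k.+1 a) 0]).
  by exists (D * 1)%N; apply: pdeg_meval.
have l0 : (l ord0).@[psi (initial k.+1 (fun=> 0)) 0] != 0.
  by rewrite psi0 oner_neq0.
have [b [fb lb]] := gen_ex (gen_and (gen_neq0 fP fa) (gen_neq0 lP l0)).
have b0 := psi_neq0 _ _ _ (lh ord0) lb; have [Q Qb] := exists_proj b0.
have [] : (X `&` Z k) Q.
  apply: sub; split; first exact: psiX b0 Qb.
  by move=> g [[E' gE] gv]; apply/(pvanish_line gE Qb).
move=> _ ZQ; move/eqP: fb; apply; apply/(pvanish_line fE Qb)/ZQ.
by split => //; exists E.
Qed.

End ChainExistence.

(** * Trilinear forms and tangent spaces *)

Section Trilinear.
Variables (K : numFieldType) (a b c : nat).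
Implicit Types (x : 'rV[K]_a) (y : 'rV[K]_b) (z : 'rV[K]_c).

(** Forms are functions with three independent argument spaces, so that the restriction to a block
    such as V x U x L is a composition with matrices and again of this kind. *)
Definition trilin (f : 'rV[K]_a -> 'rV[K]_b -> 'rV[K]_c -> K) :=
  [/\ forall s x x' y z, f (s *: x + x') y z = s * f x y z + f x' y z,
      forall s x y y' z, f x (s *: y + y') z = s * f x y z + f x y' z &
      forall s x y z z', f x y (s *: z + z') = s * f x y z + f x y z'].

Variable f : 'rV[K]_a -> 'rV[K]_b -> 'rV[K]_c -> K.
Hypothesis ft : trilin f.

Lemma trilinD1 x x' y z : f (x + x') y z = f x y z + f x' y z.
Proof. by case: ft => /(_ 1 x x' y z) + _ _; rewrite scale1r mul1r. Qed.
Lemma trilinD2 x y y' z : f x (y + y') z = f x y z + f x y' z.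
Proof. by case: ft => _ /(_ 1 x y y' z) + _; rewrite scale1r mul1r. Qed.
Lemma trilinD3 x y z z' : f x y (z + z') = f x y z + f x y z'.
Proof. by case: ft => _ _ /(_ 1 x y z z'); rewrite scale1r mul1r. Qed.
Lemma trilin01 y z : f 0 y z = 0.
Proof. by apply: (addIr (f 0 y z)); rewrite -trilinD1 addr0 add0r. Qed.
Lemma trilin02 x z : f x 0 z = 0.
Proof. by apply: (addIr (f x 0 z)); rewrite -trilinD2 addr0 add0r. Qed.
Lemma trilin03 x y : f x y 0 = 0.
Proof. by apply: (addIr (f x y 0)); rewrite -trilinD3 addr0 add0r. Qed.
Lemma trilinZ1 s x y z : f (s *: x) y z = s * f x y z.
Proof. by case: ft => /(_ s x 0 y z) + _ _; rewrite trilin01 !addr0. Qed.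
Lemma trilinZ2 s x y z : f x (s *: y) z = s * f x y z.
Proof. by case: ft => _ /(_ s x y 0 z) + _; rewrite trilin02 !addr0. Qed.
Lemma trilinZ3 s x y z : f x y (s *: z) = s * f x y z.
Proof. by case: ft => _ _ /(_ s x y z 0); rewrite trilin03 !addr0. Qed.
Lemma trilinB1 x x' y z : f (x - x') y z = f x y z - f x' y z.
Proof. by rewrite -scaleN1r trilinD1 trilinZ1 mulN1r. Qed.
Lemma trilinB2 x y y' z : f x (y - y') z = f x y z - f x y' z.
Proof. by rewrite -scaleN1r trilinD2 trilinZ2 mulN1r. Qed.
Lemma trilin_sum1 (J : Type) (r : seq J) (P : pred J) (F : J -> 'rV[K]_a) y z :
  f (\sum_(j <- r | P j) F j) y z = \sum_(j <- r | P j) f (F j) y z.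
Proof.
by apply: (big_morph (fun x => f x y z)) => [x x'|]; rewrite ?trilinD1 ?trilin01.
Qed.
Lemma trilin_sum2 (J : Type) (r : seq J) (P : pred J) (F : J -> 'rV[K]_b) x z :
  f x (\sum_(j <- r | P j) F j) z = \sum_(j <- r | P j) f x (F j) z.
Proof.
by apply: (big_morph (fun y => f x y z)) => [y y'|]; rewrite ?trilinD2 ?trilin02.
Qed.
Lemma trilin_sum3 (J : Type) (r : seq J) (P : pred J) (F : J -> 'rV[K]_c) x y :
  f x y (\sum_(j <- r | P j) F j) = \sum_(j <- r | P j) f x y (F j).
Proof.
by apply: (big_morph (fun z => f x y z)) => [z z'|]; rewrite ?trilinD3 ?trilin03.
Qed.

Lemma trilin1_eq0 y z : (forall i, f 'e_i y z = 0) -> forall x, f x y z = 0.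
Proof.
move=> f0 x; rewrite (row_sum_delta x) trilin_sum1 big1 // => i _.
by rewrite trilinZ1 f0 mulr0.
Qed.
Lemma trilin2_eq0 x z : (forall i, f x 'e_i z = 0) -> forall y, f x y z = 0.
Proof.
move=> f0 y; rewrite (row_sum_delta y) trilin_sum2 big1 // => i _.
by rewrite trilinZ2 f0 mulr0.
Qed.
Lemma trilin3_eq0 x y : (forall i, f x y 'e_i = 0) -> forall z, f x y z = 0.
Proof.
move=> f0 z; rewrite (row_sum_delta z) trilin_sum3 big1 // => i _.
by rewrite trilinZ3 f0 mulr0.
Qed.

End Trilinear.

Section Tangents.
Variables (K : numFieldType) (m n : nat).
Local Notation N := (sv_N m n).
Local Notation V := ('rV[K]_m.+1).
Local Notation Y := ('rV[K]_n.+1).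
Implicit Types (x : V) (y z : Y).

Definition svi (c : 'I_N.+1) := enum_val (cast_ord (esym (card_sv_index m n)) c).

Lemma sv_vecE (x : V) (y : Y) c : sv_vec x y 0 c =
  x 0 (svi c).1 * y 0 (val (svi c).2).1 * y 0 (val (svi c).2).2.
Proof. by rewrite mxE -/(svi c); case: (svi c) => i jk. Qed.

Definition sv_polar (x : V) (y z : Y) : 'rV[K]_N.+1 :=
  \row_c (x 0 (svi c).1 * (y 0 (val (svi c).2).1 * z 0 (val (svi c).2).2
     + z 0 (val (svi c).2).1 * y 0 (val (svi c).2).2)).

Lemma sv_polar_diag x y : sv_polar x y y = 2 *: sv_vec x y.
Proof. by apply/rowP => c; rewrite !mxE -/(svi c); case: (svi c) => i jk; ring. Qed.

Lemma sv_vecZ s t x y : sv_vec (s *: x) (t *: y) = (s * t ^+ 2) *: sv_vec x y.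
Proof.
by apply/rowP => c; rewrite !mxE; case: (enum_val _) => i jk; rewrite !mxE; ring.
Qed.

Lemma sv_vec_neq0 (x : V) (y : Y) : x != 0 -> y != 0 -> sv_vec x y != 0.
Proof.
move=> /rV0Pn[i xi] /rV0Pn[j yj].
have jj : ((j, j).1 <= (j, j).2)%N by [].
pose c := cast_ord (card_sv_index m n) (enum_rank ((i, exist _ (j, j) jj) : sv_index m n)).
apply/rV0Pn; exists c; rewrite sv_vecE /svi /c cast_ordK enum_rankK /=.
by rewrite !mulf_neq0.
Qed.

(* The condition [f (X p) (Z p) = 0, f _ (Z p) (Z p) = 0] says that the linear form
   f on the ambient space vanishes on the affine tangent space at the point p: the
   tangent spaces at s points, together with r vectors, span the ambient space. *)
Definition fill (s r : nat) := exists (X : 'I_s -> V) (Z : 'I_s -> Y)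
    (T : 'I_r -> V * Y * Y),
  forall f, trilin f -> (forall x y z, f x y z = f x z y) ->
    (forall p x, f x (Z p) (Z p) = 0) -> (forall p y, f (X p) (Z p) y = 0) ->
    (forall k, f (T k).1.1 (T k).1.2 (T k).2 = 0) ->
  forall x y z, f x y z = 0.

(** A vector of the affine cone over the secant variety; scalars are absorbed into the linear
    argument [X]. *)
Definition combination s (X : 'I_s -> V) (Z : 'I_s -> Y) : 'rV[K]_N.+1 :=
  \sum_p sv_vec (X p) (Z p).

(** Curves will start at this sum, so it must be nonzero. Zero vectors impose no condition and may
    be replaced by any others. If the sum still vanishes, doubling the first x leaves all conditions
    equivalent and makes it nonzero. *)
Lemma fill_nondegenerate s r : (0 < s)%N -> fill s r ->
  exists (X : 'I_s -> V) (Z : 'I_s -> Y) (T : 'I_r -> V * Y * Y),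
    combination X Z != 0 /\
  forall f, trilin f -> (forall x y z, f x y z = f x z y) ->
    (forall p x, f x (Z p) (Z p) = 0) -> (forall p y, f (X p) (Z p) y = 0) ->
    (forall k, f (T k).1.1 (T k).1.2 (T k).2 = 0) ->
  forall x y z, f x y z = 0.
Proof.
move=> s0 [X0 [Z0 [T XZT]]].
pose X p : V := if X0 p == 0 then const_mx 1 else X0 p.
pose Z p : Y := if Z0 p == 0 then const_mx 1 else Z0 p.
have c1 k : (const_mx 1 : 'rV[K]_k.+1) != 0.
  by apply/rV0Pn; exists ord0; rewrite mxE oner_neq0.
have Xn p : X p != 0 by rewrite /X; case: ifP => [_|/negbT //]; apply: c1.
have Zn p : Z p != 0 by rewrite /Z; case: ifP => [_|/negbT //]; apply: c1.
have XZ (s' : 'I_s -> K) f : (forall p, s' p != 0) ->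
    trilin f -> (forall x y z, f x y z = f x z y) ->
    (forall p x, f x (Z p) (Z p) = 0) ->
    (forall p y, f (s' p *: X p) (Z p) y = 0) ->
    (forall k, f (T k).1.1 (T k).1.2 (T k).2 = 0) -> forall x y z, f x y z = 0.
  move=> s'0 ft fs f1 f2 fT; apply: XZT => // p x.
    have := f1 p x; rewrite /Z; case: eqP => // -> _; exact: trilin02.
  have [-> | Zp] := eqVneq (Z0 p) 0; first exact: trilin02.
  have [-> | Xp] := eqVneq (X0 p) 0; first exact: trilin01.
  have /eqP := f2 p x; rewrite trilinZ1 // mulf_eq0 (negPf (s'0 p)) /=.
  by rewrite /X /Z (negPf Xp) (negPf Zp) => /eqP.
have [C0 | C0] := eqVneq (combination X Z) 0; last first.
  exists X, Z, T; split => // f ft fs f1 f2; apply: (XZ (fun=> 1)) => // p.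
    by rewrite oner_neq0.
  by move=> y; rewrite scale1r.
pose p0 : 'I_s := Ordinal s0; pose s' p : K := if p == p0 then 2 else 1.
exists (fun p => s' p *: X p), Z, T; split; last first.
  move=> f ft fs f1 f2; apply: (XZ s') => // p.
  by rewrite /s'; case: ifP => _; rewrite ?oner_neq0 // pnatr_eq0.
have -> : combination (fun p => s' p *: X p) Z = combination X Z + sv_vec (X p0) (Z p0).
  rewrite /combination (bigD1 p0) //= [X in _ = X + _](bigD1 p0) //= addrAC.
  congr (_ + _); last by apply: eq_bigr => p /negPf pp; rewrite /s' pp scale1r.
  by rewrite /s' eqxx -[Z p0 in LHS]scale1r sv_vecZ expr1n mulr1 scaler_nat mulr2n.
by rewrite C0 add0r sv_vec_neq0.
Qed.

Lemma fill_add s r : fill s r -> fill s.+1 r.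
Proof.
move=> [X [Z [T XZT]]].
exists (fun p => if unlift ord0 p is Some q then X q else 0),
       (fun p => if unlift ord0 p is Some q then Z q else 0), T.
move=> f ft fs f1 f2 fT; apply: XZT => // p x.
  by have := f1 (lift ord0 p) x; rewrite liftK.
by have := f2 (lift ord0 p) x; rewrite liftK.
Qed.

(** The tangent space at the dropped point is spanned by m+n+1 vectors: e_i z0 z0 for i other than
    i0, and X z0 e_j for all j. As coordinate i0 of X is nonzero, e_i0 z0 z0 follows; if X = 0 it
    replaces the second kind. *)
Lemma fill_drop s r : fill s.+1 r -> fill s (r + (m + n).+1).
Proof.
move=> [X [Z [T XZT]]].
pose i0 := if [pick i | X ord0 0 i != 0] is Some i then i else ord0.
pose z0 := Z ord0.
exists (fun p => X (lift ord0 p)), (fun p => Z (lift ord0 p)).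
exists (fun k => match split k with
  | inl k => T k
  | inr k => match split (cast_ord (esym (addnS m n)) k) with
             | inl i => ('e_(lift i0 i), z0, z0)
             | inr j => if X ord0 == 0 then ('e_i0, z0, z0) else (X ord0, z0, 'e_j)
             end
  end) => f ft fs f1 f2 fT.
have fT' k : f (T k).1.1 (T k).1.2 (T k).2 = 0.
  by have := fT (unsplit (inl k)); rewrite unsplitK.
have fr j := fT (unsplit (inr (cast_ord (addnS m n) (unsplit (inr j))))).
have fX y : f (X ord0) z0 y = 0.
  apply: trilin3_eq0 => // j.
  have := fr j; rewrite unsplitK cast_ordK unsplitK; case: eqP => // -> _.
  exact: trilin01.
have fi i : f 'e_(lift i0 i) z0 z0 = 0.
  have := fT (unsplit (inr (cast_ord (addnS m n) (unsplit (inl i))))).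
  by rewrite unsplitK cast_ordK unsplitK.
have fi0 : f 'e_i0 z0 z0 = 0.
  have [X0 | X0] := eqVneq (X ord0) 0.
    by have := fr ord0; rewrite unsplitK cast_ordK unsplitK X0 eqxx.
  have Xi0 : X ord0 0 i0 != 0.
    rewrite /i0; case: pickP => // Xi; case/rV0Pn: X0 => i.
    by rewrite (Xi i).
  apply: (mulfI Xi0); rewrite mulr0 -trilinZ1 // -[RHS](fX z0).
  rewrite [in RHS](row_sum_delta (X ord0)) (bigD1 i0) //= trilinD1 //.
  rewrite [X in _ = _ + X]trilin_sum1 // big1 ?addr0 // => i.
  by case: (unliftP i0 i) => [j ->|->]; rewrite ?eqxx // trilinZ1 // fi mulr0.
have fz x : f x z0 z0 = 0.
  apply: (trilin1_eq0 ft) => i.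
  by case: (unliftP i0 i) => [j ->|->].
apply: XZT => // p x; first by case: (unliftP ord0 p) => [q ->|->].
by case: (unliftP ord0 p) => [q ->|->].
Qed.

End Tangents.

Lemma sum_pairE (R : nmodType) (I J : finType) (F : I * J -> R) :
  \sum_p F p = \sum_i \sum_j F (i, j).
Proof. by rewrite pair_bigA; apply: eq_bigr => -[]. Qed.

Section SecantDimension.
Variables (K : numFieldType) (m n : nat).
Local Notation N := (sv_N m n).
Local Notation V := ('rV[K]_m.+1).
Local Notation Y := ('rV[K]_n.+1).
Implicit Types (x : V) (y z : Y).

(** The linear form [w] on the ambient space as a symmetric trilinear form; at (x, y, y) it is twice
    the value of [w] on [sv_vec x y]. *)
Definition sv_form (w : 'I_N.+1 -> K) x y z := \sum_c sv_polar x y z 0 c * w c.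

Lemma sv_form_trilin w : trilin (sv_form w).
Proof.
by split=> s *; rewrite /sv_form mulr_sumr -big_split; apply: eq_bigr => c _ /=;
  rewrite !mxE; ring.
Qed.

Lemma sv_form_sym w x y z : sv_form w x y z = sv_form w x z y.
Proof. by apply: eq_bigr => c _; rewrite !mxE; ring. Qed.

Lemma sv_form_eq0 w : (forall x y z, sv_form w x y z = 0) -> forall c, w c = 0.
Proof.
move=> w0 c; have := w0 'e_(svi c).1 'e_(val (svi c).2).1 'e_(val (svi c).2).2.
have inj_svi : injective (@svi m n).
  by move=> u v /enum_val_inj /cast_ord_inj.
rewrite /sv_form (bigD1 c) //= big1 ?addr0 => [|c' c'c].
  rewrite !mxE !eqxx /= !mulr1n mul1r => /eqP.
  rewrite mulf_eq0 => /orP[|/eqP //]; rewrite mul1r -natrM -(natrD _ 1) pnatr_eq0.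
  by [].
rewrite !mxE !eqxx /=.
have /eqP : svi c' != svi c by rewrite (inj_eq inj_svi).
case: (svi c') (svi c) => [i [[j k] jk]] [i' [[j' k'] jk']] /= ne.
have ext : (i == i') -> (j == j') -> (k == k') -> False.
  move=> /eqP ii /eqP jj /eqP kk; apply: ne; rewrite ii; congr (_, _).
  by apply/val_inj; rewrite /= jj kk.
have [ii | _] := eqVneq i i'; last by rewrite !mul0r.
have [jj | jj] := eqVneq j j'.
  have [kk | kk] := eqVneq k k'; first by case: ext; apply/eqP.
  rewrite mulr0 add0r; case: eqVneq => [jk2|]; last by rewrite mul0r mulr0 mul0r.
  case: eqVneq => [kj|]; last by rewrite !mulr0 mul0r.
  by case/eqP: kk; rewrite kj -jj.
rewrite mul0r add0r; case: eqVneq => [jk2|]; last by rewrite mul0r mulr0 mul0r.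
case: eqVneq => [kj|]; last by rewrite !mulr0 mul0r.
case/eqP: jj; apply/val_inj/eqP; rewrite eqn_leq.
have /= jk1 := jk; have /= := jk'; rewrite -jk2 -kj => kj'.
by rewrite jk1 kj'.
Qed.

Section Points.
Variables (s : nat) (X : 'I_s -> V) (Z : 'I_s -> Y).

Definition tangent_dir := ('I_s * 'I_m.+1 + 'I_s * 'I_n.+1)%type.

Definition tangent_vec (d : tangent_dir) : 'rV[K]_N.+1 :=
  match d with
  | inl (p, i) => sv_vec 'e_i (Z p)
  | inr (p, j) => sv_polar (X p) (Z p) 'e_j
  end.

Definition tangent_mx : 'M[K]_(#|{: tangent_dir}|, N.+1) :=
  \matrix_k tangent_vec (enum_val k).

(** A linear form that vanishes on the tangent vectors and on the [r] added vectors satisfies all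
    the conditions, hence is zero. So these vectors span, and the added ones account for rank at
    most [r]. *)
Lemma tangent_mx_rank r (T : 'I_r -> V * Y * Y) :
  (forall f, trilin f -> (forall x y z, f x y z = f x z y) ->
    (forall p x, f x (Z p) (Z p) = 0) -> (forall p y, f (X p) (Z p) y = 0) ->
    (forall k, f (T k).1.1 (T k).1.2 (T k).2 = 0) ->
  forall x y z, f x y z = 0) -> (N.+1 <= \rank tangent_mx + r)%N.
Proof.
move=> XZT; pose B : 'M[K]_(r, N.+1) :=
  \matrix_k sv_polar (T k).1.1 (T k).1.2 (T k).2.
have free : row_free (col_mx tangent_mx B)^T.
  apply: inj_row_free => w wM; pose f := sv_form (fun c => w 0 c).
  have rowE (k : nat) (A : 'M[K]_(k, N.+1)) i : (w *m A^T) 0 i = \sum_c A i c * w 0 c.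
    by rewrite mxE; apply: eq_bigr => c _; rewrite mxE mulrC.
  move: wM; rewrite tr_col_mx mul_mx_row => /eqP.
  rewrite -[X in _ == X](@row_mx0 _ 1) => /eqP/eq_row_mx[wA wB].
  have tan0 d : \sum_c tangent_vec d 0 c * w 0 c = 0.
    move/rowP/(_ (enum_rank d)): wA; rewrite rowE [RHS]mxE => wA.
    by apply: etrans wA; apply: eq_bigr => c _; rewrite mxE enum_rankK.
  have ft := sv_form_trilin (fun c => w 0 c).
  have f0 : forall x y z, f x y z = 0.
    apply: XZT => //.
    - exact: sv_form_sym.
    - move=> p; apply: (trilin1_eq0 ft) => i; rewrite /f /sv_form.
      rewrite -[RHS](mulr0 2) -[in RHS](tan0 (inl (p, i))) mulr_sumr.
      by apply: eq_bigr => c _; rewrite sv_polar_diag mxE mulrA.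
    - by move=> p; apply: (trilin3_eq0 ft) => j; apply: (tan0 (inr (p, j))).
    - move=> k; move/rowP/(_ k): wB; rewrite rowE [RHS]mxE => wB.
      by apply: etrans wB; apply: eq_bigr => c _; rewrite [RHS]mulrC [LHS]mulrC !mxE.
  by apply/rowP => c; rewrite mxE (sv_form_eq0 f0).
move: free; rewrite /row_free mxrank_tr => /eqP {1}<-; rewrite -addsmxE.
apply: leq_trans (mxrank_adds_leqif _ _) _.
by rewrite leq_add2l rank_leq_row.
Qed.

Hypothesis comb_neq0 : combination X Z != 0.

(* A curve through the point of the secant variety given by X and Z, whose
   derivatives together with that point are d + 1 independent tangent vectors. *)
Lemma tangent_curve d : (d < \rank tangent_mx)%N ->
  exists (DX : 'I_d -> 'I_s -> V) (DZ : 'I_d -> 'I_s -> Y)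
    (A : 'M[K]_(d.+1, N.+1)),
    [/\ row_free A, row 0 A = combination X Z &
        forall i, row (lift ord0 i) A =
          \sum_p (sv_vec (DX i p) (Z p) + sv_polar (X p) (Z p) (DZ i p))].
Proof.
move=> dr; pose v0 := combination X Z.
have v0A : (v0 <= tangent_mx)%MS.
  apply: summx_sub => p _.
  have -> : sv_vec (X p) (Z p) = \sum_i X p 0 i *: tangent_vec (inl (p, i)).
    apply/rowP => c; rewrite summxE sv_vecE {1}(row_sum_delta (X p)) summxE.
    rewrite !mulr_suml; apply: eq_bigr => i _; rewrite [RHS]mxE sv_vecE.
    by rewrite mxE !mulrA.
  apply: summx_sub => i _; apply: scalemx_sub.
  have -> : tangent_vec (inl (p, i)) = row (enum_rank (inl (p, i) : tangent_dir)) tangent_mx.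
    by rewrite rowK enum_rankK.
  exact: row_sub.
(* A complement of the base point in the tangent space, so that the point and the chosen [d]
   directions are independent. *)
pose C := (tangent_mx :\: v0)%MS.
have rC : (d <= \rank C)%N.
  have := mxrank_cap_compl tangent_mx v0; have := rank_leq_row v0.
  have := mxrankS (capmxSr tangent_mx v0); rewrite -/C; lia.
pose C' : 'M[K]_(d, N.+1) := pid_mx d *m row_base C.
have C'f : row_free C'.
  by rewrite /row_free mxrankMfree ?row_base_free // rank_pid_mx.
have C'C : (C' <= C)%MS by apply: submx_trans (submxMl _ _) _; rewrite eq_row_base.
have /submxP[S SE] : (C' <= tangent_mx)%MS.
  exact: submx_trans C'C (diffmxSl _ _).
pose DX i p : V := \row_k S i (enum_rank (inl (p, k) : tangent_dir)).
pose DZ i p : Y := \row_k S i (enum_rank (inr (p, k) : tangent_dir)).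
exists DX, DZ, (col_mx v0 C'); split.
- have rk : \rank (col_mx v0 C') = (1 + d)%N.
    rewrite -addsmxE mxrank_disjoint_sum.
      by rewrite (eqP C'f) rank_rV comb_neq0.
    apply/eqP; rewrite -submx0 -(capmx_diff tangent_mx v0) -/C capmxC.
    by rewrite capmxS.
  by apply/eqP.
- apply/rowP => c; rewrite mxE -[RHS](col_mxEu v0 C').
  by congr (col_mx _ _ _ _); apply/val_inj.
- move=> i; apply/rowP => c; rewrite mxE.
  transitivity (col_mx v0 C' (rshift 1 i) c).
    by congr (col_mx _ _ _ _); apply/val_inj.
  rewrite col_mxEd SE mxE summxE (reindex _ (onW_bij _ (@enum_rank_bij _))) /=.
  under eq_bigr do rewrite mxE enum_rankK.
  rewrite big_sumType /= !sum_pairE.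
  rewrite -big_split; apply: eq_bigr => p _ /=; rewrite mxE; congr (_ + _).
    rewrite sv_vecE [DX i p in RHS]row_sum_delta summxE !mulr_suml.
    by apply: eq_bigr => k _; rewrite sv_vecE !mxE !mulrA.
  have ft c' : trilin (fun x y z => sv_polar x y z 0 c').
    by split=> *; rewrite !mxE; ring.
  rewrite [DZ i p in RHS]row_sum_delta (trilin_sum3 (ft c)).
  by apply: eq_bigr => k _; rewrite (trilinZ3 (ft c)) !mxE.
Qed.

End Points.

End SecantDimension.

(** * Dimension of a secant variety from its tangent spaces *)

Section NonDefectivity.
Variables (K : numFieldType) (m n : nat).
Local Notation N := (sv_N m n).
Local Notation V := ('rV[K]_m.+1).
Local Notation Y := ('rV[K]_n.+1).
Local Notation projN := (proj K N).

Lemma pdeg_combination (I : Type) s (X : (I -> K) -> 'I_s -> V)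
    (Z : (I -> K) -> 'I_s -> Y) :
  (forall p i, pdeg 1 (fun a => X a p 0 i)) ->
  (forall p j, pdeg 1 (fun a => Z a p 0 j)) ->
  forall c, pdeg 3 (fun a => combination (X a) (Z a) 0 c).
Proof.
move=> XD ZD c.
have -> : (fun a => combination (X a) (Z a) 0 c) = (fun a => \sum_p
    X a p 0 (svi c).1 * Z a p 0 (val (svi c).2).1 * Z a p 0 (val (svi c).2).2).
  by apply/funext => a; rewrite summxE; apply: eq_bigr => p _; rewrite sv_vecE.
by apply: pdeg_sum => p _; apply: (@pdeg_mul _ _ 2 1) => //; apply: (@pdeg_mul _ _ 1 1).
Qed.

(** [W] stands for the variety itself, defined as an image, with s = 1, and for the secant
    varieties, defined as closures. The hypotheses below are the common properties: [W] contains all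
    sums of [s] points of the cone and lies in their closure. *)
Variables (s : nat) (W : set projN).
Hypothesis s_gt0 : (0 < s)%N.
Hypothesis W_points : forall (X : 'I_s -> V) (Z : 'I_s -> Y) (Q : projN),
  combination X Z != 0 -> val Q = <[combination X Z]>%VS -> W Q.
Hypothesis W_closure : forall (f : {mpoly K[N.+1]}) d, f \is d.-homog ->
  (forall (X : 'I_s -> V) (Z : 'I_s -> Y), f.@[combination X Z 0] = 0) ->
  forall Q, W Q -> pvanish f Q.

(** The N parameters are the affine chart with first coordinate 1; a form vanishing on this chart
    vanishes generically, hence everywhere. *)
Lemma chain_ambient e C : irr_chain W e C -> (e <= N)%N.
Proof.
move=> chC; rewrite -[X in (_ <= X)%N]card_ord.
pose psi (a : 'I_N -> K) : 'rV[K]_N.+1 :=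
  \row_j if unlift ord0 j is Some i then a i else 1.
apply: (chain_length (psi := psi) (D := 1) chC).
  move=> j; rewrite (_ : (fun a => _) =
      (fun a : 'I_N -> K => if unlift ord0 j is Some i then a i else 1)).
    by case: (unlift ord0 j) => [i|]; [apply: pdeg_var | apply: pdeg_const].
  by apply/funext => a; rewrite mxE.
move=> f d fd fpsi Q _ v _; apply/eqP/contraT => fv.
have fP : polyfun (fun a : 'I_N.+1 -> K => f.@[(\row_j a j) 0]).
  exists (1 * d)%N; apply: pdeg_meval => // j.
  rewrite (_ : (fun a => _) = (fun a => a j)); first exact: pdeg_var.
  by apply/funext => a; rewrite mxE.
have fa : f.@[(\row_j v 0 j) 0] != 0.
  by rewrite (_ : \row_j v 0 j = v) //; apply/rowP => j; rewrite mxE.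
have [a [a0 fa0]] := gen_ex (gen_and
  (@gen_neq0 K _ _ (fun=> 1) (@polyfun_var K _ (ord0 : 'I_N.+1)) (oner_neq0 K))
  (gen_neq0 (a := fun j => v 0 j) fP fa)).
move: fa0; rewrite (_ : \row_j a j = a ord0 *: psi (fun i => a (lift ord0 i) / a ord0)).
  by rewrite (meval_homogZ _ _ fd) fpsi mulr0 eqxx.
apply/rowP => j; rewrite !mxE; case: unliftP => [i ->|->]; last by rewrite mulr1.
by rewrite mulrC divfK.
Qed.

(** Each y is scaled to first coordinate 1, and scaling the whole sum makes the first coordinate of
    x_0 equal to 1. The remaining m + (s-1)(m+1) + s n parameters still reach a dense set. *)
Lemma chain_parameters e C : irr_chain W e C -> (e <= s * (m + n).+1 - 1)%N.
Proof.
case: s s_gt0 W_closure => // s' _ Wcl chC.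
pose I := ('I_m + 'I_s' * 'I_m.+1 + 'I_s'.+1 * 'I_n)%type.
have -> : (s'.+1 * (m + n).+1 - 1 = #|{: I}|)%N.
  by rewrite !card_sum !card_prod !card_ord; lia.
pose X (a : I -> K) (p : 'I_s'.+1) : V := \row_i
  if unlift ord0 p is Some q then a (inl (inr (q, i)))
  else if unlift ord0 i is Some j then a (inl (inl j)) else 1.
pose Z (a : I -> K) (p : 'I_s'.+1) : Y := \row_j
  if unlift ord0 j is Some k then a (inr (p, k)) else 1.
apply: (chain_length (psi := fun a => combination (X a) (Z a)) (D := 3) chC).
  apply: pdeg_combination => p i.
    rewrite (_ : (fun a => _) = (fun a =>
      if unlift ord0 p is Some q then a (inl (inr (q, i)))
      else if unlift ord0 i is Some j then a (inl (inl j)) else 1)).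
      case: unlift => [q|]; first exact: pdeg_var.
      by case: unlift => [j|]; [apply: pdeg_var | apply: pdeg_const].
    by apply/funext => a; rewrite mxE.
  rewrite (_ : (fun a => _) = (fun a : I -> K =>
      if unlift ord0 i is Some k then a (inr (p, k)) else 1)).
    by case: unlift => [j|]; [apply: pdeg_var | apply: pdeg_const].
  by apply/funext => a; rewrite mxE.
move=> f d fd fpsi; apply: (Wcl f d fd) => X0 Z0; apply/eqP/contraT => f0.
pose J := ('I_s'.+1 * 'I_m.+1 + 'I_s'.+1 * 'I_n.+1)%type.
pose X' (a : J -> K) (p : 'I_s'.+1) : V := \row_i a (inl (p, i)).
pose Z' (a : J -> K) (p : 'I_s'.+1) : Y := \row_j a (inr (p, j)).
pose a0 (k : J) := match k with inl (p, i) => X0 p 0 i | inr (p, j) => Z0 p 0 j end.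
have fP : polyfun (fun a => f.@[combination (X' a) (Z' a) 0]).
  exists (3 * d)%N; apply: pdeg_meval => //; apply: pdeg_combination => p i.
    rewrite (_ : (fun a => _) = (fun a => a (inl (p, i)))); first exact: pdeg_var.
    by apply/funext => a; rewrite mxE.
  rewrite (_ : (fun a => _) = (fun a : J -> K => a (inr (p, i)))); first exact: pdeg_var.
  by apply/funext => a; rewrite mxE.
have fa0 : f.@[combination (X' a0) (Z' a0) 0] != 0.
  rewrite (_ : combination _ _ = combination X0 Z0) //.
  by apply: eq_bigr => p _; congr sv_vec; apply/rowP => i; rewrite mxE.
have [a [fa [ax az]]] := gen_ex (gen_and (gen_neq0 fP fa0)
  (gen_and (@gen_neq0 K _ _ (fun=> 1)
      (@polyfun_var K _ (inl (ord0, ord0) : J)) (oner_neq0 K))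
    (gen_all (fun p => @gen_neq0 K _ _ (fun=> 1)
      (@polyfun_var K _ (inr (p, ord0) : J)) (oner_neq0 K))))).
pose y p := a (inr (p, ord0)); pose c := a (inl (ord0, ord0)) * y ord0 ^+ 2.
have y0 p : y p != 0 := az p.
have c0 : c != 0 by rewrite mulf_neq0 // expf_neq0.
pose b (k : I) := match k with
  | inl (inl j) => a (inl (ord0, lift ord0 j)) * y ord0 ^+ 2 / c
  | inl (inr (q, i)) => a (inl (lift ord0 q, i)) * y (lift ord0 q) ^+ 2 / c
  | inr (p, k) => a (inr (p, lift ord0 k)) / y p
  end.
have XE p : X' a p = (c / y p ^+ 2) *: X b p.
  apply/rowP => i; rewrite !mxE.
  case: (unliftP ord0 p) => [q ->|->].
    by rewrite /b; field; rewrite c0 y0.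
  case: (unliftP ord0 i) => [j ->|->] /=.
    by field; rewrite c0 y0.
  by rewrite mulr1 mulfK // expf_neq0.
have ZE p : Z' a p = y p *: Z b p.
  apply/rowP => i; rewrite !mxE; case: (unliftP ord0 i) => [j ->|->] /=.
    by rewrite mulrC divfK.
  by rewrite mulr1.
move: fa; rewrite (_ : combination _ _ = c *: combination (X b) (Z b)).
  by rewrite (meval_homogZ _ _ fd) fpsi mulr0 eqxx.
rewrite scaler_sumr; apply: eq_bigr => p _; rewrite XE ZE sv_vecZ divfK //.
by rewrite expf_neq0.
Qed.

Lemma secant_chain_exists : fill K m n s (N.+1 - s * (m + n).+1) ->
  exists C, irr_chain W (minn N (s * (m + n).+1 - 1)) C.
Proof.
move=> /(fill_nondegenerate s_gt0)[X [Z [T [c0 XZT]]]].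
have rk := tangent_mx_rank XZT.
set d := minn _ _; have dr : (d < \rank (tangent_mx X Z))%N.
  have : (0 < s * (m + n).+1)%N by rewrite muln_gt0 s_gt0.
  by rewrite /d; lia.
have [DX [DZ [A [Afree A0 AS]]]] := tangent_curve c0 dr.
pose XX (a : 'I_d -> K) p : V := X p + \sum_i a i *: DX i p.
pose ZZ (a : 'I_d -> K) p : Y := Z p + \sum_i a i *: DZ i p.
pose psi a := combination (XX a) (ZZ a).
apply: (@chain_exists K N d 3 W psi A) => //.
- apply: pdeg_combination => p i.
    rewrite (_ : (fun a => _) = (fun a => X p 0 i + \sum_k a k * DX k p 0 i)).
      apply: pdeg_add; [exact: pdeg_const | apply: pdeg_sum => k _].
      by apply: (@pdeg_mul _ _ 1 0); [apply: pdeg_var | apply: pdeg_const].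
    apply/funext => a; rewrite mxE summxE; congr (_ + _).
    by apply: eq_bigr => k _; rewrite mxE.
  rewrite (_ : (fun a => _) = (fun a => Z p 0 i + \sum_k a k * DZ k p 0 i)).
    apply: pdeg_add; [exact: pdeg_const | apply: pdeg_sum => k _].
    by apply: (@pdeg_mul _ _ 1 0); [apply: pdeg_var | apply: pdeg_const].
  apply/funext => a; rewrite mxE summxE; congr (_ + _).
  by apply: eq_bigr => k _; rewrite mxE.
- by move=> a Q; apply: W_points.
move=> a; pose x p : V := \sum_i a i *: DX i p; pose z p : Y := \sum_i a i *: DZ i p.
pose X1 (c : 'I_N.+1) (p : 'I_s) : K := X p 0 (svi c).1;
  pose x1 (c : 'I_N.+1) (p : 'I_s) : K := x p 0 (svi c).1.
pose Z1 (c : 'I_N.+1) (p : 'I_s) : K := Z p 0 (val (svi c).2).1;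
  pose z1 (c : 'I_N.+1) (p : 'I_s) : K := z p 0 (val (svi c).2).1.
pose Z2 (c : 'I_N.+1) (p : 'I_s) : K := Z p 0 (val (svi c).2).2;
  pose z2 (c : 'I_N.+1) (p : 'I_s) : K := z p 0 (val (svi c).2).2.
(* The quadratic and cubic terms in t of a product of three linear factors. *)
exists (fun c => (\sum_p (x1 c p * (z1 c p * Z2 c p + Z1 c p * z2 c p)
      + X1 c p * z1 c p * z2 c p))%:P + (\sum_p x1 c p * z1 c p * z2 c p) *: 'X) => t c.
have tE k (D : 'I_d -> 'I_s -> 'rV[K]_k) p :
    \sum_i (t * a i) *: D i p = t *: \sum_i a i *: D i p.
  by rewrite scaler_sumr; apply: eq_bigr => i _; rewrite scalerA.
have -> : psi (fun i => t * a i) 0 c = \sum_p (X1 c p + t * x1 c p) *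
    (Z1 c p + t * z1 c p) * (Z2 c p + t * z2 c p).
  rewrite /psi /combination summxE; apply: eq_bigr => p _.
  by rewrite sv_vecE /XX /ZZ !tE !mxE.
have -> : A 0 c = \sum_p X1 c p * Z1 c p * Z2 c p.
  move/rowP/(_ c): A0; rewrite mxE => ->; rewrite summxE.
  by apply: eq_bigr => p _; rewrite sv_vecE.
have -> : \sum_i a i * A (lift ord0 i) c =
    \sum_p (x1 c p * Z1 c p * Z2 c p + X1 c p * (Z1 c p * z2 c p + z1 c p * Z2 c p)).
  under eq_bigr => i _.
    move/rowP/(_ c): (AS i); rewrite mxE summxE => ->.
    rewrite mulr_sumr; over.
  rewrite exchange_big; apply: eq_bigr => p _ /=.
  have -> : X1 c p * (Z1 c p * z2 c p + z1 c p * Z2 c p) =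
      \sum_i a i * sv_polar (X p) (Z p) (DZ i p) 0 c.
    rewrite /X1 /Z1 /Z2 /z1 /z2 /z !summxE mulr_sumr mulr_suml -big_split mulr_sumr.
    by apply: eq_bigr => i _; rewrite !mxE /=; ring.
  have -> : x1 c p * Z1 c p * Z2 c p = \sum_i a i * sv_vec (DX i p) (Z p) 0 c.
    rewrite /x1 /x summxE !mulr_suml; apply: eq_bigr => i _.
    by rewrite sv_vecE mxE !mulrA.
  by rewrite -big_split; apply: eq_bigr => i _ /=; rewrite mxE mulrDr.
rewrite hornerD hornerC hornerZ hornerX.
rewrite !(mulr_suml, mulr_sumr) -!big_split /= mulr_sumr -!big_split /=.
by apply: eq_bigr => p _; ring.
Qed.

Lemma secant_dim : fill K m n s (N.+1 - s * (m + n).+1) ->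
  has_dim W (minn N (s * (m + n).+1 - 1)).
Proof.
move=> F; split; first exact: secant_chain_exists.
by move=> e C chC; rewrite leq_min (chain_ambient chC) (chain_parameters chC).
Qed.

End NonDefectivity.

(** * The Segre-Veronese variety and its secant varieties *)

Section SegreVeroneseSecants.
Variables (K : numFieldType) (m n : nat).
Local Notation N := (sv_N m n).
Local Notation X := (@segre_veronese K m n).
Implicit Types (x : 'rV[K]_m.+1) (y : 'rV[K]_n.+1) (Q : proj K N).

Lemma sv_vec0l y : sv_vec 0 y = 0 :> 'rV[K]_N.+1.
Proof. by rewrite -[0 in LHS](scale0r 0) -[y]scale1r sv_vecZ mul0r scale0r. Qed.

Lemma sv_vec0r x : sv_vec x 0 = 0 :> 'rV[K]_N.+1.
Proof. by rewrite -[0 in LHS](scale0r 0) -[x]scale1r sv_vecZ expr0n mulr0 scale0r. Qed.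

Lemma segre_veronese_dim : (m + n <= N)%N -> fill K m n 1 (N.+1 - (m + n).+1) ->
  has_dim X (m + n).
Proof.
move=> mnN F; have -> : (m + n = minn N (1 * (m + n).+1 - 1))%N.
  by rewrite mul1n subn1 (minn_idPr _).
apply: secant_dim => //; last by rewrite mul1n.
- move=> x z Q; rewrite /combination big_ord1 => xz Qv; exists (x ord0), (z ord0).
  by split => //; apply: contraNneq xz => ->; rewrite ?sv_vec0l ?sv_vec0r.
- move=> f d fd fX Q [x [y [x0 y0 Qv]]]; apply/(pvanish_line fd Qv).
  have := fX (fun=> x) (fun=> y); by rewrite /combination big_ord1.
Qed.

Lemma secant_veronese_dim s : (0 < s)%N -> fill K m n s (N.+1 - s * (m + n).+1) ->
  has_dim (secant_variety s X) (minn N (s * (m + n).+1 - 1)).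
Proof.
move=> s0 F; apply: secant_dim => //.
- move=> x z Q c0 Qv B [_ +]; apply.
  have c1 k : (const_mx 1 : 'rV[K]_k.+1) != 0.
    by apply/rV0Pn; exists ord0; rewrite mxE oner_neq0.
  (* Points of the variety have nonzero arguments. Where a summand vanishes, any point may be
     used. *)
  pose nz k (v : 'rV[K]_k.+1) := if v == 0 then const_mx 1 else v.
  have nzP k (v : 'rV[K]_k.+1) : nz k v != 0.
    by rewrite /nz; case: ifP => [_|/negbT //]; apply: c1.
  have /choice[P PE] : forall p, exists P : proj K N,
      val P = <[sv_vec (nz _ (x p)) (nz _ (z p))]>%VS.
    by move=> p; apply/exists_proj/sv_vec_neq0.
  exists P.
    by move=> p; exists (nz _ (x p)), (nz _ (z p)); split; [apply: nzP | apply: nzP | apply: PE].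
  rewrite Qv -memvE; apply: memv_sumr => p _; rewrite PE /nz.
  case: (eqVneq (x p) 0) => [->|_]; first by rewrite sv_vec0l mem0v.
  case: (eqVneq (z p) 0) => [->|_]; first by rewrite sv_vec0r mem0v.
  exact: memv_line.
- move=> f d fd fX Q QW.
  have : [set P | forall g, g = f -> pvanish g P] Q.
    apply: QW; split.
      by apply: (@zero_locus_closed _ _ (fun g => g = f)) => _ ->; exists d.
    move=> R [P PX RP] _ ->; have [v v0 Rv] := proj_line R.
    have /choice[xy xyE] : forall p, exists xy, val (P p) = <[sv_vec xy.1 xy.2]>%VS.
      by move=> p; have [x [y [_ _ ->]]] := PX p; exists (x, y).
    have /memv_sumP[u uP vE] : v \in (\sum_(i < s) val (P i))%VS.
      by apply: (subvP RP); rewrite Rv memv_line.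
    have /choice[c cE] : forall p, exists c, u p = c *: sv_vec (xy p).1 (xy p).2.
      by move=> p; apply/vlineP; rewrite -xyE; apply: uP.
    apply/(pvanish_line fd Rv); rewrite vE.
    rewrite -(fX (fun p => c p *: (xy p).1) (fun p => (xy p).2)).
    rewrite /combination; congr (_.@[fun_of_matrix _ 0]); apply: eq_bigr => p _; rewrite cE /=.
    by rewrite -[(xy p).2 in RHS]scale1r sv_vecZ expr1n mulr1.
  by apply.
Qed.

Lemma nondefective_of_fill s : (0 < s)%N -> (m + n <= N)%N ->
  fill K m n 1 (N.+1 - (m + n).+1) -> fill K m n s (N.+1 - s * (m + n).+1) ->
  nondefective s X.
Proof.
move=> s0 mnN F1 Fs; exists (m + n)%N; first exact: segre_veronese_dim.
exact: secant_veronese_dim.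
Qed.

(* b is the number of points at which the tangent spaces are still independent. *)
Lemma nondefective_of_critical_fill b : (0 < b)%N ->
  (b * (m + n).+1 <= N.+1)%N -> (N.+1 <= b.+1 * (m + n).+1)%N ->
  fill K m n b (N.+1 - b * (m + n).+1) -> fill K m n b.+1 0 ->
  forall s, (0 < s)%N -> nondefective s X.
Proof.
move=> b0 bN Nb Fb Fb1.
have small k : (k < b)%N -> fill K m n (b - k) (N.+1 - (b - k) * (m + n).+1).
  elim: k => [_|k IH kb]; first by rewrite subn0.
  have := IH (ltnW kb); have -> : (b - k = (b - k.+1).+1)%N by lia.
  move/fill_drop; congr (fill _ _ _ _ _).
  have : ((b - k.+1).+1 * (m + n).+1 <= b * (m + n).+1)%N by rewrite leq_mul2r; lia.
  by rewrite mulSn; lia.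
have large k : fill K m n (b.+1 + k) 0.
  by elim: k => [|k IH]; rewrite ?addn0 // addnS; apply: fill_add.
have F s : (0 < s)%N -> fill K m n s (N.+1 - s * (m + n).+1).
  move=> s0; case: (leqP s b) => sb.
    by rewrite -(subKn sb); apply: small; lia.
  have -> : (N.+1 - s * (m + n).+1 = 0)%N.
    apply/eqP; rewrite subn_eq0; apply: leq_trans Nb _.
    by rewrite leq_mul2r sb orbT.
  by rewrite -(subnKC sb); apply: large.
move=> s s0; apply: nondefective_of_fill => //; last exact: F.
  have := leq_pmull (m + n).+1 b0; lia.
by have := F 1%N isT; rewrite mul1n.
Qed.

End SegreVeroneseSecants.

(** * Groups of points *)

Section GenericInjectivity.
Variables (K : numFieldType) (I : Type) (a b c : nat).
Local Notation form := ('rV[K]_a -> 'rV[K]_b -> 'rV[K]_c -> K).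
Local Notation idx := ('I_a * 'I_b * 'I_c)%type.

Lemma trilin_coord (f : form) x y z : trilin f ->
  f x y z = \sum_(p : idx) x 0 p.1.1 * y 0 p.1.2 * z 0 p.2 * f 'e_p.1.1 'e_p.1.2 'e_p.2.
Proof.
move=> ft; rewrite !sum_pairE {1}(row_sum_delta x) (trilin_sum1 ft).
apply: eq_bigr => i _; rewrite (trilinZ1 ft) {1}(row_sum_delta y) (trilin_sum2 ft).
rewrite mulr_sumr; apply: eq_bigr => j _.
rewrite (trilinZ2 ft) {1}(row_sum_delta z) (trilin_sum3 ft) !mulr_sumr.
by apply: eq_bigr => k _; rewrite (trilinZ3 ft) /= !mulrA.
Qed.

Definition polyeq (E : (I -> K) -> form -> K) :=
  exists M : (I -> K) -> idx -> K, (forall p, polyfun (fun t => M t p)) /\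
    forall t f, trilin f -> E t f = \sum_p M t p * f 'e_p.1.1 'e_p.1.2 'e_p.2.

Lemma polyeq_eval (X : (I -> K) -> 'rV[K]_a) (Y : (I -> K) -> 'rV[K]_b)
    (Z : (I -> K) -> 'rV[K]_c) :
  (forall i, polyfun (fun t => X t 0 i)) -> (forall i, polyfun (fun t => Y t 0 i)) ->
  (forall i, polyfun (fun t => Z t 0 i)) -> polyeq (fun t f => f (X t) (Y t) (Z t)).
Proof.
move=> XP YP ZP; exists (fun t p => X t 0 p.1.1 * Y t 0 p.1.2 * Z t 0 p.2); split.
  by move=> p; apply: polyfun_mul => //; apply: polyfun_mul.
by move=> t f ft; apply: trilin_coord.
Qed.

Lemma polyeq_sum (J : Type) (r : seq J) (s : J -> (I -> K) -> K) E :
  (forall j, polyfun (s j)) -> (forall j, polyeq (E j)) ->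
  polyeq (fun t f => \sum_(j <- r) s j t * E j t f).
Proof.
move=> sP /choice[M MP]; exists (fun t p => \sum_(j <- r) s j t * M j t p); split.
  move=> p; apply: polyfun_sum => j; apply: polyfun_mul => //.
  by case: (MP j) => /(_ p).
move=> t f ft; under eq_bigr => j _ do rewrite (proj2 (MP j)) // mulr_sumr.
rewrite exchange_big; apply: eq_bigr => p _; rewrite mulr_suml.
by apply: eq_bigr => j _; rewrite mulrA.
Qed.

Lemma polyeq_add E E' : polyeq E -> polyeq E' -> polyeq (fun t f => E t f + E' t f).
Proof.
move=> EP EP'; have := @polyeq_sum bool [:: true; false] (fun _ _ => 1)
  (fun j => if j then E else E') (fun=> polyfun_const _ _).
case; first by case.
move=> M [MP ME]; exists M; split => // t f ft; rewrite -ME //.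
by rewrite !big_cons big_nil !mul1r addr0.
Qed.

Lemma polyeq_if (q : bool) E : polyeq E -> polyeq (fun t f => if q then E t f else 0).
Proof.
case: q => // _; exists (fun _ _ => 0); split.
  by move=> p; apply: polyfun_const.
by move=> t f _; rewrite big1 // => p _; rewrite mul0r.
Qed.

(** In coordinates these are linear equations with coefficients polynomial in the parameters, so by
    [gen_inj] a single parameter with only the zero solution suffices. *)
Lemma gen_tri (J : finType) (E : J -> (I -> K) -> form -> K) :
  (forall j, polyeq (E j)) ->
  (exists t, forall f, trilin f -> (forall j, E j t f = 0) ->
     forall x y z, f x y z = 0) ->
  gen (fun t => forall f, trilin f -> (forall j, E j t f = 0) ->
     forall x y z, f x y z = 0).
Proof.
move=> /choice[M MP] [t0 inj0].
pose F (w : idx -> K) : form :=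
  fun x y z => \sum_p x 0 p.1.1 * y 0 p.1.2 * z 0 p.2 * w p.
have Ft w : trilin (F w).
  by split=> *; rewrite /F mulr_sumr -big_split; apply: eq_bigr => p _ /=;
    rewrite !mxE; ring.
have Fd w p : F w 'e_p.1.1 'e_p.1.2 'e_p.2 = w p.
  rewrite /F (bigD1 p) //= big1 ?addr0 => [|q].
    by rewrite !mxE !eqxx !mul1r.
  case: p q => [[i j] k] [[i' j'] k']; rewrite -!pair_eqE /= !mxE !eqxx /=.
  rewrite xpair_eqE.
  by case: (i' == i); case: (j' == j); case: (k' == k) => //= _;
    rewrite ?(mul0r, mulr0).
have inj0' w : (forall e, \sum_p M e t0 p * w p = 0) -> forall p, w p = 0.
  move=> wM p; rewrite -(Fd w p); apply: inj0 => // j.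
  rewrite (proj2 (MP j)) //; apply: etrans (wM j).
  by apply: eq_bigr => q _; rewrite Fd.
apply: gen_imp (gen_inj (M := fun t e p => M e t p) (fun e => proj1 (MP e)) inj0').
move=> t inj f ft Ef x y z; rewrite trilin_coord // big1 // => p _.
rewrite (inj (fun p => f 'e_p.1.1 'e_p.1.2 'e_p.2)) ?mulr0 // => e.
by rewrite -(proj2 (MP e)).
Qed.

End GenericInjectivity.

Lemma gen_reindex (K : numFieldType) (I J : Type) (h : J -> I) (r : I -> J)
    (P : (J -> K) -> Prop) : cancel h r -> gen P ->
  gen (fun a => P (fun j => a (h j))).
Proof.
move=> hr [F [[D FD] [a0 Fa0] FP]]; exists (fun a => F (fun j => a (h j))); split.
- by exists D => a b; apply: FD (fun j => a (h j)) (fun j => b (h j)).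
- exists (fun i => a0 (r i)); rewrite (_ : (fun j => _) = a0) //.
  by apply/funext => j; rewrite hr.
- by move=> a /FP.
Qed.

Lemma polyfun_reindex (K : numFieldType) (I J : Type) (h : J -> I) (F : (J -> K) -> K) :
  polyfun F -> polyfun (fun a : I -> K => F (fun j => a (h j))).
Proof. by case=> D FD; exists D => a b; apply: FD (fun j => a (h j)) (fun j => b (h j)). Qed.

(** * Relations imposed by one group *)

Section Group.
Variables (K : numFieldType) (m k : nat).
Variable f : 'rV[K]_m.+1 -> 'rV[K]_k -> 'rV[K]_k -> K.
Hypotheses (ft : trilin f) (fs : forall x y z, f x y z = f x z y).
Variables (x : nat -> 'rV[K]_m.+1) (u : nat -> 'rV[K]_k) (A A' : nat -> K).
Variables (l0 l1 : 'rV[K]_k).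
Hypotheses (A0 : A 0 = 0) (A'0 : A' 0 = 1) (A1 : A 1 = 1) (A'1 : A' 1 = 0).
Hypothesis A_neq0 : forall j, (1 < j <= m)%N -> A j != 0 /\ A' j != 0.
Hypothesis m_ge1 : (1 <= m)%N.

(* Up to a scalar this is u j + l0 / A j + l1 / A' j; the points 0 and 1 are the
   limits l0 and l1. *)
Definition group_point j := (A j * A' j) *: u j + (A' j *: l0 + A j *: l1).

Hypothesis f_quad : forall j w, (j <= m)%N -> f w (group_point j) (group_point j) = 0.
Hypothesis f_sing : forall j y, (j <= m)%N -> f (x j) (group_point j) y = 0.

Let ptE0 : group_point 0 = l0.
Proof. by rewrite /group_point A0 A'0 mul0r !scale0r add0r addr0 scale1r. Qed.
Let ptE1 : group_point 1 = l1.
Proof. by rewrite /group_point A1 A'1 mulr0 !scale0r !add0r scale1r. Qed.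
Let fq0 w : f w l0 l0 = 0. Proof. by rewrite -ptE0 f_quad. Qed.
Let fq1 w : f w l1 l1 = 0. Proof. by rewrite -ptE1 f_quad. Qed.
Let fx0 y : f (x 0) l0 y = 0. Proof. by rewrite -ptE0 f_sing. Qed.
Let fx1 y : f (x 1) l1 y = 0. Proof. by rewrite -ptE1 f_sing. Qed.

Let fpt w j y : f w (group_point j) y =
  A j * A' j * f w (u j) y + (A' j * f w l0 y + A j * f w l1 y).
Proof. by rewrite !(trilinD2 ft) !(trilinZ2 ft). Qed.

Let quadE w j : (1 < j <= m)%N ->
  A j * A' j * f w (u j) (u j) + 2 * (A' j * f w (u j) l0 + A j * f w (u j) l1)
    + 2 * f w l0 l1 = 0.
Proof.
move=> /[dup] /A_neq0[a0 a'0] /andP[_ jm].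
apply: (mulfI (mulf_neq0 a0 a'0)); rewrite mulr0 -(f_quad w jm) fpt.
rewrite !(fs w _ (group_point j)) !fpt fq0 fq1 !(fs w (u j)) (fs w l1 l0); ring.
Qed.

(** At w = x_0 every term of the quadratic condition that contains l0 vanishes. *)
Lemma group_edge0 j : (1 < j <= m)%N ->
  2 * f (x 0) (u j) l1 = - A' j * f (x 0) (u j) (u j).
Proof.
move=> jm; have [a0 _] := A_neq0 jm; have := quadE (x 0) jm.
rewrite (fs _ (u j) l0) !fx0 !(mulr0, addr0, add0r) => q.
apply: (mulfI a0); apply/eqP; rewrite -subr_eq0 -[X in _ == X]q; apply/eqP; ring.
Qed.

Lemma group_edge1 j : (1 < j <= m)%N ->
  2 * f (x 1) (u j) l0 = - A j * f (x 1) (u j) (u j).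
Proof.
move=> jm; have [_ a0] := A_neq0 jm; have := quadE (x 1) jm.
rewrite (fs _ (u j) l1) (fs _ l0 l1) !fx1 !(mulr0, addr0, add0r) => q.
apply: (mulfI a0); apply/eqP; rewrite -subr_eq0 -[X in _ == X]q; apply/eqP; ring.
Qed.

Lemma group_extra (z : 'rV[K]_m.+1) om ps : x 1 = om *: z + ps *: x 0 -> ps != 0 ->
  f z (\sum_(2 <= j < m.+1) u j) l0 = 0 -> f z (\sum_(2 <= j < m.+1) u j) l1 = 0 ->
  \sum_(2 <= j < m.+1) A j * f (x 1) (u j) (u j) = 0 /\
  \sum_(2 <= j < m.+1) A' j * f (x 0) (u j) (u j) = 0.
Proof.
move=> x1E ps0; set v := \sum_(2 <= j < m.+1) u j => z0 z1.
have x1v : f (x 1) v l0 = 0.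
  by rewrite x1E (trilinD1 ft) !(trilinZ1 ft) z0 (fs _ v) fx0 !mulr0 addr0.
have x0v : f (x 0) v l1 = 0.
  apply: (mulfI ps0); rewrite mulr0 -(trilinZ1 ft).
  have -> : ps *: x 0 = x 1 - om *: z by rewrite x1E addrAC subrr add0r.
  by rewrite (trilinB1 ft) (trilinZ1 ft) z1 (fs _ v) fx1 mulr0 subrr.
split; apply: oppr_inj; rewrite oppr0.
  rewrite -[RHS](mulr0 2) -[in RHS]x1v (trilin_sum2 ft) mulr_sumr -sumrN.
  by apply: eq_big_nat => j jm; rewrite group_edge1 ?mulNr.
rewrite -[RHS](mulr0 2) -[in RHS]x0v (trilin_sum2 ft) mulr_sumr -sumrN.
by apply: eq_big_nat => j jm; rewrite group_edge0 ?mulNr.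
Qed.

(** Here the u_j sum to w - v, with (e, v) and (z, w) two further points. As before f(x_0, v, l1) =
    0, so the edge relations compute f(x_0, w, l1). The singularity at point 2, whose x_2 lies on
    the line through x_0 and z, computes it again, and comparison leaves one condition. *)
Lemma group_extra_half (e z : 'rV[K]_m.+1) (v w : 'rV[K]_k) om ps om' ps' :
  (2 <= m)%N -> x 1 = om *: e + ps *: x 0 -> ps != 0 ->
  x 2 = om' *: z + ps' *: x 0 -> ps' != 0 ->
  \sum_(2 <= j < m.+1) u j = w - v ->
  f e v l1 = 0 -> f z w l0 = 0 -> f z w l1 = 0 -> f z w (u 2) = 0 ->
  \sum_(2 <= j < m.+1) A' j * f (x 0) (u j) (u j) - 2 * A' 2 * f (x 0) (u 2) w = 0.
Proof.
move=> m2 x1E ps0 x2E ps'0 uE ev zw0 zw1 zwu.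
have x0v : f (x 0) v l1 = 0.
  apply: (mulfI ps0); rewrite mulr0 -(trilinZ1 ft).
  have -> : ps *: x 0 = x 1 - om *: e by rewrite x1E addrAC subrr add0r.
  by rewrite (trilinB1 ft) (trilinZ1 ft) ev (fs _ v) fx1 mulr0 subrr.
have x0w : 2 * f (x 0) w l1 = - \sum_(2 <= j < m.+1) A' j * f (x 0) (u j) (u j).
  have -> : w = \sum_(2 <= j < m.+1) u j + v by rewrite uE subrK.
  rewrite (trilinD2 ft) x0v addr0 (trilin_sum2 ft) mulr_sumr -sumrN.
  by apply: eq_big_nat => j jm; rewrite group_edge0 ?mulNr.
have [a0 _] : A 2 != 0 /\ A' 2 != 0 by apply: A_neq0.
have := f_sing w m2; rewrite fpt x2E !(trilinD1 ft) !(trilinZ1 ft) fx0.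
rewrite (fs z) zwu (fs z l0) zw0 (fs z l1) zw1 (fs _ l1 w) => sg.
have {}sg : A' 2 * f (x 0) (u 2) w + f (x 0) w l1 = 0.
  by apply: (mulfI (mulf_neq0 a0 ps'0)); rewrite mulr0 -[RHS]sg; ring.
have -> : \sum_(2 <= j < m.+1) A' j * f (x 0) (u j) (u j) = - (2 * f (x 0) w l1).
  by rewrite x0w opprK.
by rewrite -[RHS](mulr0 (- 2)) -[in RHS]sg; ring.
Qed.

Hypothesis A_ratio : forall i j, (1 < i <= m)%N -> (1 < j <= m)%N -> i != j ->
  A i * A' j != A' i * A j.

(** For i >= 2 the singularity at point i, contracted with l0, l1 and u_i, gives f(x_i, l0, l1) = 0.
    For j other than i its contraction with u_j and the quadratic condition at j are two equations
    in f(x_i, u_j, l0) and f(x_i, u_j, l1), independent by [A_ratio]. *)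
Lemma group_vanish : (2 <= m)%N ->
  (forall w i j, f w (u i) (u j) = 0) ->
  forall i, (i <= m)%N -> f (x i) l0 l1 = 0 /\
    forall j, (1 < j <= m)%N -> f (x i) (u j) l0 = 0 /\ f (x i) (u j) l1 = 0.
Proof.
move=> m2 fu i im; have two0 : (2 : K) != 0 by rewrite pnatr_eq0.
have quad j : (1 < j <= m)%N ->
    A' j * f (x i) (u j) l0 + A j * f (x i) (u j) l1 + f (x i) l0 l1 = 0.
  move=> jm; apply: (mulfI two0); rewrite mulr0 -[RHS](quadE (x i) jm) fu; ring.
case: (ltngtP i 1) => i1.
- have -> : i = 0 by lia.
  split; first exact: fx0.
  move=> j jm; split; first by rewrite (fs _ (u j)) fx0.
  by apply: (mulfI two0); rewrite group_edge0 // fu !mulr0.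
- have jm : (1 < i <= m)%N by rewrite i1.
  have [a0 a'0] := A_neq0 jm.
  have s0 : A' i * f (x i) (u i) l0 = - f (x i) l0 l1.
    apply: (mulfI a0); have := f_sing l0 im; rewrite fpt fq0 (fs _ l1) => sg.
    by apply/eqP; rewrite -subr_eq0 -[X in _ == X]sg; apply/eqP; ring.
  have s1 : A i * f (x i) (u i) l1 = - f (x i) l0 l1.
    apply: (mulfI a'0); have := f_sing l1 im; rewrite fpt fq1 => sg.
    by apply/eqP; rewrite -subr_eq0 -[X in _ == X]sg; apply/eqP; ring.
  have su j : A' i * f (x i) (u j) l0 + A i * f (x i) (u j) l1 = 0.
    by have := f_sing (u j) im; rewrite fpt fu mulr0 add0r !(fs _ _ (u j)).
  have c0 : f (x i) l0 l1 = 0.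
    apply: (mulfI two0); have := su i; rewrite s0 s1 => sg.
    by rewrite mulr0 -oppr0 -[in RHS]sg; ring.
  split => // j jmm.
  have [-> | ij] := eqVneq j i.
    by split; [apply: (mulfI a'0) | apply: (mulfI a0)]; rewrite ?s0 ?s1 c0 oppr0 mulr0.
  have q := quad j jmm; rewrite c0 addr0 in q; have s := su j.
  have D0 : A j * A' i - A' j * A i != 0 by rewrite subr_eq0 A_ratio.
  set p := f (x i) (u j) l0 in q s *; set r := f (x i) (u j) l1 in q s *.
  split; apply: (mulfI D0); rewrite mulr0.
    transitivity (A j * (A' i * p + A i * r) - A i * (A' j * p + A j * r)).
      by ring.
    by rewrite s q !mulr0 subrr.
  transitivity (A' i * (A' j * p + A j * r) - A' j * (A' i * p + A i * r)).
    by ring.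
  by rewrite s q !mulr0 subrr.
- rewrite i1; split; first by rewrite fs fx1.
  move=> j jm; split; last by rewrite (fs _ (u j)) fx1.
  by apply: (mulfI two0); rewrite group_edge1 // fu !mulr0.
Qed.

End Group.

Lemma fill_fin (K : numFieldType) m n (P T : finType) (X : P -> 'rV[K]_m.+1)
    (Z : P -> 'rV[K]_n.+1) (U : T -> 'rV[K]_m.+1 * 'rV[K]_n.+1 * 'rV[K]_n.+1) :
  (forall f, trilin f -> (forall x y z, f x y z = f x z y) ->
    (forall p x, f x (Z p) (Z p) = 0) -> (forall p y, f (X p) (Z p) y = 0) ->
    (forall k, f (U k).1.1 (U k).1.2 (U k).2 = 0) ->
  forall x y z, f x y z = 0) -> fill K m n #|P| #|T|.
Proof.
move=> XZU; exists (fun p => X (enum_val p)), (fun p => Z (enum_val p)).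
exists (fun k => U (enum_val k)) => f ft fs f1 f2 fU; apply: XZU => //.
- by move=> p x; have := f1 (enum_rank p) x; rewrite enum_rankK.
- by move=> p y; have := f2 (enum_rank p) y; rewrite enum_rankK.
- by move=> k; have := fU (enum_rank k); rewrite enum_rankK.
Qed.

Lemma trilin1_sum (K : numFieldType) a b c (f : 'rV[K]_a -> 'rV[K]_b -> 'rV[K]_c -> K)
    x y z : trilin f -> f x y z = \sum_i x 0 i * f 'e_i y z.
Proof.
move=> ft; rewrite {1}(row_sum_delta x) (trilin_sum1 ft).
by apply: eq_bigr => i _; rewrite (trilinZ1 ft).
Qed.

(** * Parametrized configurations of groups *)

Section Configuration.
Variables (K : numFieldType) (m d : nat).
Local Notation V := ('rV[K]_m.+1).
Local Notation U := ('rV[K]_d).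
Local Notation L := ('rV[K]_2).

(* The parameters of one group of m + 1 points: with first index 0 the vectors x_j,
   with first index 1 the vectors u_j, with first index 2 the scalars. *)
Local Notation param := (nat * nat * nat -> K).
Implicit Type c : param.

Section OneGroup.
Variables (z : V) (z' : option V) (zeta : U).

(** x_1 is forced onto the line through x_0 and [z]. If present, [z'] forces x_2 onto the line
    through x_0 and that vector, as needed for m even and n odd. *)
Definition gx c (j : nat) : V :=
  let P := \row_k c (0, 0, k : nat)%N in
  if j == 0 then P
  else if j == 1 then c (2, 0, 0)%N *: z + c (2, 0, 1)%N *: P
  else if j == 2 then
    if z' is Some w then c (2, 1, 0)%N *: w + c (2, 1, 1)%N *: P
    else \row_k c (0, 2, k : nat)%N
  else \row_k c (0, j, k : nat)%N.

(** u_2 is solved for, so that the u_j sum to [zeta] whatever the parameters are. *)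
Definition gu c (j : nat) : U :=
  if j == 2 then zeta - \sum_(3 <= i < m.+1) \row_k c (1, i, k : nat)%N
  else \row_k c (1, j, k : nat)%N.

Definition gA c (j : nat) : K :=
  if j == 0 then 0 else if j == 1 then 1 else c (2, j, 0)%N.

Definition gA' c (j : nat) : K :=
  if j == 0 then 1 else if j == 1 then 0 else c (2, j, 1)%N.

Lemma gAE c j : (1 < j)%N -> gA c j = c (2, j, 0)%N.
Proof. by case: j => [|[|j]]. Qed.

Lemma gA'E c j : (1 < j)%N -> gA' c j = c (2, j, 1)%N.
Proof. by case: j => [|[|j]]. Qed.

Definition gl c j : L := gA' c j *: 'e_0 + gA c j *: 'e_1.

Lemma sum_gu c : (2 <= m)%N -> \sum_(2 <= j < m.+1) gu c j = zeta.
Proof.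
move=> m2; rewrite big_ltn ?ltnS // {1}/gu eqxx.
suff -> : \sum_(3 <= j < m.+1) gu c j = \sum_(3 <= j < m.+1) \row_k c (1, j, k : nat)%N.
  by rewrite subrK.
by apply: eq_big_nat => j /andP[j3 _]; rewrite /gu; case: eqP => // j2; rewrite j2 in j3.
Qed.

Lemma gx_poly j i : polyfun (fun c => gx c j 0 i).
Proof.
have rowP' (h : 'I_m.+1 -> nat * nat * nat) :
    polyfun (fun c => (\row_k c (h k)) 0 i).
  rewrite (_ : (fun c => _) = (fun c => c (h i))); first exact: polyfun_var.
  by apply/funext => c; rewrite mxE.
have combP (v : V) p q : polyfun (fun c : param =>
    (c p *: v + c q *: \row_k c (0, 0, k : nat)%N) 0 i).
  rewrite (_ : (fun c => _) = (fun c => c p * v 0 i + c q * c (0, 0, i : nat)%N)).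
    apply: polyfun_add; apply: polyfun_mul; try exact: polyfun_var.
    exact: polyfun_const.
  by apply/funext => c; rewrite !mxE.
rewrite /gx; case: (j == 0); first exact: rowP'.
case: (j == 1); first exact: combP.
by case: (j == 2); [case: z' => [w|]|]; rewrite //; apply: rowP'.
Qed.

Lemma gu_poly j i : polyfun (fun c => gu c j 0 i).
Proof.
rewrite /gu; case: (j == 2).
  rewrite (_ : (fun c => _) =
      (fun c => zeta 0 i + - \sum_(3 <= k < m.+1) c (1, k, i : nat)%N)).
    apply: polyfun_add; first exact: polyfun_const.
    by apply: polyfun_opp; apply: polyfun_sum => k; apply: polyfun_var.
  by apply/funext => c; rewrite !mxE summxE; under eq_bigr do rewrite mxE.
rewrite (_ : (fun c => _) = (fun c => c (1, j, i : nat)%N)); first exact: polyfun_var.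
by apply/funext => c; rewrite mxE.
Qed.

Lemma gA_poly j : polyfun (fun c => gA c j).
Proof.
rewrite /gA; case: (j == 0); first exact: polyfun_const.
by case: (j == 1); [apply: polyfun_const | apply: polyfun_var].
Qed.

Lemma gA'_poly j : polyfun (fun c => gA' c j).
Proof.
rewrite /gA'; case: (j == 0); first exact: polyfun_const.
by case: (j == 1); [apply: polyfun_const | apply: polyfun_var].
Qed.

Lemma gl_poly j i : polyfun (fun c => gl c j 0 i).
Proof.
rewrite (_ : (fun c => _) =
    (fun c => gA' c j * ('e_0 : L) 0 i + gA c j * ('e_1 : L) 0 i)).
  by apply: polyfun_add; apply: polyfun_mul; rewrite ?gA_poly;
    try exact: polyfun_const; [apply: gA'_poly | apply: gA_poly].
by apply/funext => c; rewrite !mxE.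
Qed.

(** The nonvanishing hypotheses on scalars in the group lemmas; the last two scalars are the
    coefficients of x_0 in x_1 and in x_2. *)
Definition scalars_ok c :=
  [/\ forall j, (1 < j <= m)%N -> gA c j != 0 /\ gA' c j != 0,
      forall i j, (1 < i <= m)%N -> (1 < j <= m)%N -> i != j ->
        gA c i * gA' c j != gA' c i * gA c j,
      c (2, 0, 1)%N != 0 & c (2, 1, 1)%N != 0].

Definition std_scalar (j k : nat) : K := if k == 0 then 1 else j.+1%:R.

Lemma gen_scalars_ok : gen scalars_ok.
Proof.
pose c0 : param := fun q => std_scalar q.1.2 q.2.
pose F (p : 'I_m.+1 * 'I_m.+1) c :=
  if (1 < p.1)%N && (1 < p.2)%N && (p.1 != p.2) then
    gA c p.1 * gA' c p.2 - gA' c p.1 * gA c p.2 else 1.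
have G1 := gen_all (fun j : 'I_m.+1 => @gen_neq0 K _ _ c0
  (@polyfun_var K _ (2, (j : nat), 0)%N) (oner_neq0 K)).
have G2 : gen (fun c => forall j : 'I_m.+1, c (2, (j : nat), 1)%N != 0).
  apply: gen_all => j; apply: (gen_neq0 (a := c0)); first exact: polyfun_var.
  by rewrite pnatr_eq0.
have G3 : gen (fun c => c (2, 0, 1)%N != 0 /\ c (2, 1, 1)%N != 0).
  by apply: gen_and; apply: (gen_neq0 (a := c0)); try exact: polyfun_var;
    rewrite pnatr_eq0.
have G4 : gen (fun c => forall p, F p c != 0).
  apply: gen_all => p; apply: (gen_neq0 (a := c0)).
    rewrite /F; case: (_ && _); last exact: polyfun_const.
    by apply: polyfun_add; [|apply: polyfun_opp]; apply: polyfun_mul;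
      (exact: gA_poly || exact: gA'_poly).
  rewrite /F; case: ifP => [/andP[/andP[p1 p2] pp] | _]; last exact: oner_neq0.
  rewrite !gAE // !gA'E //.
  rewrite /c0 /std_scalar /= mul1r mulr1 subr_eq0 eqr_nat eqSS eq_sym.
  by rewrite val_eqE.
apply: gen_imp (gen_and (gen_and G1 G2) (gen_and G3 G4)).
move=> c [[a1 a2] [[p1 p2] a4]]; split => //.
  move=> j /andP[j1 jm]; rewrite gAE // gA'E //.
  by split; [apply: (a1 (Ordinal (jm : (j < m.+1)%N))) | apply: (a2 (Ordinal (jm : (j < m.+1)%N)))].
move=> i j /andP[i1 im] /andP[j1 jm] ij.
have := a4 (Ordinal (im : (i < m.+1)%N), Ordinal (jm : (j < m.+1)%N)).
by rewrite /F /= i1 j1 -val_eqE /= ij subr_eq0.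
Qed.

Definition basis_ok c := forall w : 'I_m.+1 -> K,
  (forall j : 'I_m.+1, \sum_i gx c j 0 i * w i = 0) -> forall i, w i = 0.

Lemma gen_basis_ok : (exists c, basis_ok c) -> gen basis_ok.
Proof.
case=> c0 B0.
exact: (gen_inj (M := fun c (j i : 'I_m.+1) => gx c j 0 i) (fun j i => gx_poly j i) B0).
Qed.

(* S collects the conditions that come from points outside the group. *)
Definition extension_ok (S : seq (V * U * L)) c := forall g : V -> U -> L -> K, trilin g ->
  (forall x j l, (1 < j <= m)%N -> g x (gu c j) l = 0) ->
  (forall j v, (j <= m)%N -> g (gx c j) v (gl c j) = 0) ->
  (forall p, p \in S -> g p.1.1 p.1.2 p.2 = 0) ->
  forall x v l, g x v l = 0.

Lemma gen_extension_ok S : (exists c, extension_ok S c) -> gen (extension_ok S).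
Proof.
pose J := ('I_m.+1 * 'I_m.+1 * 'I_2 + 'I_m.+1 * 'I_d + 'I_(size S))%type.
pose E (q : J) c (g : V -> U -> L -> K) := match q with
  | inl (inl (i, j, l)) => if (1 < j)%N then g 'e_i (gu c j) 'e_l else 0
  | inl (inr (j, v)) => g (gx c j) 'e_v (gl c j)
  | inr p => g (nth (0, 0, 0) S p).1.1 (nth (0, 0, 0) S p).1.2 (nth (0, 0, 0) S p).2
  end.
have EP q : polyeq (E q).
  have cst k (v : 'rV[K]_k) i : polyfun (fun c : param => v 0 i).
    exact: polyfun_const.
  case: q => [[[[i j] l]|[j v]]|p] /=.
  - by apply: polyeq_if; apply: (polyeq_eval (X := fun=> _) (Z := fun=> _)) => // k; apply: gu_poly.
  - by apply: (polyeq_eval (Y := fun=> _)) => // k; [apply: gx_poly | apply: gl_poly].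
  - exact: (polyeq_eval (X := fun=> _) (Y := fun=> _) (Z := fun=> _)).
move=> [c0 ok0]; apply: gen_imp (gen_tri EP _) => [c ok g gt g1 g2 gS|].
  apply: ok => // -[[[[i j] l]|[j v]]|p] /=.
  - by case: ifP => // j1; apply: g1; rewrite j1 -ltnS /=.
  - by apply: g2; rewrite -ltnS.
  - by apply: gS; apply: mem_nth.
exists c0 => g gt gE; apply: ok0 => //.
- move=> x j l /andP[j1 jm]; have jm' : (j < m.+1)%N by [].
  move: x; apply: (trilin1_eq0 gt) => i; move: l; apply: (trilin3_eq0 gt) => l.
  by have := gE (inl (inl (i, Ordinal jm', l))); rewrite /= j1.
- move=> j v jm; have jm' : (j < m.+1)%N by [].
  move: v; apply: (trilin2_eq0 gt) => v.
  exact: (gE (inl (inr (Ordinal jm', v)))).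
- move=> p pS; have ip : (index p S < size S)%N by rewrite index_mem.
  by have := gE (inr (Ordinal ip)); rewrite /= nth_index.
Qed.

End OneGroup.

Section TwoGroups.
Variables (z1 z2 : V) (z1' z2' : option V).

(** What remains of the conditions on the block of two planes once the blocks V x U x L vanish:
    2(m+1) equations from either group for 4(m+1) unknowns. *)
Definition cross_ok (c1 c2 : param) := forall D : V -> L -> L -> K, trilin D ->
  (forall j l, (j <= m)%N -> D (gx z1 z1' c1 j) (gl c1 j) l = 0) ->
  (forall j l, (j <= m)%N -> D (gx z2 z2' c2 j) l (gl c2 j) = 0) ->
  forall x l l', D x l l' = 0.

Lemma gen_cross_ok : (exists c1 c2, cross_ok c1 c2) ->
  gen (fun a : bool * (nat * nat * nat) -> K =>
    cross_ok (fun q => a (true, q)) (fun q => a (false, q))).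
Proof.
pose J := ('I_m.+1 * 'I_2 + 'I_m.+1 * 'I_2)%type.
pose E (q : J) (a : bool * (nat * nat * nat) -> K) (D : V -> L -> L -> K) :=
  match q with
  | inl (j, l) => D (gx z1 z1' (fun q => a (true, q)) j) (gl (fun q => a (true, q)) j) 'e_l
  | inr (j, l) => D (gx z2 z2' (fun q => a (false, q)) j) 'e_l (gl (fun q => a (false, q)) j)
  end.
have EP q : polyeq (E q).
  have cst k (v : 'rV[K]_k) i : polyfun (fun c : bool * (nat * nat * nat) -> K => v 0 i).
    exact: polyfun_const.
  case: q => -[j l] /=.
  - apply: (polyeq_eval (Z := fun=> _)) => // k.
      by apply: (polyfun_reindex (pair true) (gx_poly z1 z1' j k)).
    by apply: (polyfun_reindex (pair true) (gl_poly j k)).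
  - apply: (polyeq_eval (Y := fun=> _)) => // k.
      by apply: (polyfun_reindex (pair false) (gx_poly z2 z2' j k)).
    by apply: (polyfun_reindex (pair false) (gl_poly j k)).
move=> [c1 [c2 ok0]]; apply: gen_imp (gen_tri EP _) => [c ok D Dt D1 D2|].
  by apply: ok => // -[] [j l]; [apply: D1 | apply: D2]; rewrite -ltnS.
exists (fun q => if q.1 then c1 q.2 else c2 q.2) => D Dt DE; apply: ok0 => //.
- move=> j l jm; have jm' : (j < m.+1)%N by [].
  move: l; apply: (trilin3_eq0 Dt) => l.
  exact: (DE (inl (Ordinal jm', l))).
- move=> j l jm; have jm' : (j < m.+1)%N by [].
  move: l; apply: (trilin2_eq0 Dt) => l.
  exact: (DE (inr (Ordinal jm', l))).
Qed.

End TwoGroups.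

Variables (t : nat) (z : 'I_t -> V) (z' : 'I_t -> option V) (zeta : 'I_t -> U).
Variable S : 'I_t -> seq (V * U * L).
Local Notation params := ('I_t * (nat * nat * nat) -> K).
Definition group_param (a : params) (i : 'I_t) : param := fun q => a (i, q).
Local Notation X a i := (gx (z i) (z' i) (group_param a i)).

Definition config_ok (a : params) :=
  [/\ forall i, scalars_ok (group_param a i),
      forall i, basis_ok (z i) (z' i) (group_param a i),
      forall i, extension_ok (z i) (z' i) (zeta i) (S i) (group_param a i) &
      forall i j, i != j -> cross_ok (z i) (z j) (z' i) (z' j)
        (group_param a i) (group_param a j)].

(** The conditions concern single groups or pairs of groups, and their witnesses may contradict each
    other; genericity combines them. *)
Lemma config_exists (Q : params -> Prop) : gen Q ->
  (forall i, exists c, basis_ok (z i) (z' i) c) ->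
  (forall i, exists c, extension_ok (z i) (z' i) (zeta i) (S i) c) ->
  (forall i j, i != j -> exists c1 c2, cross_ok (z i) (z j) (z' i) (z' j) c1 c2) ->
  exists2 a, config_ok a & Q a.
Proof.
move=> Qg B E C.
have pairK (i : 'I_t) : cancel (pair i : nat * nat * nat -> _) snd by [].
have G1 := gen_all (fun i => gen_reindex (pairK i) gen_scalars_ok).
have G2 := gen_all (fun i => gen_reindex (pairK i) (gen_basis_ok (B i))).
have G3 := gen_all (fun i => gen_reindex (pairK i) (gen_extension_ok (E i))).
have G4 : gen (fun a : params => forall p : 'I_t * 'I_t, p.1 != p.2 ->
    cross_ok (z p.1) (z p.2) (z' p.1) (z' p.2) (group_param a p.1) (group_param a p.2)).
  apply: gen_all => -[i j] /=; have [->|ij] := eqVneq i j.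
    by apply: gen_imp (gen_true _ _).
  pose h (q : bool * (nat * nat * nat)) := (if q.1 then i else j, q.2).
  have hK : cancel h (fun q => (q.1 == i, q.2)).
    by move=> [[] q] /=; rewrite /h /= ?eqxx // eq_sym (negPf ij).
  apply: gen_imp (gen_reindex hK (gen_cross_ok (C i j ij))) => a ok _.
  exact: ok.
have [a [[[a1 a2] [a3 a4]] Qa]] :=
  gen_ex (gen_and (gen_and (gen_and G1 G2) (gen_and G3 G4)) Qg).
by exists a => //; split => // i j ij; apply: (a4 (i, j)).
Qed.

Section Vanishing.
Variables (k : nat) (iota : 'M[K]_(d, k)) (kappa : 'I_t -> 'M[K]_(2, k)).
Hypothesis decomposition : forall y : 'rV[K]_k, exists (v : U) (l : 'I_t -> L),
  y = v *m iota + \sum_i l i *m kappa i.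
Variable f : V -> 'rV[K]_k -> 'rV[K]_k -> K.
Hypotheses (ft : trilin f) (fs : forall x y z, f x y z = f x z y).

Definition config_point (a : params) i j : 'rV[K]_k :=
  let c := group_param a i in
  (gA c j * gA' c j) *: (gu (zeta i) c j *m iota) + gl c j *m kappa i.

Variable a : params.
Hypothesis f_quad : forall i j x, (j <= m)%N ->
  f x (config_point a i j) (config_point a i j) = 0.
Hypothesis f_sing : forall i j y, (j <= m)%N -> f (X a i j) (config_point a i j) y = 0.

Lemma config_pointE i j : config_point a i j =
  group_point (fun j => gu (zeta i) (group_param a i) j *m iota)
    (gA (group_param a i)) (gA' (group_param a i))
    ('e_0 *m kappa i) ('e_1 *m kappa i) j.
Proof. by rewrite /config_point /gl mulmxDl -!scalemxAl. Qed.

Hypothesis aok : config_ok a.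
Hypothesis m2 : (2 <= m)%N.

Lemma trilin_mul b1 b2 (M1 : 'M[K]_(b1, k)) (M2 : 'M[K]_(b2, k)) :
  trilin (fun x (v : 'rV_b1) (w : 'rV_b2) => f x (v *m M1) (w *m M2)).
Proof.
by split=> *; rewrite ?mulmxDl -?scalemxAl ?(trilinD1 ft, trilinD2 ft, trilinD3 ft)
  ?(trilinZ1 ft, trilinZ2 ft, trilinZ3 ft).
Qed.

Lemma basis_vanish i y y' : (forall j : nat, (j <= m)%N -> f (X a i j) y y' = 0) ->
  forall x, f x y y' = 0.
Proof.
move=> f0; case: aok => _ /(_ i) B _ _.
apply: (trilin1_eq0 ft) => r; apply: (B (fun r => f 'e_r y y')) => j.
by rewrite -(trilin1_sum _ _ _ ft); apply: f0; rewrite -ltnS ltn_ord.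
Qed.

Hypothesis f_ext : forall i p, p \in S i -> f p.1.1 (p.1.2 *m iota) (p.2 *m kappa i) = 0.
Hypothesis f_core : forall x v w, f x (v *m iota) (w *m iota) = 0.

(** Block by block: inside one plane by [group_vanish] and the basis x_j of V, then V x U x L by
    [extension_ok], where [f_core] removes the U-part of the singular conditions, and finally two
    different planes by [cross_ok]. *)
Lemma config_vanish x y y' : f x y y' = 0.
Proof.
case: (aok) => sc B E C.
have gv i j (jm : (j <= m)%N) :
    f (X a i j) ('e_0 *m kappa i) ('e_1 *m kappa i) = 0 /\
    forall r, (1 < r <= m)%N ->
      f (X a i j) (gu (zeta i) (group_param a i) r *m iota) ('e_0 *m kappa i) = 0 /\
      f (X a i j) (gu (zeta i) (group_param a i) r *m iota) ('e_1 *m kappa i) = 0.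
  apply: (@group_vanish K m k f ft fs (X a i)
    (fun j => gu (zeta i) (group_param a i) j *m iota)
    (gA (group_param a i)) (gA' (group_param a i))
    ('e_0 *m kappa i) ('e_1 *m kappa i)) => //.
  - by case: (sc i).
  - exact: ltnW.
  - by move=> r w rm; rewrite -config_pointE f_quad.
  - by move=> r w rm; rewrite -config_pointE f_sing.
  - by case: (sc i).
have pairs (b : nat) (M : 'M[K]_(b, k)) i (w : 'rV_b) x0 (l : L) :
    f x0 (w *m M) ('e_0 *m kappa i) = 0 -> f x0 (w *m M) ('e_1 *m kappa i) = 0 ->
    f x0 (w *m M) (l *m kappa i) = 0.
  move=> w0 w1; move: l; apply: (trilin3_eq0 (trilin_mul M (kappa i))) => q.
  case: (unliftP ord0 q) => [r ->|-> //].
  by rewrite (_ : lift ord0 r = 1) // (ord1 r); apply/val_inj.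
have quadL i x0 (j : nat) : (j <= 1)%N ->
    let e := if j == 0 then 'e_0 else 'e_1 : L in
    f x0 (e *m kappa i) (e *m kappa i) = 0.
  case: j => [|[|//]] _ /=.
    have := f_quad i x0 (leq0n m); rewrite config_pointE /group_point /gA /gA' /=.
    by rewrite mul0r !scale0r add0r addr0 scale1r.
  have := f_quad i x0 (ltnW m2); rewrite config_pointE /group_point /gA /gA' /=.
  by rewrite mulr0 !scale0r !add0r scale1r.
have CC i x0 (l l' : L) : f x0 (l *m kappa i) (l' *m kappa i) = 0.
  have c01 : f x0 ('e_0 *m kappa i) ('e_1 *m kappa i) = 0.
    by move: x0; apply: (@basis_vanish i) => j /(gv i)[].
  apply pairs.
    rewrite fs; apply pairs; first exact: (quadL i x0 0%N).
    exact: c01.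
  by rewrite fs; apply pairs; [rewrite fs | exact: (quadL i x0 1%N)].
have BB i x0 (v : U) (l : L) : f x0 (v *m iota) (l *m kappa i) = 0.
  move: x0 v l; apply: (E i _ (trilin_mul iota (kappa i))).
  - move=> x0 j l jm; move: x0; apply: (@basis_vanish i) => r /(gv i)[_ /(_ j jm)[g0 g1]].
    exact: pairs.
  - move=> j v jm; have := f_sing i (v *m iota) jm; rewrite /config_point.
    by rewrite (trilinD2 ft) (trilinZ2 ft) f_core mulr0 add0r fs.
  - exact: f_ext.
have DD i j x0 (l l' : L) : i != j -> f x0 (l *m kappa i) (l' *m kappa j) = 0.
  move=> ij; move: x0 l l'.
  apply: (C i j ij _ (trilin_mul (kappa i) (kappa j))) => r l rm.
    have := f_sing i (l *m kappa j) rm; rewrite /config_point.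
    by rewrite (trilinD2 ft) (trilinZ2 ft) BB mulr0 add0r.
  have := f_sing j (l *m kappa i) rm; rewrite /config_point.
  by rewrite (trilinD2 ft) (trilinZ2 ft) BB mulr0 add0r fs.
have [v [l ->]] := decomposition y; have [v' [l' ->]] := decomposition y'.
rewrite (trilinD2 ft) !(trilinD3 ft) f_core add0r !(trilin_sum3 ft) big1; last first.
  by move=> i _; rewrite BB.
rewrite add0r (trilin_sum2 ft) big1 ?add0r; last by move=> i _; rewrite fs BB.
rewrite big1 // => j _; rewrite (trilin_sum2 ft) big1 // => i _.
by case: (eqVneq i j) => [->|ij]; [apply: CC | apply: DD].
Qed.

End Vanishing.
End Configuration.

(** * Existence of parameters *)

Section Examples.
Variables (K : numFieldType) (m : nat).
Local Notation V := ('rV[K]_m.+1).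
Local Notation L := ('rV[K]_2).

(** Indexed by a natural number, so that index arithmetic needs no ordinals; out of range it is
    zero. *)
Definition unit_row b (i : nat) : 'rV[K]_b := \row_k ((k : nat) == i)%:R.

Lemma unit_rowE b (i : 'I_b) : unit_row b i = 'e_i.
Proof. by apply/rowP => k; rewrite !mxE eqxx. Qed.

Lemma trilin1_unit0 b c (f : V -> 'rV[K]_b -> 'rV[K]_c -> K) y z : trilin f ->
  (forall i, (i <= m)%N -> f (unit_row _ i) y z = 0) -> forall x, f x y z = 0.
Proof.
by move=> ft f0; apply: (trilin1_eq0 ft) => i; rewrite -unit_rowE; apply: f0; rewrite -ltnS.
Qed.

Definition mk_param (x u s : nat -> nat -> K) : nat * nat * nat -> K :=
  fun q => if q.1.1 == 0 then x q.1.2 q.2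
           else if q.1.1 == 1 then u q.1.2 q.2 else s q.1.2 q.2.

Definition mk_scalar (om ps om' ps' : K) (a a' : nat -> K) (j k : nat) : K :=
  if j == 0 then if k == 0 then om else ps
  else if j == 1 then if k == 0 then om' else ps'
  else if k == 0 then a j else a' j.

Definition std_a (j : nat) : K := 1.
Definition std_a' (j : nat) : K := j%:R.

Lemma gx_mk z z' x u om ps om' ps' a a' j :
  gx z z' (mk_param x u (mk_scalar om ps om' ps' a a')) j =
  if j == 0 then \row_(k < m.+1) x 0 k
  else if j == 1 then om *: z + ps *: \row_k x 0 k
  else if j == 2 then if z' is Some w then om' *: w + ps' *: \row_k x 0 k
    else \row_k x 2 k
  else \row_k x j k.
Proof. by case: j => [|[|[|j]]]. Qed.

Lemma gl_mk x u om ps om' ps' j :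
  gl (mk_param x u (mk_scalar om ps om' ps' std_a std_a')) j =
  if j == 0 then 'e_0 else if j == 1 then 'e_1 else j%:R *: 'e_0 + 'e_1 :> L.
Proof.
by case: j => [|[|j]]; rewrite /gl /gA /gA' /= ?scale1r ?scale0r ?addr0 ?add0r.
Qed.

Definition std_l (j : nat) : L :=
  if j == 0 then 'e_0 else if j == 1 then 'e_1 else j%:R *: 'e_0 + 'e_1.

(** Any two of the vectors [std_l] span the plane. *)
Lemma rV2_vanish (g : L -> K) i j : (forall s l l', g (s *: l + l') = s * g l + g l') ->
  i != j -> g (std_l i) = 0 -> g (std_l j) = 0 -> forall l, g l = 0.
Proof.
move=> gl ij gi gj.
have g0 : g 0 = 0.
  by have := gl (-1) 0 0; rewrite scaler0 addr0 mulN1r addNr.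
have gE (l : L) : g l = l 0 0 * g 'e_0 + l 0 1 * g 'e_1.
  have -> : l = l 0 0 *: 'e_0 + (l 0 1 *: 'e_1 + 0).
    apply/rowP => k; rewrite !mxE addr0.
    by case: k => [[|[|k]] kP] //=; rewrite ?(mulr1, mulr0, addr0, add0r);
      congr (l 0 _); apply/val_inj.
  by rewrite !gl !mxE g0 !mulr1 !(mulr0, addr0, add0r).
have ge k : g (std_l k) = if k == 0 then g 'e_0 else if k == 1 then g 'e_1
    else k%:R * g 'e_0 + g 'e_1.
  by case: k => [|[|k]] //; rewrite /std_l /= gl.
suff [e0 e1] : g 'e_0 = 0 /\ g 'e_1 = 0.
  by move=> l; rewrite gE e0 e1 !mulr0 addr0.
move: gi gj; rewrite !ge.
case: i j ij => [|[|i]] [|[|j]] //= ij gi gj.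
- by split => //; move: gj; rewrite gi mulr0 add0r.
- by split => //; apply/eqP; move/eqP: gj; rewrite gi addr0 mulf_eq0 pnatr_eq0.
- by split => //; move: gi; rewrite gj mulr0 add0r.
- by split => //; apply/eqP; move/eqP: gi; rewrite gj addr0 mulf_eq0 pnatr_eq0.
- have e0 : g 'e_0 = 0.
    have D : i.+2%:R - j.+2%:R != 0 :> K by rewrite subr_eq0 eqr_nat.
    apply: (mulfI D); rewrite mulr0 -[RHS](subr0 0) -[X in _ = X - _]gi.
    by rewrite -[X in _ = _ - X]gj; ring.
  by split => //; move: gi; rewrite e0 mulr0 add0r.
Qed.

(** The scalars 1 and 0 put x_1 at z and x_2 at w. They violate [scalars_ok], but that condition has
    its own witness; the examples below use the same freedom. *)
Lemma basis_example (z : V) z' (s : 'S_m.+1) : (1 <= m)%N ->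
  z = 'e_(s (inord 1)) -> (if z' is Some w then w = 'e_(s (inord 2)) else True) ->
  exists c, basis_ok z z' c.
Proof.
move=> m1 zE z'E.
pose c := mk_param (fun j k => (k == s (inord j))%:R) (fun _ _ => 0)
  (mk_scalar 1 0 1 0 std_a std_a').
exists c.
have xE j : (j <= m)%N -> gx z z' c j = 'e_(s (inord j)).
  move=> jm; rewrite gx_mk; have rE (r : 'I_m.+1) :
      \row_(k < m.+1) (val k == r)%:R = 'e_r :> V by exact: unit_rowE.
  case: j jm => [|[|[|j]]] jm /=; rewrite ?rE //.
    by rewrite scale1r scale0r addr0.
  by case: z' z'E => [w' ->|_]; rewrite ?rE // scale1r scale0r addr0.
move=> w wj i; have := wj (s^-1 i)%g; rewrite xE; last by rewrite -ltnS ltn_ord.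
rewrite inord_val permKV.
rewrite (bigD1 i) //= mxE !eqxx mul1r big1 ?addr0 // => k ki.
by rewrite mxE (negPf ki) mul0r.
Qed.

Lemma half_doubleS k : (k.*2.+1)./2 = k.
Proof. by lia. Qed.

(** Each of the first (m+1)/2 basis vectors of V serves two points of the first group, and each of
    the others two points of the second group. *)
Lemma cross_example_odd (z1 z2 : V) : odd m ->
  exists c1 c2, cross_ok z1 z2 None None c1 c2.
Proof.
move=> mo; pose h := (m.+1)./2.
pose c1 := mk_param (fun j k => (k == j./2)%:R) (fun _ _ => 0)
  (mk_scalar 0 1 0 0 std_a std_a').
pose c2 := mk_param (fun j k => (k == h + j./2)%:R) (fun _ _ => 0)
  (mk_scalar 0 1 0 0 std_a std_a').
have x1E j : gx z1 None c1 j = unit_row _ (j./2).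
  by rewrite gx_mk; case: j => [|[|[|j]]] //=; rewrite scale0r add0r scale1r.
have x2E j : gx z2 None c2 j = unit_row _ (h + j./2).
  by rewrite gx_mk; case: j => [|[|[|j]]] //=; rewrite scale0r add0r scale1r.
exists c1, c2 => D Dt D1 D2 x l l'.
move: x; apply: (trilin1_unit0 Dt) => i im.
case: (ltnP i h) => ih.
- move: l; apply: (@rV2_vanish (fun l => D _ l l') i.*2 i.*2.+1).
  + by move=> s y y'; rewrite (trilinD2 Dt) (trilinZ2 Dt).
  + by rewrite neq_ltn ltnSn.
  + have := D1 i.*2 l'; rewrite x1E gl_mk doubleK; apply.
    by rewrite /h in ih; lia.
  + have := D1 i.*2.+1 l'; rewrite x1E gl_mk half_doubleS; apply.
    by rewrite /h in ih; lia.
- have iE : i = (h + (i - h))%N by lia.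
  move: l'; apply: (@rV2_vanish (fun l' => D _ l l') (i - h).*2 (i - h).*2.+1).
  + by move=> s y y'; rewrite (trilinD3 Dt) (trilinZ3 Dt).
  + by rewrite neq_ltn ltnSn.
  + have := D2 (i - h).*2 l; rewrite x2E gl_mk doubleK -iE; apply.
    by rewrite /h in ih *; lia.
  + have := D2 (i - h).*2.+1 l; rewrite x2E gl_mk half_doubleS -iE; apply.
    by rewrite /h in ih *; lia.
Qed.

(** Now m+1 is odd and three basis vectors are treated jointly: x_0, x_1, x_2 are e_0, e_1, e_2 in
    one group and e_0+e_1+e_2, -(e_0+e_2), -(e_0+e_1) in the other, which gives 12 equations for 12
    unknowns. The other m-2 basis vectors are shared out as for odd m. *)
Lemma cross_example_even (z' : option V) : ~~ odd m -> (2 <= m)%N ->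
  z' = None \/ z' = Some (unit_row _ 2) ->
  exists c1 c2, cross_ok (unit_row _ 1) (unit_row _ 1) z' z' c1 c2.
Proof.
move=> me m2 z'E; pose h := (m.-2)./2.
pose c1 := mk_param (fun j k => (k == if (j < 3)%N then j else (2 + (j.-1)./2))%:R)
  (fun _ _ => 0) (mk_scalar 1 0 1 0 std_a std_a').
pose c2 := mk_param (fun j k => if j == 0 then (k < 3)%:R
    else if j == 2 then (k == 2)%:R - (k < 3)%:R
    else (k == 2 + h + (j.-1)./2)%:R)
  (fun _ _ => 0) (mk_scalar 1 (-1) 1 (-1) std_a std_a').
have x1E j : gx (unit_row _ 1) z' c1 j =
    unit_row _ (if (j < 3)%N then j else (2 + (j.-1)./2)%N).
  rewrite gx_mk; case: j => [|[|[|j]]] //=; first by rewrite scale0r addr0 scale1r.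
  by case: z'E => -> //=; rewrite scale0r addr0 scale1r.
have e3 : \row_(k < m.+1) ((k : nat) < 3)%:R =
    unit_row _ 0 + unit_row _ 1 + unit_row _ 2 :> V.
  by apply/rowP => -[[|[|[|k]]] kP]; rewrite !mxE /= ?(addr0, add0r).
have x20 : gx (unit_row _ 1) z' c2 0 = unit_row _ 0 + unit_row _ 1 + unit_row _ 2.
  by rewrite gx_mk /= e3.
have x21 : gx (unit_row _ 1) z' c2 1 = - (unit_row _ 0 + unit_row _ 2).
  by rewrite gx_mk /= e3 scale1r scaleN1r; apply/rowP => k; rewrite !mxE; ring.
have x22 : gx (unit_row _ 1) z' c2 2 = - (unit_row _ 0 + unit_row _ 1).
  rewrite gx_mk /= e3; case: z'E => -> /=.
    apply/rowP => -[[|[|[|k]]] kP]; rewrite !mxE /=; ring.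
  by rewrite scale1r scaleN1r; apply/rowP => k; rewrite !mxE; ring.
have x2E j : (2 < j)%N -> gx (unit_row _ 1) z' c2 j = unit_row _ (2 + h + (j.-1)./2).
  by move=> j3; rewrite gx_mk; case: j j3 => [|[|[|j]]].
exists c1, c2 => D Dt D1 D2.
have d1 j l : (j <= m)%N ->
    D (unit_row _ (if (j < 3)%N then j else (2 + (j.-1)./2)%N)) (std_l j) l = 0.
  by move=> jm; have := D1 j l jm; rewrite x1E gl_mk.
have d3 j l i : (2 < j <= m)%N -> (2 + (j.-1)./2 = i)%N -> D (unit_row _ i) (std_l j) l = 0.
  move=> /andP[j3 jm] <-; have := d1 j l jm.
  by have -> : (j < 3)%N = false by lia.
have ddl x l' : forall s y y', D x (s *: y + y') l' = s * D x y l' + D x y' l'.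
  by move=> s y y'; rewrite (trilinD2 Dt) (trilinZ2 Dt).
have ddr x l : forall s y y', D x l (s *: y + y') = s * D x l y + D x l y'.
  by move=> s y y'; rewrite (trilinD3 Dt) (trilinZ3 Dt).
pose e i := unit_row m.+1 i; pose u0 := e 0%N; pose u1 := e 1%N; pose u2 := e 2.
have a0 l : D u0 (std_l 0) l = 0 := d1 0 l isT.
have a1 l : D u1 (std_l 1) l = 0 by apply: (d1 1%N); lia.
have a2 l : D u2 (std_l 2) l = 0 by apply: (d1 2).
have b0 l : D u0 l (std_l 0) + D u1 l (std_l 0) + D u2 l (std_l 0) = 0.
  by have := D2 0%N l isT; rewrite x20 gl_mk !(trilinD1 Dt).
have b1 l : D u0 l (std_l 1) + D u2 l (std_l 1) = 0.
  have := D2 1%N l (ltnW m2); rewrite x21 gl_mk -scaleN1r (trilinZ1 Dt) mulN1r.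
  by move/eqP; rewrite oppr_eq0 (trilinD1 Dt) => /eqP.
have b2 l : D u0 l (std_l 2) + D u1 l (std_l 2) = 0.
  have := D2 2 l m2; rewrite x22 gl_mk -scaleN1r (trilinZ1 Dt) mulN1r.
  by move/eqP; rewrite oppr_eq0 (trilinD1 Dt) => /eqP.
have c01 l : D u0 l (std_l 1) = 0.
  move: l; apply: (@rV2_vanish (fun l => D u0 l _) 0 2) => //.
  by have := b1 (std_l 2); rewrite a2 addr0.
have c21 l : D u2 l (std_l 1) = 0 by have := b1 l; rewrite c01 add0r.
have c02 l : D u0 l (std_l 2) = 0.
  move: l; apply: (@rV2_vanish (fun l => D u0 l _) 0 1) => //.
  by have := b2 (std_l 1); rewrite a1 addr0.
have c12 l : D u1 l (std_l 2) = 0 by have := b2 l; rewrite c02 add0r.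
have D0 l l' : D u0 l l' = 0.
  by move: l'; apply: (@rV2_vanish (fun l' => D u0 l l') 1 2).
have c10 l : D u1 l (std_l 0) = 0.
  move: l; apply: (@rV2_vanish (fun l => D u1 l _) 1 2) => //.
  by have := b0 (std_l 2); rewrite D0 a2 addr0 add0r.
have c20 l : D u2 l (std_l 0) = 0.
  by have := b0 l; rewrite D0 c10 !add0r.
have DD1 l l' : D u1 l l' = 0.
  by move: l'; apply: (@rV2_vanish (fun l' => D u1 l l') 0 2).
have DD2 l l' : D u2 l l' = 0.
  by move: l'; apply: (@rV2_vanish (fun l' => D u2 l l') 0 1).
move=> x l l'; move: x; apply: (trilin1_unit0 Dt) => i im.
case: i im => [|[|[|i]]] im; rewrite ?D0 ?DD1 ?DD2 //.
case: (ltnP i h) => ih.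
- move: l; apply: (@rV2_vanish (fun l => D _ l l') i.*2.+3 i.*2.+4) => //.
  + by rewrite neq_ltn ltnSn.
  + by apply: d3; rewrite /h in ih; lia.
  + by apply: d3; rewrite /h in ih; lia.
- move: l'; apply: (@rV2_vanish (fun l' => D _ l l') (i - h).*2.+3 (i - h).*2.+4) => //.
  + by rewrite neq_ltn ltnSn.
  + have := D2 (i - h).*2.+3 l; rewrite x2E // gl_mk.
    have -> : (2 + h + ((i - h).*2.+3).-1./2 = i.+3)%N by lia.
    by apply; rewrite /h in ih *; lia.
  + have := D2 (i - h).*2.+4 l; rewrite x2E // gl_mk.
    have -> : (2 + h + ((i - h).*2.+4).-1./2 = i.+3)%N by lia.
    by apply; rewrite /h in ih *; lia.
Qed.

End Examples.

Section ExtensionExamples.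
Variables (K : numFieldType) (m d : nat).
Local Notation V := ('rV[K]_m.+1).
Local Notation U := ('rV[K]_d).
Local Notation L := ('rV[K]_2).

Lemma trilin2_unit0 a c (f : 'rV[K]_a -> U -> 'rV[K]_c -> K) x z : trilin f ->
  (forall i, (i < d)%N -> f x (unit_row _ _ i) z = 0) -> forall y, f x y z = 0.
Proof.
by move=> ft f0; apply: (trilin2_eq0 ft) => i; rewrite -unit_rowE; apply: f0.
Qed.

Lemma trilin_gu_zeta (zeta : U) c (g : V -> U -> L -> K) : trilin g -> (2 <= m)%N ->
  (forall x j l, (1 < j <= m)%N -> g x (gu m zeta c j) l = 0) ->
  forall x l, g x zeta l = 0.
Proof.
move=> gt m2 gu0 x l; rewrite -(sum_gu zeta c m2) (trilin_sum2 gt).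
by rewrite big_nat big1 // => j jm; apply: gu0.
Qed.

(** Here the m-1 vectors u_j form a basis of U, so no outside condition is required. *)
Lemma extension_example_full (z : V) z' : m = d.+1 -> (2 <= m)%N ->
  exists c, extension_ok z z' (unit_row K d 0) [::] c.
Proof.
move=> md m2; exists (mk_param (fun _ _ => 0) (fun j k => (k == j.-2)%:R)
  (mk_scalar 0 0 0 0 (std_a K) (std_a' K))).
move=> g gt gu0 _ _ x v l; have gz := trilin_gu_zeta gt m2 gu0.
move: v; apply: (trilin2_unit0 gt) => -[//|k] kd.
have := gu0 x k.+3 l; rewrite /gu /mk_param /=; apply.
by rewrite md.
Qed.

(* The vectors u_j span the hyperplane modulo which all basis vectors of U agree, up to
   the vector number [pn 1], which vanishes if eps = 0; pn is a permutation. *)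
Lemma hyperplane_vanish (pn : nat -> nat) (eps : bool) x s (g : V -> U -> L -> K) :
  d = m -> (2 <= m)%N -> (forall k, (k < m)%N -> exists2 j, (j < m)%N & pn j = k) ->
  trilin g ->
  let c := mk_param x (fun j k => (k == pn j.-1)%:R - (k == pn 0)%:R) s in
  let zeta := unit_row K d (pn 1) - eps%:R *: unit_row K d (pn 0) in
  (forall x j l, (1 < j <= m)%N -> g x (gu m zeta c j) l = 0) ->
  (forall x l, eps = false -> g x (unit_row K d (pn 1)) l = 0) /\
  forall k x l, (k < m)%N -> (k != pn 1) || eps ->
    g x (unit_row K d k) l = g x (unit_row K d (pn 0)) l.
Proof.
move=> dm m2 pnS gt c zeta gu0.
have gz x0 l : g x0 (unit_row K d (pn 1)) l = eps%:R * g x0 (unit_row K d (pn 0)) l.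
  apply/eqP; rewrite -subr_eq0 -(trilinZ2 gt) -(trilinB2 gt).
  by rewrite (trilin_gu_zeta gt m2 gu0).
split=> [x0 l e0 | k x0 l km ke]; first by rewrite gz e0 mul0r.
have [j jm jk] := pnS k km; rewrite -jk.
case: j jm jk => [//|[|j]] jm jk.
  rewrite gz; move: ke; rewrite -jk eqxx /= => ->.
  by rewrite mul1r.
apply/eqP; rewrite -subr_eq0 -(trilinB2 gt).
rewrite (_ : _ - _ = gu m zeta c j.+3); first by apply/eqP/gu0.
by rewrite /gu /c /mk_param /=; apply/rowP => i; rewrite !mxE.
Qed.

Definition swap1 (p j : nat) : nat := if j == 1 then p else if j == p then 1 else j.

Lemma swap1_surj p k : (p < m)%N -> (2 <= m)%N -> (k < m)%N ->
  exists2 j, (j < m)%N & swap1 p j = k.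
Proof.
move=> pm m2 km; exists (swap1 p k); rewrite /swap1; do ?case: eqP => //; lia.
Qed.

(** Modulo the hyperplane of the u_j, g is a bilinear form on V x L, and each e_q needs two vectors
    of L. They come from [S] for q <= h other than p, from the points 0 and 1 for q = p, and from
    the points 2(q-h) and 2(q-h)+1 for q > h. *)
Lemma extension_example_odd h p z' (z : V) (S : seq (V * U * L)) :
  d = m -> (m.+1 = h.*2)%N -> (2 <= h)%N -> (p <= h)%N -> z' = None ->
  (forall q, (q <= h)%N -> q != p ->
    (unit_row K m.+1 q, unit_row K d q, 'e_0) \in S /\
    (unit_row K m.+1 q, unit_row K d q, 'e_1) \in S) ->
  exists c, extension_ok z z' (unit_row K d p) S c.
Proof.
move=> dm mh h2 ph -> SP; have m2 : (2 <= m)%N by lia.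
pose pn := swap1 p; have pn1 : pn 1 = p by [].
have pm : (p < m)%N by lia.
pose c := mk_param (fun j k => (k == if (j < 2)%N then p else (h + j./2)%N)%:R : K)
  (fun j k => (k == pn j.-1)%:R - (k == pn 0)%:R)
  (mk_scalar 0 1 0 0 (std_a K) (std_a' K)).
exists c => g gt gu0 gx0 gS.
have zE : unit_row K d p = unit_row K d (pn 1) - false%:R *: unit_row K d (pn 0).
  by rewrite pn1 scale0r subr0.
rewrite zE in gu0.
have [gp ge] := hyperplane_vanish dm m2 (fun k => swap1_surj pm m2) gt gu0.
have xE j : gx z None c j = unit_row _ _ (if (j < 2)%N then p else (h + j./2)%N).
  by rewrite gx_mk; case: j => [|[|[|j]]] //=; rewrite scale0r add0r scale1r.
have gl0 x v : forall s l l', g x v (s *: l + l') = s * g x v l + g x v l'.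
  by move=> s l l'; rewrite (trilinD3 gt) (trilinZ3 gt).
have gj j v : (j <= m)%N ->
    g (unit_row _ _ (if (j < 2)%N then p else (h + j./2)%N)) v (std_l K j) = 0.
  by move=> jm; have := gx0 j v jm; rewrite xE gl_mk.
have g0 x l : g x (unit_row K d (pn 0)) l = 0.
  move: x; apply: (trilin1_unit0 gt) => q qm.
  have [qh | qh] := leqP q h.
    have [-> | qp] := eqVneq q p.
      move: l; apply: (@rV2_vanish _ (fun l => g _ _ l) 0 1) => //.
        exact: (gj 0%N).
      by apply: (gj 1%N); lia.
    have [S0 S1] := SP q qh qp.
    have gq l' : g (unit_row K m.+1 q) (unit_row K d (pn 0)) l' =
        g (unit_row K m.+1 q) (unit_row K d q) l'.
      by rewrite -(ge q) // ?qp //; lia.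
    move: l; apply: (@rV2_vanish _ (fun l => g _ _ l) 0 1) => //; rewrite gq.
      exact: (gS _ S0).
    exact: (gS _ S1).
  move: l; apply: (@rV2_vanish _ (fun l => g _ _ l) (q - h).*2 (q - h).*2.+1) => //.
  - by rewrite neq_ltn ltnSn.
  - have := gj (q - h).*2 (unit_row K d (pn 0)).
    have -> : ((q - h).*2 < 2)%N = false by lia.
    have -> : (h + (q - h).*2./2 = q)%N by lia.
    by apply; lia.
  - have := gj (q - h).*2.+1 (unit_row K d (pn 0)).
    have -> : ((q - h).*2.+1 < 2)%N = false by lia.
    have -> : (h + (q - h).*2.+1./2 = q)%N by lia.
    by apply; lia.
move=> x v l; move: v; apply: (trilin2_unit0 gt) => k kd.
have [-> | kp] := eqVneq k p; first exact: gp.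
by rewrite ge ?g0 ?kp -?dm.
Qed.

Definition rot3 (j : nat) : nat :=
  if j == 0 then 1 else if j == 1 then 2 else if j == 2 then 0 else j.

Lemma rot3_surj k : (3 <= m)%N -> (k < m)%N -> exists2 j, (j < m)%N & rot3 j = k.
Proof.
move=> m3 km; exists (if k == 0 then 2 else if k == 1 then 0 else
  if k == 2 then 1 else k)%N; case: k km => [|[|[|k]]] //=; lia.
Qed.

(** As for odd m, except that for q = 2 only one vector of L comes from [S]. The other belongs to
    point 2, since x_2 is put at e_2. The points 0 and 1 serve q = h+1. *)
Lemma extension_example_even h (z : V) (S : seq (V * U * L)) :
  d = m -> (m = h.*2)%N -> (2 <= h)%N ->
  (forall q, (q <= h)%N -> (unit_row K m.+1 q, unit_row K d q, 'e_0) \in S) ->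
  (forall q, (q <= h)%N -> q != 2 -> (unit_row K m.+1 q, unit_row K d q, 'e_1) \in S) ->
  exists c, extension_ok z (Some (unit_row K m.+1 2)) (unit_row K d 2 - unit_row K d 1) S c.
Proof.
move=> dm mh h2 SP0 SP1; have m2 : (2 <= m)%N by lia.
have m3 : (3 <= m)%N by lia.
pose X j := if (j < 2)%N then h.+1 else if j == 2 then 2 else (h.+1 + (j.-1)./2)%N.
pose c := mk_param (fun j k => (k == X j)%:R : K)
  (fun j k => (k == rot3 j.-1)%:R - (k == rot3 0)%:R)
  (mk_scalar 0 1 1 0 (std_a K) (std_a' K)).
exists c => g gt gu0 gx0 gS.
have zE : unit_row K d 2 - unit_row K d 1 =
    unit_row K d (rot3 1) - true%:R *: unit_row K d (rot3 0).
  by rewrite scale1r.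
rewrite zE in gu0.
have [_ ge] := hyperplane_vanish dm m2 (fun k => rot3_surj m3) gt gu0.
have xE j : gx z (Some (unit_row K m.+1 2)) c j = unit_row _ _ (X j).
  by rewrite gx_mk; case: j => [|[|[|j]]] //=;
    rewrite scale0r ?(add0r, addr0) scale1r.
have gl0 x v : forall s l l', g x v (s *: l + l') = s * g x v l + g x v l'.
  by move=> s l l'; rewrite (trilinD3 gt) (trilinZ3 gt).
have gj j v : (j <= m)%N -> g (unit_row _ _ (X j)) v (std_l K j) = 0.
  by move=> jm; have := gx0 j v jm; rewrite xE gl_mk.
have gj' j q v : (j <= m)%N -> X j = q -> g (unit_row _ _ q) v (std_l K j) = 0.
  by move=> jm <-; apply: gj.
have g0 x l : g x (unit_row K d (rot3 0)) l = 0.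
  move: x; apply: (trilin1_unit0 gt) => q qm.
  have [qh | qh] := leqP q h.
    have gq l' : g (unit_row K m.+1 q) (unit_row K d (rot3 0)) l' =
        g (unit_row K m.+1 q) (unit_row K d q) l'.
      by rewrite -(ge q) ?orbT //; lia.
    have g1 : g (unit_row K m.+1 q) (unit_row K d (rot3 0)) (std_l K 0) = 0.
      by rewrite gq; apply: (gS _ (SP0 q qh)).
    have [q2 | q2] := eqVneq q 2.
      rewrite q2 in g1 *.
      by move: l; apply: (@rV2_vanish _ (fun l => g _ _ l) 0 2) => //; apply: gj'.
    move: l; apply: (@rV2_vanish _ (fun l => g _ _ l) 0 1) => //.
    by rewrite gq; apply: (gS _ (SP1 q qh q2)).
  have [-> | qh1] := eqVneq q h.+1.
    move: l; apply: (@rV2_vanish _ (fun l => g _ _ l) 0 1) => //; apply: gj' => //.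
    lia.
  move: l; apply: (@rV2_vanish _ (fun l => g _ _ l) (q - h.+1).*2.+1 (q - h.+1).*2.+2) => //.
  - by rewrite neq_ltn ltnSn.
  - by apply: gj'; rewrite /X; do ?case: ifP; lia.
  - by apply: gj'; rewrite /X; do ?case: ifP; lia.
by move=> x v l; move: v; apply: (trilin2_unit0 gt) => k kd; rewrite ge ?orbT -?dm.
Qed.

End ExtensionExamples.

(** * Restriction to the base space *)

Section Core.
Variables (K : numFieldType) (m d : nat).
Local Notation V := ('rV[K]_m.+1).
Local Notation U := ('rV[K]_d).
Local Notation form := (V -> U -> U -> K).

Definition core_form (ins : seq (V * U)) (f : form) :=
  [/\ trilin f, forall x v w, f x v w = f x w v &
      forall p, p \in ins -> (forall x, f x p.2 p.2 = 0) /\ (forall v, f p.1 p.2 v = 0)].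

(** Symmetry and singularity at [ins] are linear equations with constant coefficients and can be
    added to the system of [gen_tri]. *)
Lemma gen_core (I : Type) (J : finType) ins (Psi : J -> (I -> K) -> form -> K) :
  (forall j, polyeq (Psi j)) ->
  (exists a, forall f, core_form ins f -> (forall j, Psi j a f = 0) ->
     forall x v w, f x v w = 0) ->
  gen (fun a => forall f, core_form ins f -> (forall j, Psi j a f = 0) ->
     forall x v w, f x v w = 0).
Proof.
move=> PsiP [a0 ok0].
pose E (q : ('I_m.+1 * 'I_d * 'I_d + 'I_(size ins) * 'I_m.+1 +
    'I_(size ins) * 'I_d + J)%type) (a : I -> K) (f : form) := match q with
  | inl (inl (inl (i, j, k))) => f 'e_i 'e_j 'e_k + -1 * f 'e_i 'e_k 'e_j
  | inl (inl (inr (p, i))) => f 'e_i (nth (0, 0) ins p).2 (nth (0, 0) ins p).2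
  | inl (inr (p, i)) => f (nth (0, 0) ins p).1 (nth (0, 0) ins p).2 'e_i
  | inr j => Psi j a f
  end.
have cst k (v : 'rV[K]_k) i : polyfun (fun a : I -> K => v 0 i).
  exact: polyfun_const.
have cstE (x : V) (v w : U) : polyeq (fun (a : I -> K) (f : form) => f x v w).
  by apply: (polyeq_eval (X := fun=> x) (Y := fun=> v) (Z := fun=> w)).
have EP q : polyeq (E q).
  case: q => [[[[[i j] k]|[p i]]|[p i]]|j] //=; try exact: cstE; try exact: PsiP.
  have := @polyeq_sum K I m.+1 d d bool [:: true; false]
    (fun b _ => if b then 1 else -1)
    (fun b _ f => if b then f 'e_i 'e_j 'e_k else f 'e_i 'e_k 'e_j).
  case; [by case; apply: polyfun_const | by case |] => M [MP ME].
  exists M; split => // t f ft; rewrite -ME //.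
  by rewrite !big_cons big_nil mul1r addr0.
have anti f : trilin f ->
    exists2 h, trilin h & forall x v w, h x v w = f x v w - f x w v.
  move=> ft; exists (fun x v w => f x v w - f x w v) => //.
  split=> *; rewrite ?(trilinD1 ft, trilinD2 ft, trilinD3 ft)
    ?(trilinZ1 ft, trilinZ2 ft, trilinZ3 ft); ring.
have EI f : trilin f -> forall a, (forall q, E q a f = 0) <->
    core_form ins f /\ forall j, Psi j a f = 0.
  move=> ft a; split=> [Ef | [[_ fs fi] fP]].
    split; last by move=> j; have := Ef (inr j).
    split => //.
      have [h ht hE] := anti _ _ _ f ft => x v w; apply/eqP; rewrite -subr_eq0 -hE.
      apply/eqP; move: x; apply: (trilin1_eq0 ht) => i.
      move: v; apply: (trilin2_eq0 ht) => j; move: w; apply: (trilin3_eq0 ht) => k.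
      rewrite hE.
      by have := Ef (inl (inl (inl (i, j, k)))); rewrite /= mulN1r.
    move=> p pi; have ip : (index p ins < size ins)%N by rewrite index_mem.
    split.
      apply: (trilin1_eq0 ft) => i.
      by have := Ef (inl (inl (inr (Ordinal ip, i)))); rewrite /= nth_index.
    apply: (trilin3_eq0 ft) => i.
    by have := Ef (inl (inr (Ordinal ip, i))); rewrite /= nth_index.
  case=> [[[[[i j] k]|[p i]]|[p i]]|j] //=.
  - by rewrite fs mulN1r subrr.
  - by apply: (proj1 (fi _ (mem_nth _ (ltn_ord p)))).
  - by apply: (proj2 (fi _ (mem_nth _ (ltn_ord p)))).
apply: gen_imp (gen_tri EP _) => [a ok f fc fP|].
  have ft : trilin f by case: fc.
  by apply: ok => //; apply/(EI f ft a).
by exists a0 => f ft /(EI f ft a0)[]; apply: ok0.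
Qed.

Lemma core_diag ins f : core_form ins f ->
  (forall x j, (j < d)%N -> f x (unit_row K d j) (unit_row K d j) = 0) ->
  (forall x j k, (j < k < d)%N -> f x (unit_row K d j) (unit_row K d k) = 0) ->
  forall x v w, f x v w = 0.
Proof.
move=> [ft fs _] fd fo x v w.
move: v; apply: (trilin2_unit0 ft) => j jd; move: w; apply: (trilin3_eq0 ft) => k.
rewrite -unit_rowE; case: (ltngtP j k) => jk.
- by apply: fo; rewrite jk ltn_ord.
- by rewrite fs; apply: fo; rewrite jk.
- by rewrite -jk; apply: fd.
Qed.

End Core.

Lemma polyeq_reindex (K : numFieldType) (I J : Type) (h : J -> I) a b c
    (E : (J -> K) -> ('rV[K]_a -> 'rV[K]_b -> 'rV[K]_c -> K) -> K) :
  polyeq E -> polyeq (fun (t : I -> K) f => E (fun j => t (h j)) f).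
Proof.
case=> M [MP ME]; exists (fun t => M (fun j => t (h j))); split.
  by move=> p; apply: (polyfun_reindex h (MP p)).
by move=> t f ft; apply: ME.
Qed.

(** * Conditions of the groups on V x U x U *)

Section GroupConditions.
Variables (K : numFieldType) (m d : nat).
Local Notation V := ('rV[K]_m.+1).
Local Notation U := ('rV[K]_d).
Local Notation form := (V -> U -> U -> K).
Local Notation param := (nat * nat * nat -> K).
Variables (z : V) (z' : option V) (zeta w : U).

(** The two conditions of [group_extra]; the boolean, read as a number, is the index of the x
    involved. *)
Definition group_psi (b : bool) (c : param) (f : form) : K :=
  \sum_(2 <= j < m.+1) (if b then gA c j else gA' c j) *
    f (gx z z' c b) (gu m zeta c j) (gu m zeta c j).

Definition group_psi_half (c : param) (f : form) : K :=
  group_psi false c f + -2 * (gA' c 2 * f (gx z z' c 0) (gu m zeta c 2) w).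

Lemma group_psi_poly b : polyeq (group_psi b).
Proof.
apply: polyeq_sum => j.
  by case: b; [apply: gA_poly | apply: gA'_poly].
by apply: polyeq_eval => k; [apply: gx_poly | apply: gu_poly | apply: gu_poly].
Qed.

Lemma group_psi_half_poly : polyeq group_psi_half.
Proof.
apply: polyeq_add; first exact: group_psi_poly.
have := @polyeq_sum K (nat * nat * nat) m.+1 d d unit [:: tt]
  (fun _ (c : param) => -2 * gA' c 2)
  (fun _ c f => f (gx z z' c 0) (gu m zeta c 2) w).
case.
- by move=> _; apply: polyfun_mul; [apply: polyfun_const | apply: gA'_poly].
- move=> _; apply: (polyeq_eval (Z := fun=> w)) => k; first exact: gx_poly.
    exact: gu_poly.
  exact: polyfun_const.
move=> M [MP ME]; exists M; split => // t f ft.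
by rewrite -ME // big_cons big_nil addr0 mulrA.
Qed.

Definition delta_at (i j : nat) : K := (j == i)%:R.

Lemma delta_sum (F : nat -> K) i : (1 < i <= m)%N ->
  \sum_(2 <= j < m.+1) delta_at i j * F j = F i.
Proof.
move=> im; rewrite (bigD1_seq i) ?iota_uniq ?mem_index_iota //=.
rewrite /delta_at eqxx mul1r big1 ?addr0 // => j /negPf->.
by rewrite mul0r.
Qed.

(* The limit parameters at which the two conditions of a group concern a single
   vector u_j each; for m = 3 the vector u_2 is determined by u_3. *)
Lemma slot_param om ps (P : V) (v v' : U) :
  (3 <= m)%N -> [\/ (4 <= m)%N, v' = v | v' = zeta - v] ->
  exists c : param, [/\ forall f, group_psi true c f = f (gx z z' c 1) v v,
    gx z z' c 1 = om *: z + ps *: P,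
    forall f, group_psi false c f = f P v' v' &
    v' = v -> forall f, group_psi_half c f = f P v v].
Proof.
move=> m3 vv'.
(* [A] and [A'] become the indicators of 3 and [j2], with u_3 = v and u_4 = x4. For m = 3 there is
   no u_4, and j2 = 2 selects u_2 = zeta - v. *)
pose c (x4 : U) (j2 : nat) : param := mk_param
  (fun _ k => if insub k is Some i then P 0 i else 0)
  (fun j k => if insub k is Some i then
     if j == 3 then v 0 i else if j == 4 then x4 0 i else 0 else 0)
  (mk_scalar om ps 0 0 (delta_at 3) (delta_at j2)).
have rowE b (y : 'rV[K]_b) :
    \row_(k < b) (if insub (val k) is Some i then y 0 i else 0) = y.
  by apply/rowP => k; rewrite mxE insubT //= => kb; congr (y 0 _); apply/val_inj.
have x0 x4 j2 : gx z z' (c x4 j2) 0 = P by rewrite gx_mk rowE.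
have x1 x4 j2 : gx z z' (c x4 j2) 1 = om *: z + ps *: P by rewrite gx_mk rowE.
have u3 x4 j2 : gu m zeta (c x4 j2) 3 = v by rewrite /gu /c /mk_param /= rowE.
have p1 x4 j2 f : group_psi true (c x4 j2) f = f (gx z z' (c x4 j2) 1) v v.
  rewrite -(u3 x4 j2) -(@delta_sum (fun j => f _ (gu m zeta (c x4 j2) j)
    (gu m zeta (c x4 j2) j)) 3) //.
  by apply: eq_big_nat => j /andP[j2' _]; rewrite gAE //; case: j j2' => [|[|]].
have p0 x4 j2 f : (1 < j2 <= m)%N ->
    group_psi false (c x4 j2) f = f P (gu m zeta (c x4 j2) j2) (gu m zeta (c x4 j2) j2).
  move=> jm; rewrite -(x0 x4 j2) -(@delta_sum (fun j => f _ (gu m zeta (c x4 j2) j)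
    (gu m zeta (c x4 j2) j)) j2) //.
  by apply: eq_big_nat => j /andP[j2' _]; rewrite gA'E //; case: j j2' => [|[|]].
have [E | /eqP v'v] := eqVneq v' v.
  exists (c 0 3); split=> [f||f|_ f] //; first by rewrite p0 // u3 E.
  rewrite /group_psi_half p0 // u3 gA'E // /c /mk_param /= /delta_at /=.
  by rewrite mul0r mulr0 addr0.
case: vv' => [m4 | // | E].
  exists (c v' 4); split=> [f||f|/v'v//] //; rewrite p0 ?m4 // /gu /c /mk_param /=.
  by rewrite rowE.
have [m3E | m3E] := eqVneq m 3.
  exists (c 0 2); split=> [f||f|/v'v//] //; rewrite p0 ?(ltnW m3) //.
  suff -> : gu m zeta (c 0 2) 2 = v' by [].
  rewrite /gu m3E big_nat1 /= E; congr (_ - _).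
  exact: (rowE _ v).
exists (c v' 4); split=> [f||f|/v'v//] //; rewrite p0; last by rewrite /=; lia.
by rewrite /gu /c /mk_param /= rowE.
Qed.

End GroupConditions.

Section Slots.
Variables (K : numFieldType) (m d t : nat).
Local Notation V := ('rV[K]_m.+1).
Local Notation U := ('rV[K]_d).
Local Notation params := ('I_t * (nat * nat * nat) -> K).
Variables (ins : seq (V * U)) (z' : 'I_t -> option V) (zeta : 'I_t -> U).

Definition core_pairs (z : 'I_t -> V) (a : params) := forall f, core_form ins f ->
  (forall i b, group_psi (z i) (z' i) (zeta i) b (group_param a i) f = 0) ->
  forall x v w, f x v w = 0.

Definition core_singles (z : 'I_t -> V) (w : U) (a : params) := forall f, core_form ins f ->
  (forall i, group_psi_half (z i) (z' i) (zeta i) w (group_param a i) f = 0) ->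
  forall x v w, f x v w = 0.

Lemma gen_core_pairs z : (exists a, core_pairs z a) -> gen (core_pairs z).
Proof.
pose Psi (q : 'I_t * bool) (a : params) f :=
  group_psi (z q.1) (z' q.1) (zeta q.1) q.2 (group_param a q.1) f.
have PsiP q : polyeq (Psi q).
  exact: (polyeq_reindex (pair q.1) (group_psi_poly _ _ _ q.2)).
case=> a0 ok; apply: gen_imp (gen_core (ins := ins) PsiP _).
  by move=> a aok f fc fP; apply: aok => // -[i b]; apply: fP.
exists a0 => f fc fP; apply: ok => // i b; exact: (fP (i, b)).
Qed.

Lemma gen_core_singles z w : (exists a, core_singles z w a) -> gen (core_singles z w).
Proof.
pose Psi (i : 'I_t) (a : params) f :=
  group_psi_half (z i) (z' i) (zeta i) w (group_param a i) f.
have PsiP q : polyeq (Psi q).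
  exact: (polyeq_reindex (pair q) (group_psi_half_poly _ _ _ _)).
exact: (gen_core (ins := ins) PsiP).
Qed.

(* The pair ((i, v), (i', v')) stands for the conditions f e_i v v = 0 and
   f e_i' v' v' = 0 imposed by one group. *)
Definition slot := ((nat * U) * (nat * U))%type.

(** As x_1 lies in the span of z and x_0, its index is that of z or that of x_0. The second clause
    lists the pairs of vectors that [slot_param] can reach. *)
Definition slot_ok (zi : nat) (zt : U) (s : slot) :=
  (s.1.1 = zi \/ s.1.1 = s.2.1) /\ [\/ (4 <= m)%N, s.2.2 = s.1.2 | s.2.2 = zt - s.1.2].

Lemma core_pairs_slots (zi : 'I_t -> nat) (s : 'I_t -> slot) : (3 <= m)%N ->
  (forall i, slot_ok (zi i) (zeta i) (s i)) ->
  (forall f, core_form ins f ->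
    (forall i, f (unit_row K _ (s i).1.1) (s i).1.2 (s i).1.2 = 0 /\
      f (unit_row K _ (s i).2.1) (s i).2.2 (s i).2.2 = 0) ->
    forall x v w, f x v w = 0) ->
  exists a, core_pairs (fun i => unit_row K _ (zi i)) a.
Proof.
move=> m3 sok kill.
have cP i := @slot_param K m d (unit_row K m.+1 (zi i)) (z' i) (zeta i) 0
  ((s i).1.1 == zi i)%:R ((s i).1.1 != zi i)%:R
  (unit_row K m.+1 (s i).2.1) (s i).1.2 (s i).2.2 m3 (proj2 (sok i)).
have [c {}cP] := choice cP.
exists (fun q => c q.1 q.2) => f fc fP; apply: kill => // i.
have [c1 x1 c0 _] := cP i; have := fP i true; have := fP i false.
rewrite /group_param /= c0 => -> ; rewrite c1 x1; case: eqP => [E|ne].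
  by rewrite -E scale1r scale0r addr0.
rewrite scale0r scale1r add0r; case: (proj1 (sok i)) => [//|->].
by [].
Qed.

Lemma core_singles_slots (zi : 'I_t -> V) w (s : 'I_t -> nat * U) : (3 <= m)%N ->
  (forall f, core_form ins f ->
    (forall i, f (unit_row K _ (s i).1) (s i).2 (s i).2 = 0) ->
    forall x v w, f x v w = 0) ->
  exists a, core_singles zi w a.
Proof.
move=> m3 kill.
have cP i := @slot_param K m d (zi i) (z' i) (zeta i) w 0 0
  (unit_row K m.+1 (s i).1) (s i).2 (s i).2 m3 (Or32 _ _ erefl).
have [c {}cP] := choice cP.
exists (fun q => c q.1 q.2) => f fc fP; apply: kill => // i.
have [_ _ _ c0] := cP i.
by have := fP i; rewrite /group_param /= c0.
Qed.

End Slots.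

Definition strict_pairs (M : nat) : seq (nat * nat) :=
  [seq (j, k) | k <- iota 0 M, j <- iota 0 k].

Lemma size_strict_pairs M : size (strict_pairs M) = 'C(M, 2).
Proof.
rewrite size_allpairs_dep -bin2_sum sumnE big_map /index_iota subn0.
by apply: eq_bigr => k _; rewrite size_iota.
Qed.

Lemma mem_strict_pairs M j k : ((j, k) \in strict_pairs M) = (j < k < M)%N.
Proof.
apply/allpairsPdep/andP => [[k' [j' [+ + [-> ->]]]]|[jk kM]].
  by rewrite !mem_iota /= !add0n.
by exists k, j; rewrite !mem_iota !add0n.
Qed.

Section Cores.
Variables (K : numFieldType) (m d : nat).
Local Notation V := ('rV[K]_m.+1).
Local Notation U := ('rV[K]_d).
Local Notation form := (V -> U -> U -> K).
Local Notation eV i := (unit_row K m.+1 i).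
Local Notation eU j := (unit_row K d j).

Definition kills (L : seq (nat * U)) (f : form) :=
  forall e, e \in L -> f (eV e.1) e.2 e.2 = 0.

Lemma kills_cat L L' f : kills (L ++ L') f <-> kills L f /\ kills L' f.
Proof.
split=> [k|[k k'] e]; last by rewrite mem_cat => /orP[/k|/k'].
by split=> e eL; apply: k; rewrite mem_cat eL ?orbT.
Qed.

(** Groups impose conditions on squares f(e_i, v, v) only, so an off-diagonal coefficient is reached
    by polarization. *)
Definition cells (diag : seq nat) (off : seq (nat * nat)) : seq U :=
  [seq eU j | j <- diag] ++ [seq eU p.1 + eU p.2 | p <- off].

Definition block (i : nat) (vs : seq U) : seq (nat * U) := [seq (i, v) | v <- vs].

Lemma size_cells diag off : size (cells diag off) = (size diag + size off)%N.
Proof. by rewrite size_cat !size_map. Qed.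

Lemma polarization (f : form) x v w : trilin f -> (forall x v w, f x v w = f x w v) ->
  f x v v = 0 -> f x w w = 0 -> f x (v + w) (v + w) = 0 -> f x v w = 0.
Proof.
move=> ft fs fv fw; rewrite (trilinD2 ft) !(trilinD3 ft) fv fw (fs x w v) add0r addr0.
move=> E; have two0 : (2 : K) != 0 by rewrite pnatr_eq0.
by apply: (mulfI two0); rewrite mulr0 -[RHS]E; ring.
Qed.

Lemma kills_block i diag off (f : form) : trilin f ->
  (forall x v w, f x v w = f x w v) -> kills (block i (cells diag off)) f ->
  (forall j, j \in diag -> f (eV i) (eU j) (eU j) = 0) /\
  (forall j k, (j, k) \in off -> f (eV i) (eU j) (eU j) = 0 ->
    f (eV i) (eU k) (eU k) = 0 -> f (eV i) (eU j) (eU k) = 0).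
Proof.
move=> ft fs kl; split=> [j jd | j k jk fj fk].
  apply: (kl (i, _)); apply: map_f; rewrite mem_cat; apply/orP; left.
  exact: map_f.
apply: polarization => //; apply: (kl (i, _)); apply: map_f.
by rewrite mem_cat; apply/orP; right; apply: (map_f (fun p => eU p.1 + eU p.2) jk).
Qed.

Lemma mem_flatten_block (F : nat -> seq U) s i e :
  i \in s -> e \in block i (F i) -> e \in flatten [seq block i (F i) | i <- s].
Proof.
move=> si eF; apply/flattenP; exists (block i (F i)) => //.
exact: (map_f (fun i => block i (F i)) si).
Qed.

Section Diagonal.
Variable h : nat.

Definition diag_ins : seq (V * U) := [seq (eV q, eU q) | q <- iota 0 h.+1].

(** For i <= h the further points already annihilate the diagonal cells up to h and every cell
    involving i. The remaining pairs avoid i and are enumerated through [bump i]. *)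
Definition diag_list1 : seq (nat * U) :=
  flatten [seq block i (cells (iota h.+1 (d - h.+1))
    [seq (bump i p.1, bump i p.2) | p <- strict_pairs d.-1]) | i <- iota 0 h.+1].

Definition diag_list2 : seq (nat * U) :=
  flatten [seq block i (cells (iota h.+1 (d - h.+1)) (strict_pairs d))
    | i <- iota h.+1 (m - h)].

Lemma size_flatten_block (F : nat -> seq U) a l e : (forall i, size (F i) = e) ->
  size (flatten [seq block i (F i) | i <- iota a l]) = (l * e)%N.
Proof.
move=> Fe; rewrite size_flatten /shape -map_comp sumnE big_map.
rewrite (eq_bigr (fun=> e)) => [|i _]; last by rewrite /= size_map Fe.
by rewrite big_const_seq count_predT size_iota iter_addn_0 mulnC.
Qed.

Lemma size_diag_list1 :
  size diag_list1 = (h.+1 * (d - h.+1 + 'C(d.-1, 2)))%N.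
Proof.
apply: size_flatten_block => i.
by rewrite size_cells size_map size_iota size_strict_pairs.
Qed.

Lemma size_diag_list2 :
  size diag_list2 = ((m - h) * (d - h.+1 + 'C(d, 2)))%N.
Proof.
by apply: size_flatten_block => i; rewrite size_cells size_iota size_strict_pairs.
Qed.

Lemma diag_list1_index e : e \in diag_list1 -> (e.1 <= h)%N.
Proof.
case/flattenP => s /mapP[i]; rewrite mem_iota => /andP[_ ih] -> /mapP[v _ ->].
by rewrite /=; lia.
Qed.

Lemma bump_pair i j k : (j < k < d)%N -> i != j -> i != k -> (i < d)%N ->
  (j, k) \in [seq (bump i p.1, bump i p.2) | p <- strict_pairs d.-1].
Proof.
move=> jk ij ik id; apply/mapP; exists (unbump i j, unbump i k).
  by rewrite mem_strict_pairs /unbump; lia.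
by rewrite /= /bump /unbump; congr (_, _); lia.
Qed.

Lemma diag_core f : (h < d)%N -> core_form diag_ins f ->
  kills (diag_list1 ++ diag_list2) f -> forall x v w, f x v w = 0.
Proof.
move=> hd fc /kills_cat[k1 k2]; have [ft fs fi] := fc.
have fd x j : (j <= h)%N -> f x (eU j) (eU j) = 0.
  move=> jh; have : (eV j, eU j) \in diag_ins.
    by apply: (map_f (fun q => (eV q, eU q))); rewrite mem_iota.
  by move=> /fi[].
have fp j v : (j <= h)%N -> f (eV j) (eU j) v = 0.
  move=> jh; have : (eV j, eU j) \in diag_ins.
    by apply: (map_f (fun q => (eV q, eU q))); rewrite mem_iota.
  by move=> /fi[].
have b1 i : (i <= h)%N -> kills (block i (cells (iota h.+1 (d - h.+1))
    [seq (bump i p.1, bump i p.2) | p <- strict_pairs d.-1])) f.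
  move=> ih e eb; apply: k1; apply: mem_flatten_block eb.
  by rewrite mem_iota.
have b2 i : (h < i <= m)%N ->
    kills (block i (cells (iota h.+1 (d - h.+1)) (strict_pairs d))) f.
  move=> ih e eb; apply: k2; apply: mem_flatten_block eb.
  by rewrite mem_iota; lia.
have dd x j : (j < d)%N -> f x (eU j) (eU j) = 0.
  move=> jd; have [jh|jh] := leqP j h; first exact: fd.
  move: x; apply: (trilin1_unit0 ft) => i im.
  have jm : j \in iota h.+1 (d - h.+1) by rewrite mem_iota; lia.
  have [ih|ih] := leqP i h.
    by have [+ _] := kills_block ft fs (b1 i ih); apply.
  have ihm : (h < i <= m)%N by rewrite ih.
  by have [+ _] := kills_block ft fs (b2 i ihm); apply.
apply: (core_diag fc) => // x j k jk; have /andP[jk1 kd] := jk.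
have jd := ltn_trans jk1 kd.
move: x; apply: (trilin1_unit0 ft) => i im; have [ih|ih] := leqP i h.
  have [ij|ij] := eqVneq i j; last have [ik|ik] := eqVneq i k.
  - by rewrite -ij; apply: fp.
  - by rewrite fs -ik; apply: fp.
  have [_ +] := kills_block ft fs (b1 i ih); apply; rewrite ?dd //.
  by apply: bump_pair => //; lia.
have ihm : (h < i <= m)%N by rewrite ih.
have [_ +] := kills_block ft fs (b2 i ihm); apply; rewrite ?dd //.
by rewrite mem_strict_pairs.
Qed.

End Diagonal.
End Cores.

Lemma bin2_double k : ('C(k.+1, 2).*2 = k.+1 * k)%N.
Proof. by rewrite -mul2n -mul_bin_diag bin1. Qed.

Lemma bin2_even h : ('C(h.*2, 2) = h * h.*2.-1)%N.
Proof. by case: h => // h; have := bin2_double h.*2.+1; rewrite doubleS /=; nia. Qed.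

Lemma bin2_odd h : ('C(h.*2.+1, 2) = h.*2.+1 * h)%N.
Proof. by have := bin2_double h.*2; nia. Qed.

Section CoreExistence.
Variables (K : numFieldType) (m d t : nat).
Local Notation V := ('rV[K]_m.+1).
Local Notation U := ('rV[K]_d).

(** The bound 4 h^3 - 3 h equals (m+1) C(m+1,2) - 2m(h+1), the dimension of the forms singular at
    the h+1 further points; each group kills one cell. *)
Lemma diag_core_singles h z' zeta (z : 'I_t -> V) (w : U) :
  d = m -> (m = h.*2)%N -> (2 <= h)%N -> (4 * h ^ 3 - 3 * h <= t)%N ->
  exists a, core_singles (diag_ins K m d h) z' zeta z w a.
Proof.
move=> dm mh h2 ht; pose L := diag_list1 K d h ++ diag_list2 K m d h.
have sL : (size L <= t)%N.
  apply: leq_trans ht; rewrite size_cat size_diag_list1 size_diag_list2 dm mh.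
  case: h h2 {mh L} => [|[|h]] // _.
  have -> : (h.+2.*2.-1 = h.+1.*2.+1)%N by lia.
  rewrite bin2_even bin2_odd; nia.
apply: (@core_singles_slots K m d t _ z' zeta z w
  (fun i : 'I_t => nth (0%N, 0) L i)); first by lia.
move=> f fc fL; apply: (diag_core _ fc) => [|e eL]; first by rewrite dm; lia.
have ei : (index e L < t)%N by apply: leq_trans sL; rewrite index_mem.
by have := fL (Ordinal ei); rewrite /= nth_index.
Qed.

(** The first entry of a slot is taken from [diag_list1], so its index is at most h and determines
    the further point assigned to the group. The second entry is arbitrary, which requires m >=
    4. *)
Lemma diag_core_pairs h : d = m -> (m.+1 = h.*2)%N -> (2 <= h)%N ->
  (2 * h ^ 3 + 1 <= t + 3 * h ^ 2 + h)%N ->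
  exists zi : 'I_t -> nat, (forall i, (zi i <= h)%N) /\
    exists a, core_pairs (diag_ins K m d h) (fun=> None)
      (fun i => unit_row K d (zi i)) (fun i => unit_row K m.+1 (zi i)) a.
Proof.
move=> dm mh h2 ht; have [h3|h3] := leqP 3 h.
  pose L1 := diag_list1 K d h; pose L := L1 ++ diag_list2 K m d h.
  have [T [Tt T1 T2]] : exists T, [/\ (T <= t)%N, (T <= size L1)%N & (size L <= T + T)%N].
    case: h h2 h3 mh ht @L1 @L => [|[|k]] // _ h3 mh ht.
    (* In terms of h this is 2 h^3 - 3 h^2 - h + 1, half the number of cells. *)
    exists (2 * k ^ 3 + 9 * k ^ 2 + 11 * k + 3)%N.
    rewrite size_cat size_diag_list1 size_diag_list2.
    have -> : m = k.+1.*2.+1 by lia.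
    have -> : d = k.+1.*2.+1 by lia.
    have -> : (k.+1.*2.+1.-1 = k.+1.*2)%N by lia.
    have -> : (k.+1.*2.+1 - k.+3 = k)%N by lia.
    have -> : (k.+1.*2.+1 - k.+2 = k.+1)%N by lia.
    rewrite bin2_even bin2_odd (_ : k.+1.*2.-1 = k.*2.+1)%N; last by lia.
    rewrite -!mul2n; move: ht; rewrite !expnS !expn0 !muln1 => ht.
    split; nia.
  exists (fun i => (nth (0%N, 0 : U) L1 i).1); split=> [i|].
    have [il|il] := ltnP i (size L1); last by rewrite nth_default.
    exact/diag_list1_index/mem_nth.
  apply: (@core_pairs_slots K m d t _ _ _ _
    (fun i : 'I_t => (nth (0%N, 0) L1 i, nth (0%N, 0) L (i + T)))); first by lia.
    by move=> i; split; [left | apply: Or31; lia].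
  move=> f fc fL; apply: (diag_core _ fc) => [|e eL]; first by rewrite dm; lia.
  have [eT|eT] := ltnP (index e L) T.
    have [] := fL (Ordinal (leq_trans eT Tt)) => + _ /=.
    have eL1 : (index e L < size L1)%N by apply: leq_trans eT T1.
    have := nth_cat (0%N, 0 : U) L1 (diag_list2 K m d h) (index e L).
    by rewrite -/L eL1 nth_index // => <-.
  have eT' : (index e L - T < t)%N.
    rewrite ltn_subLR //; apply: leq_trans (leq_trans T2 _); rewrite ?index_mem //.
    by rewrite leq_add2l.
  by have [_] := fL (Ordinal eT'); rewrite /= subnK // nth_index.
(* For m = 3 both entries of a slot carry the same vector: the three cells of index 3 are matched
   with those of index 0, 1, 2. *)
have hE : h = 2%N by lia.
have mE : m = 3%N by lia.
have t3 : (3 <= t)%N by move: ht; rewrite hE !expnS !expn0; lia.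
pose v (q : nat) : U := if q == 0 then unit_row K d 1 + unit_row K d 2
  else if q == 1 then unit_row K d 0 + unit_row K d 2
  else unit_row K d 0 + unit_row K d 1.
exists (fun i : 'I_t => minn i 2); split=> [i|]; first by rewrite hE geq_minr.
apply: (@core_pairs_slots K m d t _ _ _ _
  (fun i : 'I_t => ((minn i 2, v i), (3%N, v i)))); first by lia.
  by move=> i; split; [left | apply: Or32].
move=> f fc fL; apply: (diag_core _ fc) => [|e]; first by lia.
have fv q : (q < 3)%N -> f (unit_row K m.+1 q) (v q) (v q) = 0 /\
    f (unit_row K m.+1 3) (v q) (v q) = 0.
  move=> q3; have := fL (Ordinal (leq_trans q3 t3)); rewrite /=.
  by have -> : minn q 2 = q by lia.
have [a0 b0] := fv 0%N isT; have [a1 b1] := fv 1%N isT; have [a2 b2] := fv 2 isT.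
have -> : diag_list1 K d h ++ diag_list2 K m d h =
    [:: (0, v 0); (1, v 1); (2, v 2); (3, v 2); (3, v 1); (3, v 0)]%N.
  rewrite /diag_list1 /diag_list2 /cells hE.
  have -> : (m - 2 = 1)%N by lia.
  have -> : (d - 3 = 0)%N by lia.
  have -> : (d.-1 = 2)%N by lia.
  by rewrite [in strict_pairs d]dm mE.
by rewrite !inE => /orP[|/orP[|/orP[|/orP[|/orP[|]]]]] /eqP->.
Qed.

End CoreExistence.

(** * Pairing cells into slots *)

Section Pairing.
Variables (K : numFieldType) (d : nat).
Local Notation U := ('rV[K]_d).
Implicit Types (L X : seq (nat * U)) (vs : seq U).

(** The index constraint of [slot_ok] when all groups use the further point (e_1, eta_0). *)
Definition pairable (a b : nat * U) := a.1 = 1%N \/ a.1 = b.1.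

Definition covers (T : nat) L := exists s : seq (slot K d),
  [/\ (size s <= T)%N, forall p, p \in s -> pairable p.1 p.2 &
      forall e, e \in L -> exists2 p, p \in s & e = p.1 \/ e = p.2].

Lemma covers_cat T T' L L' : covers T L -> covers T' L' -> covers (T + T') (L ++ L').
Proof.
move=> [s [s1 s2 s3]] [s' [s1' s2' s3']]; exists (s ++ s'); split.
- by rewrite size_cat leq_add.
- by move=> p; rewrite mem_cat => /orP[/s2|/s2'].
- by move=> e; rewrite mem_cat => /orP[/s3|/s3'] [p ps pe]; exists p;
    rewrite // mem_cat ps ?orbT.
Qed.

Lemma covers_cons2 T a b L : pairable a b -> covers T L -> covers T.+1 [:: a, b & L].
Proof.
move=> ab [s [s1 s2 s3]]; exists ((a, b) :: s); split => //.
  by move=> p; rewrite inE => /orP[/eqP->|/s2].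
move=> e; rewrite !inE orbA => /orP[/orP[]/eqP->|/s3[p ps pe]].
- by exists (a, b); rewrite ?mem_head //; left.
- by exists (a, b); rewrite ?mem_head //; right.
- by exists p; rewrite // inE ps orbT.
Qed.

Lemma covers_pairs L : {in L &, forall a b, pairable a b} ->
  covers (uphalf (size L)) L.
Proof.
have [k] := ubnP (size L); elim: k L => // k IH [|a [|b L]] Lk Lp.
- by exists [::]; split.
- exists [:: (a, a)]; split => // [p|e]; rewrite inE => /eqP->; first by right.
  by exists (a, a); rewrite ?mem_head //; left.
- apply: covers_cons2; first by apply: Lp; rewrite !inE eqxx ?orbT.
  apply: IH; first by move: Lk => /=; lia.
  by move=> x y xL yL; apply: Lp; rewrite !inE ?xL ?yL !orbT.
Qed.

Lemma covers_block i vs : covers (uphalf (size vs)) (block i vs).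
Proof.
rewrite -(size_map (pair i)); apply: covers_pairs => a b /mapP[v _ ->] /mapP[w _ ->].
by right.
Qed.

Lemma covers_cons_block x i vs : x.1 = 1%N ->
  covers (uphalf (size vs).+1) (x :: block i vs).
Proof.
case: vs => [|v vs] x1; last by apply: covers_cons2; [left | apply: covers_block].
by apply: (@covers_pairs [:: x]) => a b; rewrite !inE => /eqP-> /eqP->; right.
Qed.

Lemma covers_sub T L L' : {subset L <= L'} -> covers T L' -> covers T L.
Proof. by move=> sub [s [s1 s2 s3]]; exists s; split => // e /sub /s3. Qed.

(* Elements of X, whose first coordinate is 1, complete the blocks of odd size. *)
Lemma covers_blocks js vs X : (forall x, x \in X -> x.1 = 1%N) ->
  covers (size js * uphalf (size vs) + uphalf (size X - odd (size vs) * size js))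
    (flatten [seq block i vs | i <- js] ++ X).
Proof.
elim: js X => [|i js IH] X X1 /=.
  rewrite mul0n muln0 subn0 add0n; apply: covers_pairs => a b aX _; left; exact: X1.
case vso: (odd (size vs)); last first.
  rewrite mul0n subn0 mulSn -addnA -catA; apply: covers_cat (covers_block i vs) _.
  by have := IH X X1; rewrite vso mul0n subn0.
case: X X1 => [|x X] X1.
  rewrite sub0n addn0 cats0 mulSn; apply: covers_cat (covers_block i vs) _.
  by have := IH [::] X1; rewrite sub0n cats0 addn0.
have /(covers_cons_block i vs) : x.1 = 1%N by apply: X1; rewrite mem_head.
have -> : uphalf (size vs).+1 = uphalf (size vs) by lia.
have X1' y : y \in X -> y.1 = 1%N by move=> yX; apply: X1; rewrite inE yX orbT.
move=> cx; have := covers_cat cx (IH X X1'); rewrite vso !mul1n /= subSS mulSn addnA.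
apply: covers_sub => e; rewrite !(inE, mem_cat).
by do !case: (e \in _); rewrite ?orbT.
Qed.

End Pairing.

(** * Forms singular at a single further point *)

Section FirstCore.
Variables (K : numFieldType) (m d t : nat).
Local Notation V := ('rV[K]_m.+1).
Local Notation U := ('rV[K]_d).
Local Notation eV i := (unit_row K m.+1 i).
Local Notation eU j := (unit_row K d j).

Definition point_ins : seq (V * U) := [:: (eV 1, eU 0)].

Definition point_list : seq (nat * U) :=
  flatten [seq block i (cells K d (iota 1 d.-1) (strict_pairs d)) | i <- 0%N :: iota 2 d].

Definition point_extra : seq (nat * U) :=
  block 1 (cells K d (iota 1 d.-1) [seq (p.1.+1, p.2.+1) | p <- strict_pairs d.-1]).

Lemma point_core f : m = d.+1 -> core_form point_ins f ->
  kills (m := m) (point_list ++ point_extra) f -> forall x v w, f x v w = 0.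
Proof.
move=> md fc /kills_cat[k1 k2]; have [ft fs fi] := fc.
have [f00 f10] := fi _ (mem_head _ _); rewrite /= in f00 f10.
have b1 i : (i <= m)%N -> i != 1%N ->
    kills (m := m) (block i (cells K d (iota 1 d.-1) (strict_pairs d))) f.
  move=> im i1 e eb; apply: k1; apply: mem_flatten_block eb.
  by rewrite inE mem_iota; lia.
have dd x j : (j < d)%N -> f x (eU j) (eU j) = 0.
  case: j => [//|j] jd; move: x; apply: (trilin1_unit0 ft) => i im.
  have jm : j.+1 \in iota 1 d.-1 by rewrite mem_iota; lia.
  have [->|i1] := eqVneq i 1%N.
    by have [+ _] := kills_block ft fs k2; apply.
  by have [+ _] := kills_block ft fs (b1 i im i1); apply.
apply: (core_diag fc) => // x j k jk; have /andP[jk1 kd] := jk.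
have jd := ltn_trans jk1 kd.
move: x; apply: (trilin1_unit0 ft) => i im; have [->|i1] := eqVneq i 1%N.
  case: j k jk jk1 kd jd => [|j] [|k] // jk jk1 kd jd.
  have [_ +] := kills_block ft fs k2; apply; rewrite ?dd //.
  apply/mapP; exists (j, k) => //.
  by rewrite mem_strict_pairs; lia.
have [_ +] := kills_block ft fs (b1 i im i1); apply; rewrite ?dd //.
by rewrite mem_strict_pairs.
Qed.

Lemma point_core_pairs z' : m = d.+1 -> (3 <= m)%N -> (m ^ 3 <= 4 * t + 4 * m + 1)%N ->
  exists a, core_pairs point_ins z' (fun i : 'I_t => eU 0) (fun i => eV 1) a.
Proof.
move=> md m3 mt; have [m4|m4] := leqP 4 m.
  have [s [sT sp sc]] : covers t (point_list ++ point_extra).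
    have xP x : x \in point_extra -> x.1 = 1%N by case/mapP => v _ ->.
    have [s [sT sp sc]] := covers_blocks (0%N :: iota 2 d)
      (cells K d (iota 1 d.-1) (strict_pairs d)) xP.
    exists s; split => //; apply: leq_trans sT _.
    rewrite /point_extra size_map !size_cells size_map !size_strict_pairs.
    have -> : size (0%N :: iota 2 d) = d.+1 by rewrite /= size_iota.
    rewrite !size_iota.
    move: m4 mt; rewrite md {md m3 xP}.
    case: d => [|[|[|[|k]]]] // _; rewrite !expnS expn0 muln1 => mt.
      (* For m = 4 there are four blocks of five cells and only three cells of index 1, hence 12
         slots. *)
      by apply: (@leq_trans 12) => //; lia.
    rewrite -[k.+4.-1]/k.+3; have := bin2_double k.+2; have := bin2_double k.+3.
    set a := 'C(_, 2); set b := 'C(_, 2) => aE bE.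
    set E := (k.+3 + a)%N; set X := (k.+3 + b)%N.
    (* From m = 5 on there is a cell of index 1 for every block. *)
    have XE : (k.+1.+4 <= X)%N by rewrite /X; nia.
    have EE : (2 * E = (k + 6) * k.+3)%N by rewrite /E; nia.
    have XX : (2 * X = (k + 4) * k.+3)%N by rewrite /X; nia.
    have uE : (2 * uphalf E = odd E + E)%N by lia.
    have vE : (2 * uphalf (X - odd E * k.+1.+4) <= 1 + (X - odd E * k.+1.+4))%N by lia.
    move: uE vE; set u := uphalf E; set v := uphalf _; move: u v XE EE XX.
    clearbody E X => u v XE EE XX uE vE.
    have W4 : (4 * (k.+1.+4 * u) = k.+1.+4 * (2 * odd E + (k + 6) * k.+3))%N.
      by rewrite -EE -mulnDr -uE; ring.
    have oX : (odd E * k.+1.+4 <= X)%N by case: (odd E); lia.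
    have {}vE : (4 * v + 2 * (odd E * k.+1.+4) <= 2 + (k + 4) * k.+3)%N by lia.
    move: (odd E) (k.+1.+4 * u)%N W4 vE => o w W4 vE.
    rewrite -(leq_pmul2l (isT : (0 < 4)%N)) mulnDr W4; move: vE mt; clear.
    move: (v) => {}v; nia.
  pose dflt : slot K d := ((1%N, 0), (1%N, 0)).
  apply: (@core_pairs_slots K m d t _ _ _ (fun=> 1%N) (fun i : 'I_t => nth dflt s i)) => //.
    move=> i; split; last exact: Or31.
    have [si|si] := ltnP i (size s); last by rewrite nth_default //; left.
    exact/sp/mem_nth.
  move=> f fc fL; apply: (point_core md fc) => e /sc[p ps pe].
  have pt : (index p s < t)%N by apply: leq_trans sT; rewrite index_mem.
  by have [] := fL (Ordinal pt); rewrite /= nth_index //; case: pe => <-.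
(* For m = 3 the slot with vectors eta_1 and zeta - eta_1 = eta_0 - eta_1 is admissible. Since f(x,
   eta_0, eta_0) = 0, it kills both remaining cells of its index; for index 1 only eta_1 is left to
   kill. *)
have mE : m = 3%N by lia.
have t4 : (4 <= t)%N by move: mt; rewrite mE !expnS expn0; lia.
pose s (i : nat) : slot K d := if i == 1%N then ((1%N, eU 1), (1%N, eU 1))
  else ((minn i 3, eU 1), (minn i 3, eU 0 - eU 1)).
apply: (@core_pairs_slots K m d t _ _ _ (fun=> 1%N) (fun i : 'I_t => s i)) => //.
  move=> i; rewrite /s; case: ifP => _ /=; split; try by right.
    exact: Or32.
  exact: Or33.
move=> f fc fL; have [ft fs fi] := fc.
have [f00 f10] := fi _ (mem_head _ _); rewrite /= in f00 f10.
have d2 : d = 2%N by lia.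
have f11 x : f x (eU 1) (eU 1) = 0.
  move: x; apply: (trilin1_unit0 ft) => i im.
  have it : (i < t)%N by lia.
  have [] := fL (Ordinal it); rewrite /= /s; case: eqP => [->//|_] /=.
  by have -> : minn i 3 = i by lia.
have f01 x : f x (eU 0) (eU 1) = 0.
  move: x; apply: (trilin1_unit0 ft) => i im.
  have [->//|i1] := eqVneq i 1%N.
  have it : (i < t)%N by lia.
  have [_] := fL (Ordinal it); rewrite /= /s (negPf i1) /=.
  have -> : minn i 3 = i by lia.
  rewrite (trilinB2 ft) (fs _ (eU 0) (_ - _)) (fs _ (eU 1) (_ - _)) !(trilinB2 ft).
  rewrite f00 f11 (fs _ (eU 1) (eU 0)).
  have two0 : (-2 : K) != 0 by rewrite oppr_eq0 pnatr_eq0.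
  by move=> E; apply: (mulfI two0); rewrite mulr0 -[RHS]E; ring.
apply: (core_diag fc) => [x j|x j k] jd.
  by have [->|->] : j = 0%N \/ j = 1%N by lia.
by have [-> ->] : j = 0%N /\ k = 1%N by lia.
Qed.

End FirstCore.

(** * Spanning and independent configurations *)

Section ConfigurationFill.
Variables (K : numFieldType) (m d t n : nat).
Local Notation V := ('rV[K]_m.+1).
Local Notation U := ('rV[K]_d).
Local Notation L := ('rV[K]_2).
Local Notation Y := ('rV[K]_n.+1).
Local Notation form := (V -> Y -> Y -> K).
Local Notation params := ('I_t * (nat * nat * nat) -> K).
Hypothesis dtn : (d + t.*2 = n.+1)%N.

Definition base_mx : 'M[K]_(d, n.+1) := \matrix_(r, c) ((c : nat) == r)%:R.
Definition plane_mx (i : 'I_t) : 'M[K]_(2, n.+1) :=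
  \matrix_(r, c) ((c : nat) == d + i.*2 + r)%N%:R.
Local Notation io := base_mx.

Lemma base_plane_decomposition (y : Y) : exists (v : U) (l : 'I_t -> L),
  y = v *m io + \sum_i l i *m plane_mx i.
Proof.
exists (\row_r y 0 (inord r)), (fun i => \row_r y 0 (inord (d + i.*2 + r)%N)).
apply/rowP => c; rewrite !mxE summxE.
have eqE (r : nat) : (c : nat) = r -> y 0 (inord r) = y 0 c.
  by move=> <-; rewrite inord_val.
have [cd|dc] := ltnP c d.
  rewrite (bigD1 (Ordinal cd)) //= !mxE eqxx mulr1 (eqE c) // big1 => [|r rc].
    rewrite addr0 big1 ?addr0 // => i _; rewrite mxE big1 // => r _; rewrite !mxE.
    by case: eqP => [E|_]; [lia | rewrite mulr0].
  rewrite !mxE; case: eqP => [E|_]; last by rewrite mulr0.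
  by case/eqP: rc; apply/val_inj.
rewrite big1 => [|r _]; last first.
  by rewrite !mxE; case: eqP => [E|_]; [have := ltn_ord r; lia | rewrite mulr0].
have it : ((c - d)./2 < t)%N by have := ltn_ord c; lia.
have r2 : (odd (c - d) < 2)%N by case: odd.
rewrite (bigD1 (Ordinal it)) //= mxE (bigD1 (Ordinal r2)) //= !mxE.
rewrite (_ : (c : nat) == _); last by apply/eqP; rewrite /=; lia.
rewrite mulr1 (eqE (d + (c - d)./2.*2 + odd (c - d))%N); last by lia.
rewrite big1 => [|r rr]; last first.
  rewrite !mxE; case: eqP => [E|_]; last by rewrite mulr0.
  by case/eqP: rr; apply/val_inj; rewrite /=; have := ltn_ord r; lia.
rewrite big1 => [|i ii]; first by rewrite addr0 add0r addr0.
rewrite mxE big1 // => r _; rewrite !mxE; case: eqP => [E|_]; last by rewrite mulr0.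
by case/eqP: ii; apply/val_inj; rewrite /=; have := ltn_ord r; lia.
Qed.

Variables (z : 'I_t -> V) (z' : 'I_t -> option V) (zeta : 'I_t -> U).
Variables (S : 'I_t -> seq (V * U * L)) (ins : seq (V * U)).

Definition config_form (a : params) (f : form) :=
  [/\ trilin f /\ forall x y y', f x y y' = f x y' y,
      forall p, p \in ins -> (forall x, f x (p.2 *m io) (p.2 *m io) = 0) /\
        forall y, f p.1 (p.2 *m io) y = 0,
      forall i j x, (j <= m)%N ->
        f x (config_point m zeta io plane_mx a i j) (config_point m zeta io plane_mx a i j) = 0 &
      forall i j y, (j <= m)%N ->
        f (gx (z i) (z' i) (group_param a i) j) (config_point m zeta io plane_mx a i j) y = 0].

(** By [config_vanish] the added vectors only have to secure the outside conditions and the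
    vanishing on V x U x U. *)
Lemma config_fill (J : finType) (trip : J -> V * Y * Y) (a : params) : (2 <= m)%N ->
  config_ok z z' zeta S a ->
  (forall f, config_form a f -> (forall k, f (trip k).1.1 (trip k).1.2 (trip k).2 = 0) ->
    (forall i p, p \in S i -> f p.1.1 (p.1.2 *m io) (p.2 *m plane_mx i) = 0) /\
    forall x v w, f x (v *m io) (w *m io) = 0) ->
  fill K m n (size ins + t * m.+1) #|J|.
Proof.
move=> m2 aok kill; pose P := ('I_(size ins) + 'I_t * 'I_m.+1)%type.
have -> : (size ins + t * m.+1 = #|{: P}|)%N.
  by rewrite card_sum card_prod !card_ord.
pose XX (p : P) := match p with
  | inl q => (nth (0, 0) ins q).1
  | inr (i, j) => gx (z i) (z' i) (group_param a i) j end.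
pose ZZ (p : P) := match p with
  | inl q => (nth (0, 0) ins q).2 *m io
  | inr (i, j) => config_point m zeta io plane_mx a i j end.
apply: (@fill_fin K m n P J XX ZZ trip) => f ft fs f1 f2 fT.
have fc : config_form a f.
  split => //.
  - move=> p pi; have ip : (index p ins < size ins)%N by rewrite index_mem.
    split=> [x|y].
      by have := f1 (inl (Ordinal ip)) x; rewrite /= nth_index.
    by have := f2 (inl (Ordinal ip)) y; rewrite /= nth_index.
  - move=> i j x jm; have jm' : (j < m.+1)%N by [].
    exact: (f1 (inr (i, Ordinal jm')) x).
  - move=> i j y jm; have jm' : (j < m.+1)%N by [].
    exact: (f2 (inr (i, Ordinal jm')) y).
have [fext fcore] := kill f fc fT; have [_ _ fq fsg] := fc.
exact: (config_vanish base_plane_decomposition ft fs fq fsg aok m2 fext fcore).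
Qed.

Section Spanning.
Hypothesis m2 : (2 <= m)%N.
Hypothesis S_ins : forall i p, p \in S i -> p.1 \in ins.
Hypothesis basisP : forall i, exists c, basis_ok (z i) (z' i) c.
Hypothesis extensionP : forall i, exists c, extension_ok (z i) (z' i) (zeta i) (S i) c.
Hypothesis crossP : forall i j, i != j ->
  exists c1 c2, cross_ok (z i) (z j) (z' i) (z' j) c1 c2.

Lemma config_core a f : config_form a f ->
  core_form ins (fun x v w => f x (v *m io) (w *m io)) /\
  forall i p, p \in S i -> f p.1.1 (p.1.2 *m io) (p.2 *m plane_mx i) = 0.
Proof.
move=> [[ft fs] fi _ _]; split; last by move=> i p /S_ins /fi[].
split; first exact: trilin_mul.
  by move=> x v w; apply: fs.
by move=> p /fi[p1 p2]; split.
Qed.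

(** No vectors are added: [S] involves only further points, and the conditions of [group_extra] kill
    V x U x U. *)
Lemma fill_pairs : (forall i, (z i, zeta i) \in ins) ->
  (exists a, core_pairs ins z' zeta z a) -> fill K m n (size ins + t * m.+1) 0.
Proof.
move=> zin /gen_core_pairs Q.
have [a aok aQ] := config_exists Q basisP extensionP crossP.
have := config_fill (trip := fun _ : 'I_0 => (0, 0, 0)) m2 aok; rewrite card_ord.
apply=> f fc _.
have [core fext] := config_core fc; split => //.
have [[ft fs] fi fq fsg] := fc; case: aok => sc _ _ _.
apply: (aQ _ core) => i b.
have [sc1 sc2 sc3 _] := sc i.
have zz y : f (z i) (zeta i *m io) y = 0 by case: (fi _ (zin i)).
have su : \sum_(2 <= j < m.+1) gu m (zeta i) (group_param a i) j *m io = zeta i *m io.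
  by rewrite -mulmx_suml sum_gu.
have [g1 g0] := @group_extra K m n.+1 f ft fs (gx (z i) (z' i) (group_param a i))
  (fun j => gu m (zeta i) (group_param a i) j *m io)
  (gA (group_param a i)) (gA' (group_param a i))
  ('e_0 *m plane_mx i) ('e_1 *m plane_mx i) erefl erefl erefl erefl sc1 (ltnW m2)
  (fun j w jm => etrans (congr2 (f w) (esym (config_pointE m zeta io plane_mx a i j))
     (esym (config_pointE m zeta io plane_mx a i j))) (fq i j w jm))
  (fun j w jm => etrans (congr1 (fun y => f _ y w)
     (esym (config_pointE m zeta io plane_mx a i j))) (fsg i j w jm))
  (z i) _ _ erefl sc3 (etrans (congr1 (fun y => f _ y _) su) (zz _))
  (etrans (congr1 (fun y => f _ y _) su) (zz _)).
by rewrite /group_psi; case: b.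
Qed.

Lemma fill_singles (w : 'I_t -> V) (v : 'I_t -> U) (u : U) : (3 <= m)%N ->
  (forall i, z' i = Some (w i)) -> (forall i, zeta i = u - v i) ->
  (forall i, (z i, v i) \in ins) -> (forall i, (w i, u) \in ins) ->
  (exists a, core_singles ins z' zeta z u a) -> fill K m n (size ins + t * m.+1) 0.
Proof.
move=> m3 z'E zetaE zin win /gen_core_singles Q.
have [a aok aQ] := config_exists Q basisP extensionP crossP.
have := config_fill (trip := fun _ : 'I_0 => (0, 0, 0)) m2 aok; rewrite card_ord.
apply=> f fc _.
have [core fext] := config_core fc; split => //.
have [[ft fs] fi fq fsg] := fc; case: aok => sc _ _ _.
apply: (aQ _ core) => i.
have [sc1 sc2 sc3 sc4] := sc i.
have zz y : f (z i) (v i *m io) y = 0 by case: (fi _ (zin i)).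
have ww y : f (w i) (u *m io) y = 0 by case: (fi _ (win i)).
have su : \sum_(2 <= j < m.+1) gu m (zeta i) (group_param a i) j *m io =
    u *m io - v i *m io.
  by rewrite -mulmx_suml sum_gu // zetaE mulmxBl.
have x2 : gx (z i) (z' i) (group_param a i) 2 =
    group_param a i (2, 1, 0)%N *: w i +
    group_param a i (2, 1, 1)%N *: gx (z i) (z' i) (group_param a i) 0.
  by rewrite /gx z'E.
have := @group_extra_half K m n.+1 f ft fs (gx (z i) (z' i) (group_param a i))
  (fun j => gu m (zeta i) (group_param a i) j *m io)
  (gA (group_param a i)) (gA' (group_param a i))
  ('e_0 *m plane_mx i) ('e_1 *m plane_mx i) erefl erefl erefl erefl sc1 (ltnW m2)
  (fun j w jm => etrans (congr2 (f w) (esym (config_pointE m zeta io plane_mx a i j))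
     (esym (config_pointE m zeta io plane_mx a i j))) (fq i j w jm))
  (fun j w jm => etrans (congr1 (fun y => f _ y w)
     (esym (config_pointE m zeta io plane_mx a i j))) (fsg i j w jm))
  (z i) (w i) (v i *m io) (u *m io) _ _ _ _ m2 erefl sc3 x2 sc4 su (zz _) (ww _) (ww _) (ww _).
by rewrite /group_psi_half /group_psi mulNr mulrA.
Qed.

End Spanning.
End ConfigurationFill.

(** * Independence of tangent spaces *)

Section Independence.
Variables (K : numFieldType) (m t n : nat).
Local Notation V := ('rV[K]_m.+1).
Local Notation L := ('rV[K]_2).
Local Notation Y := ('rV[K]_n.+1).

Lemma fill_all_triples d (z : 'I_t -> V) z' zeta : (d.+1 + t.*2 = n.+1)%N ->
  (2 <= m)%N -> (forall i, exists c, basis_ok (z i) (z' i) c) ->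
  (forall i, exists c, @extension_ok K m d.+1 (z i) (z' i) (zeta i) [::] c) ->
  (forall i j, i != j -> exists c1 c2, cross_ok (z i) (z j) (z' i) (z' j) c1 c2) ->
  fill K m n (t * m.+1) (sv_N m d).+1.
Proof.
move=> dtn m2 B E C.
have [a aok _] := config_exists (gen_true _ _) B E C.
pose trip (q : sv_index m d) : V * Y * Y := ('e_q.1,
  'e_(val q.2).1 *m base_mx K d.+1 n, 'e_(val q.2).2 *m base_mx K d.+1 n).
rewrite -card_sv_index.
apply: (@config_fill K m d.+1 t n dtn z z' zeta (fun=> [::]) [::] _ trip a) => //.
move=> f [[ft fs] _ _ _] f0; split => // x v w.
have gt := trilin_mul ft (base_mx K d.+1 n) (base_mx K d.+1 n).
move: x; apply: (trilin1_eq0 ft) => i; move: v; apply: (trilin2_eq0 gt) => j.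
move: w; apply: (trilin3_eq0 gt) => k /=; case: (leqP j k) => jk.
  exact: (f0 (i, exist _ (j, k) jk)).
by rewrite fs; apply: (f0 (i, exist _ (k, j) (ltnW jk))).
Qed.

Section Diagonal.
Variables (A : {set 'I_m}) (z : 'I_t -> V) (z' : 'I_t -> option V).
Variables (zeta : 'I_t -> 'rV[K]_m) (S : 'I_t -> seq (V * 'rV[K]_m * L)).
Variables (J : finType) (extra : J -> V * Y * Y).
Local Notation io := (base_mx K m n).
Local Notation eV i := (unit_row K m.+1 i).
Local Notation eU j := (unit_row K m j).
Hypothesis mtn : (m + t.*2 = n.+1)%N.
Hypothesis m2 : (2 <= m)%N.
Hypothesis S_ins : forall i p, p \in S i ->
  (exists2 q, q \in A & p.1 = (eV q, eU q)) \/
  exists k, extra k = (p.1.1, p.1.2 *m io, p.2 *m plane_mx K m n i).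
Hypothesis basisP : forall i, exists c, basis_ok (z i) (z' i) c.
Hypothesis extensionP : forall i, exists c, extension_ok (z i) (z' i) (zeta i) (S i) c.
Hypothesis crossP : forall i j, i != j ->
  exists c1 c2, cross_ok (z i) (z j) (z' i) (z' j) c1 c2.

(** The triples with three different indices: i takes m-1 values and is moved past j and k, and a
    pair j < k is encoded by j <= k-1. *)
Definition strict_triple (q : sv_index m.-2 m.-2) : V * Y * Y :=
  let j : nat := (val q.2).1 in let k := (val q.2).2.+1 in
  (eV (bump k (bump j q.1)), eU j *m io, eU k *m io).

(** The 2m conditions on V x U x U that (e_q, eta_q) would impose as a point of the
    configuration. *)
Definition dropped_triple (p : {q : 'I_m | q \notin A} * (bool * 'I_m)) : V * Y * Y :=
  let q : nat := val p.1 in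
  if p.2.1 then (eV (bump q p.2.2), eU q *m io, eU q *m io)
  else (eV q, eU q *m io, eU p.2.2 *m io).

(** The coefficients on V x U x U split into the triples with different indices and 2m conditions
    for each (e_q, eta_q), q < m. Points in [A] supply theirs and vectors the rest, with none to
    spare; [extra] serves the outside conditions. *)
Lemma fill_diagonal : fill K m n (#|A| + t * m.+1)
  (m.-1 * 'C(m, 2) + (m - #|A|) * m.*2 + #|J|).
Proof.
have [a aok _] := config_exists (gen_true _ _) basisP extensionP crossP.
pose T := (sv_index m.-2 m.-2 + {q : 'I_m | q \notin A} * (bool * 'I_m) + J)%type.
pose trip (q : T) := match q with
  | inl (inl q) => strict_triple q | inl (inr q) => dropped_triple q | inr q => extra q end.
pose ins := [seq (eV q, eU q) | q : 'I_m <- enum A].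
have <- : size ins = #|A| by rewrite size_map -cardE.
have E1 : (m.-1 * 'C(m, 2) = (sv_N m.-2 m.-2).+1)%N.
  by case: (m) m2 => [|[|k]] // _; rewrite /sv_N prednK // muln_gt0 bin_gt0.
have E2 : (m - size ins = #|{: {q : 'I_m | q \notin A}}|)%N.
  rewrite card_sig size_map -cardE; transitivity #|~: A|.
    by rewrite cardsCs finset.setCK card_ord.
  by apply: eq_card => q; rewrite !inE.
have E3 : (#|{: bool * 'I_m}| = m.*2)%N by rewrite card_prod card_bool card_ord mul2n.
have -> : (m.-1 * 'C(m, 2) + (m - size ins) * m.*2 + #|J| = #|{: T}|)%N.
  by rewrite E1 E2 -E3 -card_sv_index -card_prod -!card_sum.
apply: (config_fill (trip := trip) mtn m2 aok) => f [[ft fs] fi fq fsg] f0.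
have insA q : q \in A -> (eV q, eU q) \in ins.
  by move=> qA; apply: (map_f (fun q : 'I_m => (eV q, eU q))); rewrite mem_enum.
split=> [i p /S_ins[[q qA pE]|[k pE]]|].
- by have [_] := fi _ (insA q qA); rewrite pE; apply.
- by have := f0 (inr k); rewrite /= pE.
have gt := trilin_mul ft io io.
have point (q : 'I_m) : (forall x, f x (eU q *m io) (eU q *m io) = 0) /\
    forall v, f (eV q) (eU q *m io) (v *m io) = 0.
  have [qA|qA] := boolP (q \in A).
    by have [p1 p2] := fi _ (insA q qA); split=> // v; apply: p2.
  have pv : forall v, f (eV q) (eU q *m io) (v *m io) = 0.
    apply: (trilin3_eq0 gt) => k; rewrite -unit_rowE.
    exact: (f0 (inl (inr (exist _ q qA, (false, k))))).
  split=> //; apply: (trilin1_unit0 ft) => i im.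
  have [->|iq] := eqVneq i q; first exact: pv.
  have ui : (unbump q i < m)%N by rewrite /unbump; have := ltn_ord q; lia.
  have := f0 (inl (inr (exist _ q qA, (true, Ordinal ui)))).
  by rewrite /= /dropped_triple /= unbumpKcond (negPf iq).
apply: (core_diag (ins := [::])).
  by split=> // [x v w|p]; rewrite ?in_nil // fs.
  by move=> x j jm; have [] := point (Ordinal jm).
move=> x j k /andP[jk km]; move: x; apply: (trilin1_unit0 ft) => i im.
have jm := ltn_trans jk km.
have [->|ij] := eqVneq i j; first by have [_] := point (Ordinal jm); apply.
have [->|ik] := eqVneq i k; first by have [_] := point (Ordinal km); rewrite fs; apply.
have jm' : (j < m.-2.+1)%N by lia.
have km' : (k.-1 < m.-2.+1)%N by lia.
have jk' : (j <= k.-1)%N by lia.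
have im' : (unbump j (unbump k i) < m.-2.+1)%N by rewrite /unbump; lia.
have := f0 (inl (inl (Ordinal im', exist _ (Ordinal jm', Ordinal km') jk'))).
rewrite /= /strict_triple /=; have -> : k.-1.+1 = k by lia.
suff -> : bump k (bump j (unbump j (unbump k i))) = i by [].
by rewrite /bump /unbump; lia.
Qed.

End Diagonal.
End Independence.

(** * The three parity cases *)

Section Cases.
Variables (K : numFieldType).

Lemma unit_row_inord b i : (i <= b)%N -> unit_row K b.+1 i = 'e_(inord i).
Proof. by move=> ib; rewrite -unit_rowE inordK. Qed.

Lemma basis_unit_row m p : (1 <= m)%N -> (p <= m)%N ->
  exists c, basis_ok (unit_row K m.+1 p) None c.
Proof.
move=> m1 pm; apply: (@basis_example K m _ None (tperm (inord 1) (inord p))) => //.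
by rewrite tpermL unit_row_inord.
Qed.

Lemma basis_unit_row2 m : (2 <= m)%N ->
  exists c, basis_ok (unit_row K m.+1 1) (Some (unit_row K m.+1 2)) c.
Proof.
move=> m2; apply: (@basis_example K m _ _ 1%g); rewrite ?perm1 ?unit_row_inord //.
  exact: ltnW.
exact: ltnW.
Qed.

(** Here m = e+2 and U has dimension m-1. Independence uses the groups alone; spanning adds the
    point (e_1, eta_0). *)
Lemma fill_point e t n : (1 <= e)%N -> (e.+1 + t.*2 = n.+1)%N ->
  (e.+2 ^ 3 <= 4 * t + 4 * e.+2 + 1)%N ->
  fill K e.+2 n (t * e.+3) (sv_N e.+2 e).+1 /\ fill K e.+2 n (t * e.+3).+1 0.
Proof.
move=> e1 etn mt; have m2 : (2 <= e.+2)%N by [].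
have B (i : 'I_t) := @basis_unit_row e.+2 1 isT isT.
have E (i : 'I_t) := @extension_example_full K e.+2 e.+1 (unit_row K _ 1) None erefl m2.
have C (i j : 'I_t) : i != j -> exists c1 c2,
    cross_ok (unit_row K e.+3 1) (unit_row K e.+3 1) None None c1 c2.
  move=> _; have [o|o] := boolP (odd e.+2).
    exact: cross_example_odd.
  by apply: cross_example_even => //; left.
split; first exact: (fill_all_triples etn m2 B E C).
have -> : ((t * e.+3).+1 = size (point_ins K e.+2 e.+1) + t * e.+3)%N by [].
apply: (fill_pairs etn m2 _ B E C) => //.
  by move=> i; rewrite mem_head.
exact: point_core_pairs.
Qed.

Section Diagonal.
Variables (m h t n : nat).
Local Notation V := ('rV[K]_m.+1).
Local Notation L := ('rV[K]_2).
Local Notation eV i := (unit_row K m.+1 i).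
Local Notation eU j := (unit_row K m j).

Definition diag_conditions (I0 I1 : seq nat) : seq (V * 'rV[K]_m * L) :=
  [seq (eV q, eU q, 'e_0) | q <- I0] ++ [seq (eV q, eU q, 'e_1) | q <- I1].

Lemma mem_diag_conditions0 I0 I1 q : q \in I0 ->
  (eV q, eU q, 'e_0) \in diag_conditions I0 I1.
Proof.
move=> qI; rewrite mem_cat; apply/orP; left.
exact: (map_f (fun q => (eV q, eU q, 'e_0 : L)) qI).
Qed.

Lemma mem_diag_conditions1 I0 I1 q : q \in I1 ->
  (eV q, eU q, 'e_1) \in diag_conditions I0 I1.
Proof.
move=> qI; rewrite mem_cat; apply/orP; right.
exact: (map_f (fun q => (eV q, eU q, 'e_1 : L)) qI).
Qed.

Lemma diag_conditionsP I0 I1 p : p \in diag_conditions I0 I1 ->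
  exists q, p.1 = (eV q, eU q) /\ ((q \in I0 /\ p.2 = 'e_0) \/ (q \in I1 /\ p.2 = 'e_1)).
Proof.
rewrite mem_cat => /orP[] /mapP[q qI ->]; exists q; split=> //=; [left|right] => //.
Qed.

Lemma mem_diag_ins q : (q <= h)%N -> (eV q, eU q) \in diag_ins K m m h.
Proof.
by move=> qh; apply: (map_f (fun q => (eV q, eU q))); rewrite mem_iota.
Qed.

Lemma diag_conditions_ins p :
  p \in diag_conditions (iota 0 h.+1) (iota 0 h.+1) -> p.1 \in diag_ins K m m h.
Proof.
case/diag_conditionsP => q [-> []] [qh _]; apply: mem_diag_ins.
  by move: qh; rewrite mem_iota.
by move: qh; rewrite mem_iota.
Qed.

Lemma card_ord_lt k : (k <= m)%N -> #|[set q : 'I_m | (q < k)%N]%SET| = k.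
Proof.
move=> km; rewrite cardsE -sum1_card (big_ord_narrow km).
by rewrite sum1_card card_ord.
Qed.

Hypothesis h2 : (2 <= h)%N.
Hypothesis mtn : (m + t.*2 = n.+1)%N.

(** The m+1 = 2h conditions that a group lacks on V x U x L come from h further points. Independence
    omits index h; for spanning all h+1 points are present and each group takes one as its own (z,
    zeta). *)
Lemma fill_diag_odd : (m.+1 = h.*2)%N -> (2 * h ^ 3 + 1 <= t + 3 * h ^ 2 + h)%N ->
  fill K m n (h + t * m.+1) (m.-1 * 'C(m, 2) + (m - h) * m.*2) /\
  fill K m n (h + t * m.+1).+1 0.
Proof.
move=> mh ht; have m2 : (2 <= m)%N by lia.
have mo : odd m by lia.
have hm : (h <= m)%N by lia.
have C (a b : nat) (i j : 'I_t) (_ : i != j) :=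
  @cross_example_odd K m (eV a) (eV b) mo.
split.
  pose I := iota 0 h; pose A := [set q : 'I_m | (q < h)%N]%SET.
  have := @fill_diagonal K m t n A (fun=> eV h) (fun=> None) (fun=> eU h)
    (fun=> diag_conditions I I) 'I_0 (fun=> (0, 0, 0)) mtn m2.
  rewrite card_ord_lt // card_ord addn0; apply.
  - move=> i p /diag_conditionsP[q [-> qI]]; left.
    have qh : (q < h)%N by case: qI => -[]; rewrite mem_iota.
    by exists (Ordinal (leq_trans qh hm)); rewrite ?inE.
  - by move=> i; apply: basis_unit_row; lia.
  - move=> i; apply: (@extension_example_odd K m m h) => // q qh qh'.
    have qI : q \in I by rewrite mem_iota; lia.
    by split; [apply: mem_diag_conditions0 | apply: mem_diag_conditions1].
  - exact: C.
have [zi [zih Q]] := diag_core_pairs K (erefl m) mh h2 ht.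
pose I := iota 0 h.+1.
have -> : ((h + t * m.+1).+1 = size (diag_ins K m m h) + t * m.+1)%N.
  by rewrite size_map size_iota addSn.
apply: (@fill_pairs K m m t n mtn _ _ _ (fun=> diag_conditions I I) _ m2 _ _ _ _ _ Q).
- by move=> _ p; apply: diag_conditions_ins.
- by move=> i; apply: basis_unit_row; [lia | apply: leq_trans (zih i) _].
- move=> i; apply: (@extension_example_odd K m m h) => // q qh _.
  have qI : q \in I by rewrite mem_iota.
  by split; [apply: mem_diag_conditions0 | apply: mem_diag_conditions1].
- by move=> i j; apply: C.
- by move=> i; apply: mem_diag_ins.
Qed.

(** Of the 2h+1 conditions that a group lacks, independence takes 2h from the h points other than
    (e_2, eta_2) and one from an added vector (e_2, eta_2, l0), whence the summand [t]. For spanning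
    (e_2, eta_2) is a point. *)
Lemma fill_diag_even : (m = h.*2)%N -> (4 * h ^ 3 - 3 * h <= t)%N ->
  fill K m n (h + t * m.+1) (m.-1 * 'C(m, 2) + (m - h) * m.*2 + t) /\
  fill K m n (h + t * m.+1).+1 0.
Proof.
move=> mh ht; have m2 : (2 <= m)%N by lia.
have me : ~~ odd m by lia.
have hm : (h < m)%N by lia.
have C (i j : 'I_t) : i != j -> exists c1 c2,
    cross_ok (eV 1) (eV 1) (Some (eV 2)) (Some (eV 2)) c1 c2.
  by move=> _; apply: cross_example_even => //; right.
have B (i : 'I_t) := @basis_unit_row2 m m2.
split.
  pose I0 := iota 0 h.+1; pose I1 := [seq q <- I0 | q != 2%N].
  have m2' : (2 < m)%N by lia.
  pose A := ([set q : 'I_m | (q < h.+1)%N] :\ Ordinal m2')%SET.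
  have cA : #|A| = h.
    have := cardsD1 (Ordinal m2') [set q : 'I_m | (q < h.+1)%N]%SET.
    by rewrite card_ord_lt // inE /= -/A; lia.
  have := @fill_diagonal K m t n A (fun=> eV 1) (fun=> Some (eV 2))
    (fun=> eU 2 - eU 1) (fun=> diag_conditions I0 I1) 'I_t
    (fun i => (eV 2, eU 2 *m base_mx K m n, 'e_0 *m plane_mx K m n i)) mtn m2.
  rewrite cA card_ord; apply => //.
  - move=> i p /diag_conditionsP[q [pE qI]]; have [q2|q2] := eqVneq q 2%N.
      case: qI => -[]; last by rewrite mem_filter q2.
      by move=> _ p2; right; exists i; rewrite pE p2 q2.
    have qh : (q < h.+1)%N by case: qI => -[]; rewrite ?mem_filter ?q2 mem_iota.
    by left; exists (Ordinal (leq_trans qh hm)); rewrite // !inE -val_eqE /= q2.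
  - move=> i; apply: (@extension_example_even K m m h) => // q qh.
      by apply: mem_diag_conditions0; rewrite mem_iota.
    by move=> q2; apply: mem_diag_conditions1; rewrite mem_filter q2 mem_iota.
have Q := @diag_core_singles K m m t h (fun=> Some (eV 2)) (fun=> eU 2 - eU 1)
  (fun=> eV 1) (eU 2) erefl mh h2 ht.
pose I := iota 0 h.+1.
have -> : ((h + t * m.+1).+1 = size (diag_ins K m m h) + t * m.+1)%N.
  by rewrite size_map size_iota addSn.
apply: (@fill_singles K m m t n mtn _ _ _ (fun=> diag_conditions I I) _ m2 _ B _ C
  (fun=> eV 2) (fun=> eU 1) (eU 2) _ _ _ _ _ Q) => //.
- by move=> _ p; apply: diag_conditions_ins.
- move=> i; apply: (@extension_example_even K m m h) => // q qh.
    by apply: mem_diag_conditions0; rewrite mem_iota.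
  by move=> _; apply: mem_diag_conditions1; rewrite mem_iota.
- by lia.
- by move=> i; apply: mem_diag_ins; lia.
- by move=> i; apply: mem_diag_ins.
Qed.

End Diagonal.
End Cases.

(** * Arithmetic of the bounds *)

Section Nondefective.
Variables (K : numFieldType) (m n : nat).
Local Notation N1 := (sv_N m n).+1.

Lemma nondefective_of_fill_triples b r : (0 < b)%N -> (N1 = b * (m + n).+1 + r)%N ->
  (r <= (m + n).+1)%N -> fill K m n b r -> fill K m n b.+1 0 ->
  forall s, (0 < s)%N -> nondefective s (@segre_veronese K m n).
Proof.
move=> b0 NE rle Fb Fb1; apply: (@nondefective_of_critical_fill K m n b) => //.
- by rewrite NE leq_addr.
- by rewrite NE mulSn addnC leq_add2r.
- by rewrite NE addKn.
Qed.

Lemma sv_N_double : (N1.*2 = m.+1 * (n.+2 * n.+1))%N.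
Proof. by rewrite /sv_N prednK ?muln_gt0 ?bin_gt0 // doubleMr bin2_double. Qed.

(** With U of dimension m-1 the critical number is t(m+1), and the remainder is (m+1) C(m,2). *)
Lemma nondefective_same_parity s : (3 <= m)%N -> odd m = odd n ->
  (m ^ 3 <= 2 * n + 2 * m + 5)%N -> (0 < s)%N -> nondefective s (@segre_veronese K m n).
Proof.
move=> m3 mn mle s0; have [e mE] : exists e, m = e.+2 by exists m.-2; lia.
have [t tE] : exists t, (m + t.*2 = n.+2)%N.
  exists (n.+2 - m)./2; have : (m <= n.+2)%N.
    by move: mle; rewrite !expnS expn0 muln1; nia.
  by move=> mn2; lia.
have etn : (e.+1 + t.*2 = n.+1)%N by lia.
have mt : (m ^ 3 <= 4 * t + 4 * m + 1)%N by lia.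
have e1 : (1 <= e)%N by lia.
move: mt; rewrite mE => mt; have [F1 F2] := fill_point K e1 etn mt.
have t0 : (0 < t)%N.
  by move: mt; rewrite !expnS expn0 muln1; nia.
move: F1 F2; rewrite -mE => F1 F2.
apply: (nondefective_of_fill_triples _ _ _ F1 F2 s0).
- by rewrite muln_gt0 t0.
- apply: double_inj; rewrite sv_N_double doubleD.
  have -> : ((sv_N m e).+1.*2 = m.+1 * (e.+2 * e.+1))%N.
    by rewrite /sv_N prednK ?muln_gt0 ?bin_gt0 // doubleMr bin2_double.
  have -> : (n.+2 = e.+2 + t.*2)%N by lia.
  have -> : n.+1 = (e.+1 + t.*2)%N by lia.
  have -> : (m + n).+1 = (e + e + 3 + t.*2)%N by lia.
  by rewrite mE -!mul2n; ring.
rewrite -leq_double.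
have -> : ((sv_N m e).+1.*2 = m.+1 * (e.+2 * e.+1))%N.
  by rewrite /sv_N prednK ?muln_gt0 ?bin_gt0 // doubleMr bin2_double.
by move: mt; rewrite mE !expnS expn0 muln1; nia.
Qed.

Lemma nondefective_odd_even s : (3 <= m)%N -> odd m -> ~~ odd n ->
  (m ^ 3 <= 2 * n + 2 * m + 5)%N -> (0 < s)%N -> nondefective s (@segre_veronese K m n).
Proof.
move=> m3 mo ne mle s0.
have [h mh] : exists h, (m.+1 = h.*2)%N by exists (m.+1)./2; lia.
have [t tE] : exists t, (m + t.*2 = n.+1)%N.
  exists (n.+1 - m)./2; have : (m <= n.+1)%N.
    by move: mle; rewrite !expnS expn0 muln1; nia.
  by move=> mn2; lia.
have h2 : (2 <= h)%N by lia.
have [k kE] : exists k, h = k.+2 by exists h.-2; lia.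
have mE : m = (k.*2 + 3)%N by lia.
(* This inequality provides enough conditions on V x U x U and also says that the remainder is at
   most m+n+1. *)
have ht : (2 * h ^ 3 + 1 <= t + 3 * h ^ 2 + h)%N.
  have : (m ^ 3 <= 4 * t + 4 * m + 3)%N by lia.
  by rewrite kE mE !expnS !expn0 !muln1 -!mul2n; nia.
have [F1 F2] := fill_diag_odd K h2 tE mh ht.
apply: (nondefective_of_fill_triples _ _ _ F1 F2 s0); first by lia.
- apply: double_inj; rewrite sv_N_double doubleD doubleD (doubleMr m.-1).
  have -> : (m = k.*2.+2.+1)%N by lia.
  rewrite bin2_double (_ : k.*2.+3 - h = k.+1)%N; last by lia.
  have -> : (n.+2 = k.*2.+2.+2 + t.*2)%N by lia.
  have -> : n.+1 = (k.*2.+3 + t.*2)%N by lia.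
  have -> : n = (k.*2.+2 + t.*2)%N by lia.
  by rewrite /= kE -!mul2n; ring.
rewrite -leq_double doubleD (doubleMr m.-1).
have -> : (m = k.*2.+2.+1)%N by lia.
rewrite bin2_double (_ : k.*2.+3 - h = k.+1)%N; last by lia.
have -> : n = (k.*2.+2 + t.*2)%N by lia.
by move: ht; rewrite /= kE !expnS !expn0 !muln1 -!mul2n; nia.
Qed.

Lemma nondefective_even_odd s : (3 <= m)%N -> ~~ odd m -> odd n ->
  (m ^ 3 <= n + m + 3)%N -> (0 < s)%N -> nondefective s (@segre_veronese K m n).
Proof.
move=> m3 me no mle s0.
have [h mh] : exists h, (m = h.*2)%N by exists m./2; lia.
have [t tE] : exists t, (m + t.*2 = n.+1)%N.
  exists (n.+1 - m)./2; have : (m <= n.+1)%N.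
    by move: mle; rewrite !expnS expn0 muln1; nia.
  by move=> mn2; lia.
have h2 : (2 <= h)%N by lia.
have [k kE] : exists k, h = k.+2 by exists h.-2; lia.
have mE : m = (k.*2.+3.+1)%N by lia.
have ht : (4 * h ^ 3 - 3 * h <= t)%N.
  have : (m ^ 3 <= t.*2 + 2 * m + 2)%N by lia.
  by rewrite kE mE !expnS !expn0 !muln1 -!mul2n; nia.
have [F1 F2] := fill_diag_even K h2 tE mh ht.
apply: (nondefective_of_fill_triples _ _ _ F1 F2 s0); first by lia.
- apply: double_inj; rewrite sv_N_double !doubleD (doubleMr m.-1).
  rewrite mE bin2_double (_ : k.*2.+4 - h = k.+2)%N; last by lia.
  have -> : (n.+2 = k.*2.+4.+1 + t.*2)%N by lia.
  have -> : n.+1 = (k.*2.+4 + t.*2)%N by lia.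
  have -> : n = (k.*2.+3 + t.*2)%N by lia.
  by rewrite /= kE -!mul2n; ring.
rewrite -leq_double !doubleD (doubleMr m.-1).
rewrite mE bin2_double (_ : k.*2.+4 - h = k.+2)%N; last by lia.
have -> : n = (k.*2.+3 + t.*2)%N by lia.
by move: ht; rewrite /= kE !expnS !expn0 !muln1 -!mul2n; nia.
Qed.

End Nondefective.

From mathcomp Require Import reals complex.

Local Close Scope classical_set_scope.
Local Close Scope ring_scope.

Theorem theorem1p1 (R : realType) (m n : nat) (hm : 3 <= m)
  (hn : if ~~ odd m && odd n then m ^ 3 - m - 3 <= n
        else uphalf (m ^ 3 - 2 * m - 5) <= n)
  (s : nat) (hs : 1 <= s) :
  nondefective s (@segre_veronese R[i] m n).
Proof.
(* Cleared of subtraction and [uphalf], the bounds read m^3 <= n + m + 3 and m^3 <= 2n + 2m + 5. *)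
case mo: (odd m) hn => /=; case no: (odd n) => hn.
- by apply: nondefective_same_parity => //; rewrite ?mo ?no //; lia.
- by apply: nondefective_odd_even; rewrite ?mo ?no //; lia.
- by apply: nondefective_even_odd; rewrite ?mo ?no //; lia.
- by apply: nondefective_same_parity => //; rewrite ?mo ?no //; lia.
Qed.
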